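(* Every slice Fueter-regular function $f:\Omega_D\to\mathbb{O}$ is real analytic. Equivalently, the stem function inducing any slice Fueter-regular function is real analytic.
   Context: Octonions: $\mathbb{O}=\mathbb{H}+\ell\mathbb{H}$ with product $(a+\ell b)(c+\ell d)=(ac-d\bar b)+\ell(\bar a d+cb)$ and conjugation $\overline{a+\ell b}=\bar a-\ell b$; $\mathbb{O}$ is identified with $\mathbb{R}^8$ via the basis $(1,i,j,k,\ell,\ell i,\ell j,\ell k)$. $\mathbb{S}=\{I\in\mathbb{O}:I^2=-1\}$. Let $D\subset\mathbb{R}^2$ be a non-empty open set invariant under $(\alpha,\beta)\mapsto(\alpha,-\beta)$, $\Omega_D=\{\alpha+\beta I:(\alpha,\beta)\in D,I\in\mathbb{S}\}$, assumed connected. A stem function is $F=(F_1,F_2):D\to\mathbb{O}^2$ with $F_1$ even and $F_2$ odd in the second variable; $f:\Omega_D\to\mathbb{O}$ is a slice function induced by $F$ if $f(\alpha+\beta I)=F_1(\alpha,\beta)+IF_2(\alpha,\beta)$ for all $(\alpha,\beta)\in D,I\in\mathbb{S}$. Let $E=\{(x_0,x_1,x_2,x_3)\in\mathbb{R}^4:(x_0,(x_1^2+x_2^2+x_3^2)^{1/2})\in D\}$; $O(3)$ denotes the real orthogonal $4\times4$ matrices fixing the first canonical basis vector, acting on $\mathbb{R}^4$ and $\mathbb{O}^4$ by matrix–column multiplication. $\mathcal N=\{(I,J)\in\mathbb{S}^2:I\perp J\}$. An $O(3)$-stem function is $\mathcal F=(\mathcal F_0,\dots,\mathcal F_3):E\to\mathbb{O}^4$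 with $\mathcal F(Av)=A\mathcal F(v)$ for $A\in O(3)$; it induces the well-defined function $f:\Omega_D\to\mathbb{O}$, $f(x_0+x_1I+x_2J+x_3(IJ))=\mathcal F_0(v)+I\mathcal F_1(v)+J\mathcal F_2(v)+(IJ)\mathcal F_3(v)$ for $v=(x_0,\dots,x_3)\in E$, $(I,J)\in\mathcal N$ (every point of $\Omega_D$ is of this form). Such $f$ is always a slice function. $f$ is slice Fueter-regular if it is induced by an $O(3)$-stem function $\mathcal F$ of class $C^1$ satisfying on $E$ (with $\partial_h=\partial/\partial x_h$): $\partial_0\mathcal F_0-\partial_1\mathcal F_1-\partial_2\mathcal F_2-\partial_3\mathcal F_3=0$, $\partial_1\mathcal F_0+\partial_0\mathcal F_1-\partial_3\mathcal F_2+\partial_2\mathcal F_3=0$, $\partial_2\mathcal F_0+\partial_3\mathcal F_1+\partial_0\mathcal F_2-\partial_1\mathcal F_3=0$, $\partial_3\mathcal F_0-\partial_2\mathcal F_1+\partial_1\mathcal F_2+\partial_0\mathcal F_3=0$. *)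

(* Defs.v *)
From HB Require Import structures.
From mathcomp Require Import all_boot all_order all_algebra.
From mathcomp Require Import all_classical all_reals all_analysis.
Set Implicit Arguments. Unset Strict Implicit. Unset Printing Implicit Defensive.
Import Order.TTheory GRing.Theory Num.Theory.
Import numFieldNormedType.Exports.
Local Open Scope ring_scope.
Local Open Scope classical_set_scope.

Record quat (R : Type) := Quat { qr : R; qi : R; qj : R; qk : R }.

Section Octonions.
Variable R : realType.

Definition qadd (a b : quat R) : quat R :=
  Quat (qr a + qr b) (qi a + qi b) (qj a + qj b) (qk a + qk b).
Definition qsub (a b : quat R) : quat R :=
  Quat (qr a - qr b) (qi a - qi b) (qj a - qj b) (qk a - qk b).
Definition qconj (a : quat R) : quat R :=
  Quat (qr a) (- qi a) (- qj a) (- qk a).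
Definition qmul (a b : quat R) : quat R :=
  Quat (qr a * qr b - qi a * qi b - qj a * qj b - qk a * qk b)
       (qr a * qi b + qi a * qr b + qj a * qk b - qk a * qj b)
       (qr a * qj b - qi a * qk b + qj a * qr b + qk a * qi b)
       (qr a * qk b + qi a * qj b - qj a * qi b + qk a * qr b).

(* ---------- Octonions O = H + l H, identified with R^8 (column vectors)
   via the basis (1,i,j,k,l,li,lj,lk): coordinates 0..3 are the first
   quaternion a, coordinates 4..7 the second quaternion b of a + l b. ---- *)
Definition oct := 'cV[R]_8.

Definition oq1 (x : oct) : quat R :=
  Quat (x (inord 0) 0) (x (inord 1) 0) (x (inord 2) 0) (x (inord 3) 0).
Definition oq2 (x : oct) : quat R :=
  Quat (x (inord 4) 0) (x (inord 5) 0) (x (inord 6) 0) (x (inord 7) 0).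
Definition mkO (a b : quat R) : oct :=
  \col_(i < 8) match val i with
               | 0 => qr a | 1 => qi a | 2 => qj a | 3 => qk a
               | 4 => qr b | 5 => qi b | 6 => qj b | _ => qk b end.

(* (a + l b)(c + l d) = (ac - d conj(b)) + l (conj(a) d + c b) *)
Definition omul (x y : oct) : oct :=
  let a := oq1 x in let b := oq2 x in let c := oq1 y in let d := oq2 y in
  mkO (qsub (qmul a c) (qmul d (qconj b))) (qadd (qmul (qconj a) d) (qmul c b)).

Definition oone : oct := mkO (Quat 1 0 0 0) (Quat 0 0 0 0).
Definition oreal (a : R) : oct := a *: oone.

Definition odot (x y : oct) : R := \sum_(i < 8) x i 0 * y i 0.

Definition osphere : set oct := [set I | omul I I = - oone].

Definition oN : set (oct * oct) :=
  [set IJ | osphere IJ.1 /\ osphere IJ.2 /\ odot IJ.1 IJ.2 = 0].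

Definition OmegaD (D : set (R * R)) : set oct :=
  [set x | exists a b I, D (a, b) /\ osphere I /\ x = oreal a + b *: I].

Definition c4 (v : 'cV[R]_4) (h : nat) : R := v (inord h) 0.

Definition ED (D : set (R * R)) : set 'cV[R]_4 :=
  [set v | D (c4 v 0, Num.sqrt (c4 v 1 ^+ 2 + c4 v 2 ^+ 2 + c4 v 3 ^+ 2))].

Definition e4 (h : nat) : 'cV[R]_4 := delta_mx (inord h) 0.

Definition O3 : set 'M[R]_4 :=
  [set A | A^T *m A = 1%:M /\ A *m e4 0 = e4 0].

Definition o3_stem (D : set (R * R)) (F : 'cV[R]_4 -> 'I_4 -> oct) : Prop :=
  forall A, O3 A -> forall v, ED D v ->
    forall r : 'I_4, F (A *m v) r = \sum_(s < 4) A r s *: F v s.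

Definition o3_induces (D : set (R * R)) (F : 'cV[R]_4 -> 'I_4 -> oct)
  (f : oct -> oct) : Prop :=
  forall v, ED D v -> forall I J, oN (I, J) ->
    f (oreal (c4 v 0) + c4 v 1 *: I + c4 v 2 *: J + c4 v 3 *: omul I J)
    = F v (inord 0) + omul I (F v (inord 1)) + omul J (F v (inord 2))
      + omul (omul I J) (F v (inord 3)).

Definition pd (F : 'cV[R]_4 -> 'I_4 -> oct) (r h : nat) (v : 'cV[R]_4) : oct :=
  'D_(e4 h) (fun w => F w (inord r)) v.

Definition C1_on (D : set (R * R)) (F : 'cV[R]_4 -> 'I_4 -> oct) : Prop :=
  forall (r : 'I_4) (h : nat), (h < 4)%N ->
    forall v, ED D v ->
      derivable (fun w => F w r) v (e4 h) /\
      {for v, continuous ('D_(e4 h) (fun w => F w r))}.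

Definition fueter_system (D : set (R * R)) (F : 'cV[R]_4 -> 'I_4 -> oct) : Prop :=
  forall v, ED D v -> [/\
    pd F 0 0 v - pd F 1 1 v - pd F 2 2 v - pd F 3 3 v = 0,
    pd F 0 1 v + pd F 1 0 v - pd F 2 3 v + pd F 3 2 v = 0,
    pd F 0 2 v + pd F 1 3 v + pd F 2 0 v - pd F 3 1 v = 0 &
    pd F 0 3 v - pd F 1 2 v + pd F 2 1 v + pd F 3 0 v = 0].

Definition slice_fueter_regular (D : set (R * R)) (f : oct -> oct) : Prop :=
  exists F : 'cV[R]_4 -> 'I_4 -> oct,
    [/\ o3_stem D F, C1_on D F, fueter_system D F & o3_induces D F f].

(* g : R^n -> R is real analytic at p: on some ball around p it is the sum of
   an absolutely convergent power series centred at p (partial sums taken over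
   the boxes of multi-indices with all entries <= N). *)
Definition analytic_at (n : nat) (g : 'cV[R]_n -> R) (p : 'cV[R]_n) : Prop :=
  exists r : R, 0 < r /\ exists a : ('I_n -> nat) -> R,
    forall x, ball p r x ->
      (exists M : R, forall N : nat,
         \sum_(al : {ffun 'I_n -> 'I_N.+1})
            `|a (fun i => nat_of_ord (al i))| *
            \prod_(i < n) `|x i 0 - p i 0| ^+ al i <= M) /\
      ((fun N : nat =>
         \sum_(al : {ffun 'I_n -> 'I_N.+1})
            a (fun i => nat_of_ord (al i)) *
            \prod_(i < n) (x i 0 - p i 0) ^+ al i) @ \oo --> g x).

Definition real_analytic_on (n m : nat) (A : set 'cV[R]_n)
  (f : 'cV[R]_n -> 'cV[R]_m) : Prop :=
  forall p, A p -> forall k : 'I_m, analytic_at (fun x => f x k 0) p.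

End Octonions.

(* Main.v *)
Require Import Defs.
From HB Require Import structures.
From mathcomp Require Import all_boot all_order all_algebra.
From mathcomp Require Import mpoly.
From mathcomp Require Import all_classical all_reals all_analysis.
From mathcomp Require Import ring lra.
Set Implicit Arguments. Unset Strict Implicit. Unset Printing Implicit Defensive.
Import Order.TTheory GRing.Theory Num.Theory.
Import numFieldTopology.Exports numFieldNormedType.Exports.
Local Open Scope ring_scope.
Local Open Scope classical_set_scope.

(* Fix a coordinate of the octonions.  On the plane [x2 = x3 = 0] the
   equivariance under O(3) leaves only [u = F_0], even in the second variable
   [b], and [v = F_1], odd in [b], and the Fueter system becomes
   [u_b + v_a = 0] and [b (u_a - v_b) = 2 v].  The first equation gives a
   potential [phi] with [phi_a = u] and [phi_b = - v]; by the second one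
   [b phi] is harmonic, that is, [b u + i (b v - phi)] is a holomorphic
   function of class C1, so the Cauchy formula expands it in a power series.
   The value of the slice function at [x] is [u] plus [Im x] times [v / b],
   both taken at [(Re x, b)] with [b = |Im x|].  If [Im x] is not zero, [b] is
   analytic near [x] and the series can be composed with it; if [Im x] is
   zero, parity turns the series into series of polynomials in [Re x] and
   [b ^ 2], which are polynomials in [x]. *)

(** * Weighted norms of polynomials *)

(** Why [b phi] is harmonic: the second equation says that [phi_aa + phi_bb + (2 / b) phi_b = 0],
    the Laplace equation in four variables for a function symmetric about the real axis, and with
    three transverse dimensions the left side is [1 / b] times the plane Laplacian of [b phi]. As
    [u] and [v] are only C1, holomorphy is used at first order, for the two partial derivatives of
    [b phi], and the Cauchy formula is proved for C1 pairs of real functions by shrinking the circle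
    to a point. The obstacle is the division by [b] at the real axis. There [v / b] is recovered
    from [b ^ 3] times itself, and what makes the quotient a series of polynomials is a cancellation
    between the series of [b v - phi] and that of [b phi]. Constants come from one normalisation:
    after a local rescaling [u] and [v] live on the square of half-side 2, the potential on that of
    half-side 3/2, the contour is the unit circle, and the series are used for coordinates at most
    1/4, where the modulus is below 1/2; hence the ratio 1/2 in the estimates. *)

Section WeightedNorm.
Variables (R : realType) (n : nat).
Implicit Types (p q : {mpoly R[n]}) (r : R).

(** The norm of the Banach algebra of power series that converge absolutely on the closed polydisc
    of radius [r]; it is submultiplicative and dominates the values on that polydisc. *)
Definition mnorm r p : R := \sum_(m <- msupp p) `|p@_m| * r ^+ mdeg m.

(** Supports vary from one polynomial to another; this moves several sums to one common list of
    monomials. *)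
Lemma sum_msupp_superset (V : nmodType) p (F : 'X_{1..n} -> V)
    (s : seq 'X_{1..n}) :
  uniq s -> {subset msupp p <= s} -> (forall m, p@_m = 0 -> F m = 0) ->
  \sum_(m <- msupp p) F m = \sum_(m <- s) F m.
Proof.
move=> us sub F0; rewrite [RHS](bigID (mem (msupp p))) /=.
rewrite [X in _ + X]big1 ?addr0; last first.
  by move=> m /negbTE ms; apply: F0; apply/eqP; rewrite mcoeff_eq0 ms.
rewrite -[RHS]big_filter; apply: perm_big; apply: uniq_perm.
- exact: msupp_uniq.
- exact: filter_uniq.
by move=> m; rewrite mem_filter /=; case: (boolP (m \in msupp p)) => //= /sub ->.
Qed.

Lemma mnorm_superset r p (s : seq 'X_{1..n}) :
  uniq s -> {subset msupp p <= s} ->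
  mnorm r p = \sum_(m <- s) `|p@_m| * r ^+ mdeg m.
Proof.
move=> us sub; apply: sum_msupp_superset => // m ->.
by rewrite normr0 mul0r.
Qed.

Lemma sum_uniq_le_mnorm r p (s : seq 'X_{1..n}) : 0 <= r -> uniq s ->
  \sum_(m <- s) `|p@_m| * r ^+ mdeg m <= mnorm r p.
Proof.
move=> r0 us.
rewrite (@mnorm_superset r p (s ++ [seq m <- msupp p | m \notin s])).
- rewrite big_cat /= lerDl; apply: sumr_ge0 => m _.
  by rewrite mulr_ge0 ?exprn_ge0.
- rewrite cat_uniq us filter_uniq ?msupp_uniq // andbT.
  by apply/hasPn => m; rewrite mem_filter => /andP[].
- move=> m mp; rewrite mem_cat mem_filter mp andbT; exact: orbN.
Qed.

Lemma mnorm_ge0 r p : 0 <= r -> 0 <= mnorm r p.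
Proof. by move=> r0; apply: sumr_ge0 => m _; rewrite mulr_ge0 ?exprn_ge0. Qed.

Lemma mnorm0 r : mnorm r 0 = 0.
Proof. by rewrite /mnorm -mpolyC0 msupp0 big_nil. Qed.

Lemma mnormN r p : mnorm r (- p) = mnorm r p.
Proof.
rewrite /mnorm (perm_big _ (msuppN p)) /=.
by apply: eq_bigr => m _; rewrite mcoeffN normrN.
Qed.

Lemma ler_mnormD r p q : 0 <= r -> mnorm r (p + q) <= mnorm r p + mnorm r q.
Proof.
move=> r0; pose s := undup (msupp p ++ msupp q).
have us : uniq s by apply: undup_uniq.
rewrite (mnorm_superset _ us); last first.
  by move=> m /msuppD_le; rewrite mem_undup.
rewrite (mnorm_superset r us (p := p)); last first.
  by move=> m mp; rewrite mem_undup mem_cat mp.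
rewrite (mnorm_superset r us (p := q)); last first.
  by move=> m mp; rewrite mem_undup mem_cat mp orbT.
rewrite -big_split /=; apply: ler_sum => m _.
by rewrite -mulrDl ler_wpM2r ?exprn_ge0 // mcoeffD ler_normD.
Qed.

Lemma ler_mnormB r p q : 0 <= r -> mnorm r (p - q) <= mnorm r p + mnorm r q.
Proof. by move=> r0; rewrite -(mnormN r q); exact: ler_mnormD. Qed.

Lemma ler_mnorm_sum r (I : Type) (s : seq I) (P : pred I)
    (F : I -> {mpoly R[n]}) : 0 <= r ->
  mnorm r (\sum_(i <- s | P i) F i) <= \sum_(i <- s | P i) mnorm r (F i).
Proof.
move=> r0; elim/big_rec2: _ => [|i x y _ h]; first by rewrite mnorm0.
by apply: le_trans (ler_mnormD _ _ r0) _; rewrite lerD2l.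
Qed.

Lemma mnormZX r (c : R) m : mnorm r (c *: 'X_[m]) = `|c| * r ^+ mdeg m.
Proof.
rewrite (@mnorm_superset r _ [:: m]) //; last first.
  by move=> k /msuppZ_le; rewrite msuppX.
by rewrite big_seq1 mcoeffZ mcoeffX eqxx mulr1.
Qed.

Lemma mnormC r (c : R) : mnorm r (c%:MP_[n]) = `|c|.
Proof. by rewrite -[c%:MP]mulr1 mul_mpolyC -mpolyX0 mnormZX mdeg0 mulr1. Qed.

Lemma mnorm1 r : mnorm r 1 = 1.
Proof. by rewrite -mpolyC1 mnormC normr1. Qed.

Lemma mnormX r i : mnorm r 'X_i = r.
Proof. by rewrite -[X in mnorm _ X]scale1r mnormZX mdeg1 normr1 mul1r. Qed.

Lemma mnormZ r (c : R) p : mnorm r (c *: p) = `|c| * mnorm r p.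
Proof.
rewrite (@mnorm_superset r _ (msupp p)) ?msupp_uniq //; last first.
  exact: msuppZ_le.
rewrite /mnorm mulr_sumr; apply: eq_bigr => m _.
by rewrite mcoeffZ normrM mulrA.
Qed.

Lemma ler_mnormM r p q : 0 <= r -> mnorm r (p * q) <= mnorm r p * mnorm r q.
Proof.
move=> r0; rewrite mpolyME.
rewrite big_allpairs /=.
apply: le_trans (ler_mnorm_sum _ _ _ r0) _.
rewrite /mnorm mulr_suml; apply: ler_sum => m1 _.
apply: le_trans (ler_mnorm_sum _ _ _ r0) _.
rewrite mulr_sumr; apply: ler_sum => m2 _.
by rewrite mnormZX mdegD exprD normrM mulrACA.
Qed.

Lemma ler_norm_meval r p (y : 'I_n -> R) :
  (forall i, `|y i| <= r) -> `|p.@[y]| <= mnorm r p.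
Proof.
move=> yr; rewrite mevalE; apply: le_trans (ler_norm_sum _ _ _) _.
apply: ler_sum => m _; rewrite normrM ler_wpM2l // normr_prod mdegE -prodrXr.
by apply: ler_prod => i _; rewrite normrX exprn_ge0 //= lerXn2r ?nnegrE // (le_trans _ (yr i)).
Qed.

Lemma ler_mnorm_radius r r' p : 0 <= r' -> r' <= r -> mnorm r' p <= mnorm r p.
Proof.
move=> r0 rr; apply: ler_sum => m _; rewrite ler_wpM2l //.
by rewrite lerXn2r ?nnegrE // (le_trans r0).
Qed.

(** Without constant term every monomial carries a factor [r], so [mnorm r p <= r * mnorm 1 p] for
    [r <= 1]. The [+ 1] in the witness keeps the denominator positive. *)
Lemma mnorm_small p (e : R) : p@_0 = 0 -> 0 < e ->
  exists2 d : R, 0 < d & forall r, 0 <= r -> r <= d -> mnorm r p <= e.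
Proof.
move=> p0 e0; exists (Num.min 1 (e / (mnorm 1 p + 1))).
  by rewrite lt_min ltr01 divr_gt0 // ltr_wpDl ?mnorm_ge0.
move=> r r0; rewrite le_min => /andP[r1 re].
have M0 : 0 < mnorm 1 p + 1 by rewrite ltr_wpDl ?mnorm_ge0.
apply: (@le_trans _ _ (r * mnorm 1 p)).
  rewrite /mnorm mulr_sumr [leLHS]big_seq [leRHS]big_seq; apply: ler_sum => m mp.
  rewrite expr1n mulr1 mulrC ler_wpM2r //.
  case E : (mdeg m) => [|k].
    move/eqP: E; rewrite mdeg_eq0 => /eqP E; move: mp.
    by rewrite E mcoeff_msupp p0 eqxx.
  by rewrite exprS ler_piMr // exprn_ile1.
rewrite ler_pdivlMr // in re; apply: le_trans re.
by rewrite ler_wpM2l // lerDl.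
Qed.

End WeightedNorm.

(** * Analytic germs as limits of polynomials *)

Section AnalyticLimits.
Variables (R : realType) (n : nat).
Implicit Types (r : R) (S T : nat -> {mpoly R[n]}) (g : 'cV[R]_n -> R).
Implicit Types (p x : 'cV[R]_n).

(* A function is analytic at [p] as soon as, near [p], it is a pointwise limit
   of polynomials in [x - p] forming a Cauchy sequence for a weighted l1 norm:
   the power series is the limit in the completion.  In this form sums,
   products and compositions need no manipulation of multi-indices. *)
Definition mcauchy r S := forall e : R, 0 < e ->
  exists N, forall i j, (N <= i)%N -> (N <= j)%N -> mnorm r (S i - S j) <= e.

Definition shift_eval (P : {mpoly R[n]}) p x : R := P.@[fun i => x i 0 - p i 0].

Definition poly_limit r p g := exists2 S, mcauchy r S &
  forall x, ball p r x -> (fun k => shift_eval (S k) p x) @ \oo --> g x.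

Definition germ_analytic p g := exists2 r, 0 < r & poly_limit r p g.

Lemma ball_coord r p x : ball p r x -> forall i, `|x i 0 - p i 0| <= r.
Proof. by case=> _ b i; rewrite distrC ltW //; exact: (b i 0). Qed.

(** [analytic_at] sums over boxes of finite functions while polynomials are indexed by multinomials;
    this is the dictionary. *)
Definition box_mnm N (al : {ffun 'I_n -> 'I_N.+1}) : 'X_{1..n} :=
  [multinom nat_of_ord (al i) | i < n].

Lemma box_mnm_inj N : injective (@box_mnm N).
Proof.
move=> a b /mnmP ab; apply/ffunP => i; apply/val_inj.
by have := ab i; rewrite !mnmE.
Qed.

Lemma sum_box (V : nmodType) N (F : 'X_{1..n} -> V) :
  \sum_(al : {ffun 'I_n -> 'I_N.+1}) F (box_mnm al) =
  \sum_(m <- [seq box_mnm al | al <- index_enum {ffun 'I_n -> 'I_N.+1}]) F m.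
Proof. by rewrite big_map. Qed.

Lemma box_uniq N :
  uniq [seq box_mnm al | al <- index_enum {ffun 'I_n -> 'I_N.+1}].
Proof. by rewrite map_inj_uniq ?index_enum_uniq //; exact: box_mnm_inj. Qed.

Lemma sum_box_le_mnorm N r (P : {mpoly R[n]}) : 0 <= r ->
  \sum_(al : {ffun 'I_n -> 'I_N.+1})
     `|P@_(box_mnm al)| * r ^+ mdeg (box_mnm al) <= mnorm r P.
Proof.
move=> r0; rewrite (sum_box N (fun m => `|P@_m| * r ^+ mdeg m)).
by apply: sum_uniq_le_mnorm => //; exact: box_uniq.
Qed.

Lemma meval_box N (P : {mpoly R[n]}) (y : 'I_n -> R) : (msize P <= N)%N ->
  P.@[y] = \sum_(al : {ffun 'I_n -> 'I_N.+1})
     P@_(box_mnm al) * \prod_(i < n) y i ^+ al i.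
Proof.
move=> sP; pose F (m : 'X_{1..n}) := P@_m * \prod_i y i ^+ m i.
transitivity (\sum_(al : {ffun 'I_n -> 'I_N.+1}) F (box_mnm al)); last first.
  apply: eq_bigr => al _; rewrite /F; congr (_ * _).
  by apply: eq_bigr => i _; rewrite mnmE.
rewrite (sum_box N F) mevalE; apply: sum_msupp_superset.
- exact: box_uniq.
- move=> m mP; have dm : (mdeg m < N)%N := leq_trans (msize_mdeg_lt mP) sP.
  apply/mapP; exists [ffun i => inord (m i)]; first by rewrite mem_index_enum.
  apply/mnmP => i; rewrite mnmE ffunE inordK // ltnS.
  apply: leq_trans (ltnW dm); rewrite mdegE (bigD1 i) //=; exact: leq_addr.
- by move=> m; rewrite /F => ->; rewrite mul0r.
Qed.

Lemma norm_monomial_box N r (y : 'I_n -> R) (al : {ffun 'I_n -> 'I_N.+1}) :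
  (forall i, `|y i| <= r) ->
  \prod_(i < n) `|y i| ^+ al i <= r ^+ mdeg (box_mnm al).
Proof.
move=> yr; rewrite mdegE -prodrXr; apply: ler_prod => i _.
rewrite exprn_ge0 //= mnmE lerXn2r ?nnegrE //.
exact: le_trans (yr i).
Qed.

Section Coefficients.
Variables (r : R) (S : nat -> {mpoly R[n]}).
Hypotheses (r0 : 0 < r) (cS : mcauchy r S).


Lemma mcoeff_cvg m : cvg ((fun k => (S k)@_m) @ \oo).
Proof.
have rm : 0 < r ^+ mdeg m by rewrite exprn_gt0.
apply/cauchy_cvgP => A /=; rewrite -entourage_ballE => -[e /= e0 eA].
have e2 : 0 < e / 2 * r ^+ mdeg m by rewrite mulr_gt0 // divr_gt0.
have [N HN] := cS e2.
near=> u; apply: eA.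
(* A member of the product filter: the square of a tail of the sequence of coefficients. *)
near: u; exists ([set x | (exists2 i, (N <= i)%N & x = (S i)@_m)],
   [set x | (exists2 i, (N <= i)%N & x = (S i)@_m)]) => /=.
  by split; exists N => // i /= Ni; exists i.
move=> [a b] /= [[i Ni ->] [j Nj ->]]; rewrite /ball/=.
have := HN _ _ Ni Nj; move/(le_trans (@sum_uniq_le_mnorm _ _ r _ [:: m] (ltW r0) isT)).
rewrite big_seq1 ler_pM2r // mcoeffB => h; apply: le_lt_trans h _; lra.
Unshelve. all: by end_near.
Qed.

Definition lim_mcoeff (m : 'X_{1..n}) : R := lim ((fun k => (S k)@_m) @ \oo).

(** A Fatou argument: each box sum is finite, so the bound valid for every [S j] passes to the
    limit, uniformly in the box size [N]. *)
Lemma lim_mcoeff_box e K : 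
  (forall i j, (K <= i)%N -> (K <= j)%N -> mnorm r (S i - S j) <= e) ->
  forall N, \sum_(al : {ffun 'I_n -> 'I_N.+1})
     `|lim_mcoeff (box_mnm al) - (S K)@_(box_mnm al)| * r ^+ mdeg (box_mnm al)
     <= e.
Proof.
move=> HK N.
pose G j := \sum_(al : {ffun 'I_n -> 'I_N.+1})
     `|(S j)@_(box_mnm al) - (S K)@_(box_mnm al)| * r ^+ mdeg (box_mnm al).
have GL : G @ \oo --> \sum_(al : {ffun 'I_n -> 'I_N.+1})
     `|lim_mcoeff (box_mnm al) - (S K)@_(box_mnm al)| * r ^+ mdeg (box_mnm al).
  apply: cvg_big => [|al _]; first exact: add_continuous.
  apply: cvgM; last exact: cvg_cst.
  apply: cvg_norm; apply: cvgB; last exact: cvg_cst.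
  exact: mcoeff_cvg.
rewrite -(cvg_lim _ GL) //; apply: limr_le; first by apply/cvg_ex; eexists; exact: GL.
exists K => // j /= Kj; apply: le_trans (HK j K Kj (leqnn _)).
apply: le_trans (sum_box_le_mnorm N _ (ltW r0)).
by apply: ler_sum => al _; rewrite mcoeffB.
Qed.

End Coefficients.

(** The power series has the limit coefficients. Both its boundedness and its convergence come from
    comparison with a single [S K]: the box sums differ by little, uniformly in [N], and the box sum
    of [S K] is its exact value once [N] reaches [msize (S K)]. *)
Lemma poly_limit_analytic r p g : 0 < r -> poly_limit r p g -> analytic_at g p.
Proof.
move=> r0 [S cS Sg]; exists r; split=> //.
exists (fun k => lim_mcoeff S [multinom k i | i < n]) => x px.
have yr := ball_coord px; split.
  have [K HK] := cS _ ltr01; exists (1 + mnorm r (S K)) => N.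
  apply: (@le_trans _ _ (\sum_(al : {ffun 'I_n -> 'I_N.+1})
     (`|lim_mcoeff S (box_mnm al) - (S K)@_(box_mnm al)| * r ^+ mdeg (box_mnm al)
     + `|(S K)@_(box_mnm al)| * r ^+ mdeg (box_mnm al)))).
    apply: ler_sum => al _; rewrite -mulrDl.
    apply: ler_pM => //; first by apply: prodr_ge0 => i _; rewrite exprn_ge0.
      rewrite -[X in `|X| <= _](subrK (S K)@_(box_mnm al)).
      exact: ler_normD.
    exact: norm_monomial_box.
  rewrite big_split /=; apply: lerD; last exact: sum_box_le_mnorm (ltW r0).
  exact: lim_mcoeff_box.
apply/cvgrPdist_le => e e0; have e2 : 0 < e / 2 by rewrite divr_gt0.
have [K0 HK0] := cS _ e2.
have /cvgrPdist_le/(_ _ e2)[K1 _ HK1] := Sg x px.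
pose K := maxn K0 K1.
have {}HK1 := HK1 K (leq_maxr _ _).
have {}HK0 i j : (K <= i)%N -> (K <= j)%N -> mnorm r (S i - S j) <= e / 2.
  by move=> Ki Kj; apply: HK0; [exact: leq_trans (leq_maxl _ _) Ki|exact: leq_trans (leq_maxl _ _) Kj].
exists (msize (S K)) => // N /= HN.
rewrite -(subrKA (shift_eval (S K) p x)) [e]splitr.
apply: le_trans (ler_normD _ _) _; apply: lerD => //.
rewrite /shift_eval (meval_box _ HN) -sumrB.
apply: le_trans (ler_norm_sum _ _ _) _.
apply: le_trans (lim_mcoeff_box r0 cS HK0 N); apply: ler_sum => al _.
rewrite -mulrBl normrM distrC ler_wpM2l // normr_prod.
under eq_bigr do rewrite normrX.
exact: norm_monomial_box.
Qed.

Lemma germ_analyticP p g : germ_analytic p g -> analytic_at g p.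
Proof. by case=> r r0 /(poly_limit_analytic r0). Qed.

Lemma mcauchy_radius r r' S : 0 <= r' -> r' <= r -> mcauchy r S -> mcauchy r' S.
Proof.
move=> r0 rr cS e /cS[N HN]; exists N => i j Ni Nj.
exact: le_trans (ler_mnorm_radius _ r0 rr) (HN _ _ Ni Nj).
Qed.

Lemma mcauchy_bounded r S : 0 <= r -> mcauchy r S ->
  exists M : R, forall k, mnorm r (S k) <= M.
Proof.
move=> r0 /(_ _ ltr01)[N HN].
exists (1 + \sum_(i < N.+1) mnorm r (S i)) => k.
have S0 i : 0 <= mnorm r (S i) by exact: mnorm_ge0.
have [kN|Nk] := ltnP k N.+1.
  apply: (@le_trans _ _ (\sum_(i < N.+1) mnorm r (S i))); last by rewrite lerDr.
  by rewrite (bigD1 (Ordinal kN)) //= lerDl sumr_ge0.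
rewrite -[S k](subrK (S N)); apply: le_trans (ler_mnormD _ _ r0) _.
apply: lerD; first by apply: HN => //; exact: ltnW.
by rewrite (bigD1 (Ordinal (ltnSn N))) //= lerDl sumr_ge0.
Qed.

Lemma mcauchyD r S T : 0 <= r -> mcauchy r S -> mcauchy r T ->
  mcauchy r (fun k => S k + T k).
Proof.
move=> r0 cS cT e e0; have e2 : 0 < e / 2 by rewrite divr_gt0.
have [N1 H1] := cS _ e2; have [N2 H2] := cT _ e2.
exists (maxn N1 N2) => i j; rewrite !geq_max => /andP[i1 i2] /andP[j1 j2].
have -> : S i + T i - (S j + T j) = (S i - S j) + (T i - T j) by ring.
by apply: le_trans (ler_mnormD _ _ r0) _; rewrite [e]splitr lerD ?H1 ?H2.
Qed.

Lemma mcauchyM r S T : 0 <= r -> mcauchy r S -> mcauchy r T ->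
  mcauchy r (fun k => S k * T k).
Proof.
move=> r0 cS cT e e0.
have [M1 B1] := mcauchy_bounded r0 cS; have [M2 B2] := mcauchy_bounded r0 cT.
have M10 : 0 <= M1 := le_trans (mnorm_ge0 _ r0) (B1 0%N).
have M20 : 0 <= M2 := le_trans (mnorm_ge0 _ r0) (B2 0%N).
have e2 : 0 < e / (M1 + M2 + 1) by rewrite divr_gt0 //; lra.
have [N1 H1] := cS _ e2; have [N2 H2] := cT _ e2.
exists (maxn N1 N2) => i j; rewrite !geq_max => /andP[i1 i2] /andP[j1 j2].
have -> : S i * T i - S j * T j = (S i - S j) * T i + S j * (T i - T j) by ring.
apply: le_trans (ler_mnormD _ _ r0) _.
apply: (@le_trans _ _ (e / (M1 + M2 + 1) * M2 + M1 * (e / (M1 + M2 + 1)))).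
  apply: lerD; apply: le_trans (ler_mnormM _ _ r0) _.
    by apply: ler_pM; rewrite ?mnorm_ge0 ?H1.
  by apply: ler_pM; rewrite ?mnorm_ge0 ?H2.
rewrite [M1 * _]mulrC -mulrDr -mulrA ger_pMr // mulrC ler_pdivrMr; lra.
Qed.

Lemma mcauchy_cst r (P : {mpoly R[n]}) : mcauchy r (fun=> P).
Proof. by move=> e e0; exists 0%N => i j _ _; rewrite subrr mnorm0 ltW. Qed.

Lemma mcauchy_geometric r S (C : R) : 0 <= r -> 
  (forall k, mnorm r (S k.+1 - S k) <= C * 2^-1 ^+ k) -> mcauchy r S.
Proof.
move=> r0 HS.
have C0 : 0 <= C.
  by have := HS 0%N; rewrite expr0 mulr1; apply: le_trans; exact: mnorm_ge0.
have step k l : mnorm r (S (k + l)%N - S k) <= C * 2 * 2^-1 ^+ k.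
  (* The factor [1 - 2^-1 ^+ l] is the exact partial geometric sum; without it the induction on [l]
     does not close. *)
  suff : mnorm r (S (k + l)%N - S k) <= C * 2 * 2^-1 ^+ k * (1 - 2^-1 ^+ l).
    move/le_trans; apply; rewrite ler_piMr ?gerBl ?exprn_ge0 //.
    by rewrite mulr_ge0 ?exprn_ge0 ?mulr_ge0.
  elim: l => [|l IH]; first by rewrite addn0 subrr mnorm0 expr0 subrr mulr0.
  rewrite addnS -(subrKA (S (k + l)%N)).
  apply: le_trans (ler_mnormD _ _ r0) _.
  apply: le_trans (lerD (HS _) IH) _.
  rewrite exprD exprS.
  rewrite le_eqVlt; apply/orP; left; apply/eqP; by field.
move=> e e0.
have h0 : (fun k => C * 2 * (2^-1 : R) ^+ k) @ \oo --> (0 : R).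
  rewrite -[0](mulr0 (C * 2)); apply: cvgM; first exact: cvg_cst.
  by apply: cvg_expr; rewrite ger0_norm //; lra.
have e2 : 0 < e / 2 by rewrite divr_gt0.
move/cvgrPdist_le: h0 => /(_ _ e2)[N _ HN].
have {}HN := HN N (leqnn _).
have HN' k : (N <= k)%N -> mnorm r (S k - S N) <= e / 2.
  move=> /subnKC <-; apply: le_trans (step _ _) _; apply: le_trans HN.
  by rewrite sub0r normrN ler_norm.
exists N => i j Ni Nj; have -> : S i - S j = (S i - S N) - (S j - S N) by ring.
by apply: le_trans (ler_mnormB _ _ r0) _; rewrite [e]splitr lerD ?HN'.
Qed.

Lemma poly_limit_radius r r' p g : 0 <= r' -> r' <= r ->
  poly_limit r p g -> poly_limit r' p g.
Proof.
move=> r0 rr [S cS Sg]; exists S; first exact: mcauchy_radius rr cS.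
by move=> x px; apply: Sg; exact: le_ball px.
Qed.

Lemma poly_limitD r p g h : 0 <= r -> poly_limit r p g -> poly_limit r p h ->
  poly_limit r p (fun x => g x + h x).
Proof.
move=> r0 [S cS Sg] [T cT Th]; exists (fun k => S k + T k); first exact: mcauchyD.
move=> x px; rewrite /shift_eval; under eq_fun do rewrite mevalD.
by apply: cvgD; [exact: Sg|exact: Th].
Qed.

Lemma poly_limitM r p g h : 0 <= r -> poly_limit r p g -> poly_limit r p h ->
  poly_limit r p (fun x => g x * h x).
Proof.
move=> r0 [S cS Sg] [T cT Th]; exists (fun k => S k * T k); first exact: mcauchyM.
move=> x px; rewrite /shift_eval; under eq_fun do rewrite mevalM.
by apply: cvgM; [exact: Sg|exact: Th].
Qed.

Lemma poly_limit_poly r p (P : {mpoly R[n]}) : poly_limit r p (shift_eval P p).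
Proof. by exists (fun=> P); [exact: mcauchy_cst|move=> x _; exact: cvg_cst]. Qed.

Lemma germ_analytic_near p g h : germ_analytic p g ->
  (\forall x \near p, g x = h x) -> germ_analytic p h.
Proof.
move=> [r r0 lg] /nbhs_ballP[d /= d0 gh]; exists (Num.min r d).
  by rewrite lt_min r0.
have m0 : 0 <= Num.min r d by rewrite le_min !ltW.
have [|S cS Sg] := poly_limit_radius m0 _ lg; first by rewrite ge_min lexx.
exists S => // x px; rewrite -gh; first exact: Sg.
by apply: le_ball px; rewrite ge_min lexx orbT.
Qed.

Lemma germ_analytic_common p g h : germ_analytic p g -> germ_analytic p h ->
  exists2 r, 0 < r & poly_limit r p g /\ poly_limit r p h.
Proof.
move=> [r r0 lg] [s s0 lh]; have m0 : 0 < Num.min r s by rewrite lt_min r0.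
by exists (Num.min r s) => //; split;
  [apply: poly_limit_radius lg|apply: poly_limit_radius lh];
  rewrite ?(ltW m0) // ge_min lexx ?orbT.
Qed.

Lemma germ_analyticD p g h : germ_analytic p g -> germ_analytic p h ->
  germ_analytic p (fun x => g x + h x).
Proof.
move=> ag ah; have [r r0 [lg lh]] := germ_analytic_common ag ah.
by exists r => //; apply: poly_limitD => //; exact: ltW.
Qed.

Lemma germ_analyticM p g h : germ_analytic p g -> germ_analytic p h ->
  germ_analytic p (fun x => g x * h x).
Proof.
move=> ag ah; have [r r0 [lg lh]] := germ_analytic_common ag ah.
by exists r => //; apply: poly_limitM => //; exact: ltW.
Qed.

Lemma germ_analytic_poly p (P : {mpoly R[n]}) : germ_analytic p (shift_eval P p).
Proof. by exists 1 => //; exact: poly_limit_poly. Qed.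

Lemma germ_analytic_cst p (c : R) : germ_analytic p (fun=> c).
Proof.
apply: germ_analytic_near (germ_analytic_poly p c%:MP) _.
by apply: filterE => x; rewrite /shift_eval mevalC.
Qed.

Lemma germ_analytic_coord p i : germ_analytic p (fun x => x i 0).
Proof.
apply: germ_analytic_near (germ_analytic_poly p ('X_i + (p i 0)%:MP)) _.
by apply: filterE => x; rewrite /shift_eval mevalD mevalXU mevalC subrK.
Qed.

Lemma germ_analyticN p g : germ_analytic p g -> germ_analytic p (fun x => - g x).
Proof.
move=> ag; apply: germ_analytic_near (germ_analyticM (germ_analytic_cst p (-1)) ag) _.
by apply: filterE => x; rewrite mulN1r.
Qed.

Lemma germ_analyticB p g h : germ_analytic p g -> germ_analytic p h ->
  germ_analytic p (fun x => g x - h x).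
Proof. by move=> ag ah; apply: germ_analyticD => //; exact: germ_analyticN. Qed.

End AnalyticLimits.

(** * Complex powers as pairs over a commutative ring *)

Section ComplexPowers.
Variable A : comNzRingType.
Implicit Types x y : A.

(** The two components of [(x + i y) ^ n]. The ring is arbitrary so that the same expression is used
    for real numbers and for polynomials substituted into a series. *)
Fixpoint cpow x y (n : nat) : A * A :=
  if n is m.+1 then
    let z := cpow x y m in (x * z.1 - y * z.2, x * z.2 + y * z.1)
  else (1, 0).

Definition cre x y n : A := (cpow x y n).1.
Definition cim x y n : A := (cpow x y n).2.

Lemma cre0 x y : cre x y 0 = 1. Proof. by []. Qed.
Lemma cim0 x y : cim x y 0 = 0. Proof. by []. Qed.
Lemma creS x y n : cre x y n.+1 = x * cre x y n - y * cim x y n.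
Proof. by []. Qed.
Lemma cimS x y n : cim x y n.+1 = x * cim x y n + y * cre x y n.
Proof. by []. Qed.

(** Real part of the truncated series of [(c n + i d n) z ^ n]; its imaginary part is
    [cseries d (fun n => - c n)]. *)
Definition cseries (c d : nat -> A) x y N : A :=
  \sum_(i < N) (c i * cre x y i - d i * cim x y i).

End ComplexPowers.

Lemma rmorph_cpow (A B : comNzRingType) (f : {rmorphism A -> B}) x y n :
  f (cre x y n) = cre (f x) (f y) n /\ f (cim x y n) = cim (f x) (f y) n.
Proof.
elim: n => [|n [IH1 IH2]]; first by rewrite !cre0 !cim0 rmorph1 rmorph0.
by rewrite !creS !cimS rmorphB rmorphD !rmorphM IH1 IH2.
Qed.

(** * Substitution into series, square roots and inverses of analytic germs *)

Section Compositions.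
Variables (R : realType) (n : nat).
Implicit Types (r : R) (S T U W : nat -> {mpoly R[n]}) (g : 'cV[R]_n -> R).
Implicit Types (p x : 'cV[R]_n).

Lemma shift_eval_le r p x (P : {mpoly R[n]}) : ball p r x ->
  `|shift_eval P p x| <= mnorm r P.
Proof. by move=> px; apply: ler_norm_meval; exact: ball_coord px. Qed.

Lemma shift_eval_cvg r p x S : mcauchy r S -> ball p r x ->
  cvg ((fun k => shift_eval (S k) p x) @ \oo).
Proof.
move=> cS px; apply/cauchy_cvgP => B /=; rewrite -entourage_ballE => -[e /= e0 eB].
have e2 : 0 < e / 2 by rewrite divr_gt0.
have [N HN] := cS _ e2.
near=> u; apply: eB.
near: u; exists ([set y | (exists2 i, (N <= i)%N & y = shift_eval (S i) p x)],
   [set y | (exists2 i, (N <= i)%N & y = shift_eval (S i) p x)]) => /=.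
  by split; exists N => // i /= Ni; exists i.
move=> [a b] /= [[i Ni ->] [j Nj ->]]; rewrite /ball/=.
rewrite /shift_eval -mevalB; apply: le_lt_trans (shift_eval_le _ px) _.
apply: le_lt_trans (HN _ _ Ni Nj) _; lra.
Unshelve. all: by end_near.
Qed.

(** The sum of the norms of the two components is submultiplicative for the complex product. *)
Lemma cpow_mnorm r (x y : {mpoly R[n]}) k : 0 <= r ->
  mnorm r x + mnorm r y <= 4^-1 ->
  mnorm r (cre x y k) + mnorm r (cim x y k) <= 4^-1 ^+ k.
Proof.
move=> r0 xy; elim: k => [|k IH].
  by rewrite cre0 cim0 mnorm1 mnorm0 addr0.
rewrite creS cimS exprS.
have h1 := ler_mnormB (x * cre x y k) (y * cim x y k) r0.
have h2 := ler_mnormD (x * cim x y k) (y * cre x y k) r0.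
have h3 := ler_mnormM x (cre x y k) r0.
have h4 := ler_mnormM x (cim x y k) r0.
have h5 := ler_mnormM y (cre x y k) r0.
have h6 := ler_mnormM y (cim x y k) r0.
have x0 := mnorm_ge0 x r0; have y0 := mnorm_ge0 y r0.
have c0 := mnorm_ge0 (cre x y k) r0; have d0 := mnorm_ge0 (cim x y k) r0.
apply: (@le_trans _ _ ((mnorm r x + mnorm r y) *
  (mnorm r (cre x y k) + mnorm r (cim x y k)))); first lra.
by apply: ler_pM; rewrite ?addr_ge0.
Qed.

(** Leibniz splitting gives the recursion [e_(k+1) <= e_k / 4 + D / 4 ^ k]. The slower ratio 1/2
    absorbs the factor [k] of the derivative of [z ^ k], and the constant 4 solves
    [4 / 4 + 1 = 4 / 2]. *)
Lemma cpow_mnorm_lip r (x y x' y' : {mpoly R[n]}) k : 0 <= r ->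
  mnorm r x + mnorm r y <= 4^-1 -> mnorm r x' + mnorm r y' <= 4^-1 ->
  mnorm r (cre x y k - cre x' y' k) + mnorm r (cim x y k - cim x' y' k) <=
  4 * 2^-1 ^+ k * (mnorm r (x - x') + mnorm r (y - y')).
Proof.
move=> r0 xy xy'; set D := mnorm r (x - x') + _.
have D0 : 0 <= D by rewrite addr_ge0 // mnorm_ge0.
elim: k => [|k IH].
  by rewrite !cre0 !cim0 !subrr mnorm0 addr0 expr0 mulr1 mulr_ge0.
rewrite !creS !cimS.
set c := cre x y k in IH *; set d := cim x y k in IH *.
set c' := cre x' y' k in IH *; set d' := cim x' y' k in IH *.
have -> : x * c - y * d - (x' * c' - y' * d') =
  (x * (c - c') - y * (d - d')) + ((x - x') * c' - (y - y') * d') by ring.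
have -> : x * d + y * c - (x' * d' + y' * c') =
  (x * (d - d') + y * (c - c')) + ((x - x') * d' + (y - y') * c') by ring.
have B' := cpow_mnorm k r0 xy'; rewrite -/c' -/d' in B'.
have nD P Q := @ler_mnormD _ n r P Q r0.
have nB P Q := @ler_mnormB _ n r P Q r0.
have nM P Q := @ler_mnormM _ n r P Q r0.
have N0 P := @mnorm_ge0 _ n r P r0.
have k0 : 0 <= (2^-1 : R) ^+ k by rewrite exprn_ge0.
have k4 : (4^-1 : R) ^+ k <= 2^-1 ^+ k by rewrite lerXn2r ?nnegrE //; lra.
set e := mnorm r (c - c') + _ in IH.
have e0 : 0 <= e by rewrite addr_ge0.
apply: (@le_trans _ _ ((mnorm r x + mnorm r y) * e +
   D * (mnorm r c' + mnorm r d'))).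
  have a1 := nD (x * (c - c') - y * (d - d')) ((x - x') * c' - (y - y') * d').
  have a2 := nD (x * (d - d') + y * (c - c')) ((x - x') * d' + (y - y') * c').
  have a3 := nB (x * (c - c')) (y * (d - d')).
  have a4 := nB ((x - x') * c') ((y - y') * d').
  have a5 := nD (x * (d - d')) (y * (c - c')).
  have a6 := nD ((x - x') * d') ((y - y') * c').
  have b1 := nM x (c - c'); have b2 := nM y (d - d').
  have b3 := nM x (d - d'); have b4 := nM y (c - c').
  have b5 := nM (x - x') c'; have b6 := nM (y - y') d'.
  have b7 := nM (x - x') d'; have b8 := nM (y - y') c'.
  rewrite /e /D; lra.
apply: (@le_trans _ _ (4^-1 * (4 * 2^-1 ^+ k * D) + D * 2^-1 ^+ k)).
  apply: lerD; first by apply: ler_pM; rewrite ?addr_ge0.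
  by rewrite ler_wpM2l // (le_trans B').
by rewrite exprS; nra.
Qed.

Lemma sum_half_le N i : (N <= i)%N ->
  \sum_(N <= k < i) (2^-1 : R) ^+ k <= 2 * 2^-1 ^+ N.
Proof.
move=> Ni; suff -> : \sum_(N <= k < i) (2^-1 : R) ^+ k = 2 * (2^-1 ^+ N - 2^-1 ^+ i).
  by rewrite ler_wpM2l // gerBl exprn_ge0.
elim: i Ni => [|i IH]; first by rewrite leqn0 => /eqP ->; rewrite big_geq // subrr mulr0.
rewrite leq_eqVlt => /predU1P[->|]; first by rewrite big_geq // subrr mulr0.
rewrite ltnS => Ni; rewrite big_nat_recr //= IH // exprS.
by field.
Qed.

Section SeriesComposition.
Variables (c d : nat -> R) (M : R).
Hypotheses (cM : forall k, `|c k| <= M) (dM : forall k, `|d k| <= M).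

Let cs (x y : {mpoly R[n]}) N :=
  cseries (fun k => (c k)%:MP) (fun k => (d k)%:MP) x y N.

Lemma cseries_tail r (x y : {mpoly R[n]}) N i : 0 <= r -> mnorm r x + mnorm r y <= 4^-1 ->
  (N <= i)%N -> mnorm r (cs x y i - cs x y N) <= M * (2 * 2^-1 ^+ N).
Proof.
move=> r0 xy Ni; have M0 : 0 <= M := le_trans (normr_ge0 _) (cM 0).
pose G k := (c k)%:MP * cre x y k - (d k)%:MP * cim x y k.
have E j : cs x y j = \sum_(0 <= k < j) G k by rewrite big_mkord.
rewrite !E (big_cat_nat (leq0n _) Ni) /= addrAC subrr add0r.
apply: le_trans (ler_mnorm_sum _ _ _ r0) _.
apply: le_trans _ (ler_wpM2l M0 (sum_half_le Ni)).
rewrite mulr_sumr; apply: ler_sum => k _.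
apply: le_trans (ler_mnormB _ _ r0) _.
rewrite !mul_mpolyC !mnormZ.
apply: (@le_trans _ _ (M * (mnorm r (cre x y k) + mnorm r (cim x y k)))).
  by rewrite mulrDr lerD // ler_wpM2r // mnorm_ge0.
rewrite ler_wpM2l //; apply: le_trans (cpow_mnorm k r0 xy) _.
by rewrite lerXn2r ?nnegrE //; lra.
Qed.

Lemma cseries_lip r (x y x' y' : {mpoly R[n]}) N : 0 <= r ->
  mnorm r x + mnorm r y <= 4^-1 -> mnorm r x' + mnorm r y' <= 4^-1 ->
  mnorm r (cs x y N - cs x' y' N) <=
  8 * M * (mnorm r (x - x') + mnorm r (y - y')).
Proof.
move=> r0 xy xy'; have M0 : 0 <= M := le_trans (normr_ge0 _) (cM 0).
set D := mnorm r (x - x') + _; have D0 : 0 <= D by rewrite addr_ge0 // mnorm_ge0.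
rewrite /cs /cseries -sumrB; apply: le_trans (ler_mnorm_sum _ _ _ r0) _.
apply: (@le_trans _ _ (\sum_(i < N) (M * D * 4) * 2^-1 ^+ i)).
  apply: ler_sum => k _.
  have -> : (c k)%:MP * cre x y k - (d k)%:MP * cim x y k -
     ((c k)%:MP * cre x' y' k - (d k)%:MP * cim x' y' k) =
     (c k)%:MP * (cre x y k - cre x' y' k) - (d k)%:MP * (cim x y k - cim x' y' k)
    by ring.
  apply: le_trans (ler_mnormB _ _ r0) _; rewrite !mul_mpolyC !mnormZ.
  apply: (@le_trans _ _ (M * (mnorm r (cre x y k - cre x' y' k) +
                              mnorm r (cim x y k - cim x' y' k)))).
    by rewrite mulrDr lerD // ler_wpM2r // mnorm_ge0.
  have := ler_wpM2l M0 (cpow_mnorm_lip k r0 xy xy').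
  by move/le_trans; apply; rewrite -/D le_eqVlt; apply/orP; left; apply/eqP; ring.
rewrite -mulr_sumr -(big_mkord xpredT (fun i => 2^-1 ^+ i)).
have := sum_half_le (leq0n N); rewrite expr0 mulr1 => h.
by apply: le_trans (ler_wpM2l _ h) _; [rewrite !mulr_ge0|nra].
Qed.

(** The order of truncation and the argument both move. The difference is split into two tails,
    small uniformly in the argument, and a Lipschitz difference at the fixed order [N]; these get
    [e / 4], [e / 4] and [e / 2]. *)
Lemma mcauchy_cseries r U W : 0 <= r -> mcauchy r U -> mcauchy r W ->
  (forall k, mnorm r (U k) + mnorm r (W k) <= 4^-1) ->
  mcauchy r (fun N => cs (U N) (W N) N).
Proof.
move=> r0 cU cW UW e e0; have M0 : 0 <= M := le_trans (normr_ge0 _) (cM 0).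
have e1 : 0 < e / (32 * (M + 1)) by rewrite divr_gt0 // mulr_gt0; lra.
have eE : e = e / 4 + e / 2 + e / 4 by field.
have eM : 8 * M * (e / (32 * (M + 1)) + e / (32 * (M + 1))) <= e / 2.
  have -> : 8 * M * (e / (32 * (M + 1)) + e / (32 * (M + 1))) = (M / (M + 1)) * (e / 2).
    by field; lra.
  by rewrite ger_pMl ?divr_gt0 // ler_pdivrMr; lra.
have [N1 H1] := cU _ e1; have [N2 H2] := cW _ e1.
have h0 : (fun k => M * (2 * (2^-1 : R) ^+ k)) @ \oo --> (0 : R).
  rewrite -(mulr0 M); apply: cvgM; first exact: cvg_cst.
  rewrite -(mulr0 2); apply: cvgM; first exact: cvg_cst.
  by apply: cvg_expr; rewrite ger0_norm //; lra.
have e4 : 0 < e / 4 by rewrite divr_gt0.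
move/cvgrPdist_le: h0 => /(_ _ e4)[N3 _ HN].
pose N := maxn N3 (maxn N1 N2).
have {HN} := HN N (leq_maxl _ _); rewrite /= sub0r normrN => /(le_trans (ler_norm _)) HN.
exists N => i j Ni Nj.
have tele (f g h k : {mpoly R[n]}) : f - g = (f - h) + (h - k) - (g - k) by ring.
rewrite (tele _ _ (cs (U i) (W i) N) (cs (U j) (W j) N)).
apply: le_trans (ler_mnormB _ _ r0) _; rewrite eE; apply: lerD; last first.
  exact: le_trans (cseries_tail r0 (UW j) Nj) HN.
apply: le_trans (ler_mnormD _ _ r0) _; apply: lerD.
  exact: le_trans (cseries_tail r0 (UW i) Ni) HN.
apply: le_trans (cseries_lip N r0 (UW i) (UW j)) (le_trans _ eM).
have N1' : (N1 <= N)%N by rewrite /N !leq_max leqnn orbT.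
have N2' : (N2 <= N)%N by rewrite /N !leq_max leqnn !orbT.
rewrite ler_wpM2l ?mulr_ge0 // lerD //.
  exact: H1 (leq_trans N1' Ni) (leq_trans N1' Nj).
exact: H2 (leq_trans N2' Ni) (leq_trans N2' Nj).
Qed.

(** The approximants are the truncated series at the polynomials [U N], [W N]. Continuity of [h]
    carries the values of [h] along these points to the limit, and the truncation error is geometric
    uniformly in the point, so it vanishes although the point changes with [N]. *)
Lemma poly_limit_cseries r p U W (u w : 'cV[R]_n -> R) (h : R -> R -> R) (C : R) : 0 <= r ->
  mcauchy r U -> mcauchy r W ->
  (forall k, mnorm r (U k) + mnorm r (W k) <= 4^-1) ->
  (forall x, ball p r x -> (fun k => shift_eval (U k) p x) @ \oo --> u x) ->
  (forall x, ball p r x -> (fun k => shift_eval (W k) p x) @ \oo --> w x) ->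
  (forall X Y : R, `|X| <= 4^-1 -> `|Y| <= 4^-1 ->
     {for (X, Y), continuous (fun z : R * R => h z.1 z.2)}) ->
  (forall (X Y : R) N, `|X| <= 4^-1 -> `|Y| <= 4^-1 ->
     `|h X Y - cseries c d X Y N| <= C * 2^-1 ^+ N) ->
  poly_limit r p (fun x => h (u x) (w x)).
Proof.
move=> r0 cU cW UW Uu Ww hc hs.
exists (fun N => cs (U N) (W N) N); first exact: mcauchy_cseries.
move=> x px.
have Ub k : `|shift_eval (U k) p x| <= 4^-1.
  by apply: le_trans (shift_eval_le _ px) _; apply: le_trans (UW k); rewrite lerDl mnorm_ge0.
have Wb k : `|shift_eval (W k) p x| <= 4^-1.
  by apply: le_trans (shift_eval_le _ px) _; apply: le_trans (UW k); rewrite lerDr mnorm_ge0.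
have lb (a : nat -> R) (l : R) : (forall k, `|a k| <= 4^-1) -> a @ \oo --> l -> `|l| <= 4^-1.
  move=> ab al; have al' : (fun k => `|a k|) @ \oo --> `|l| by exact: cvg_norm.
  rewrite -(cvg_lim _ al') //; apply: limr_le; first by apply/cvg_ex; eexists; exact: al'.
  by apply: nearW => k /=; exact: ab.
have ub := lb _ _ Ub (Uu x px); have wb := lb _ _ Wb (Ww x px).
have h1 : (fun N => h (shift_eval (U N) p x) (shift_eval (W N) p x)) @ \oo --> h (u x) (w x).
  by apply: continuous2_cvg (hc _ _ ub wb) _ _; [exact: Uu|exact: Ww].
have E N : shift_eval (cs (U N) (W N) N) p x =
    h (shift_eval (U N) p x) (shift_eval (W N) p x) -
    (h (shift_eval (U N) p x) (shift_eval (W N) p x) -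
    cseries c d (shift_eval (U N) p x) (shift_eval (W N) p x) N).
  rewrite opprB addrCA subrr addr0 /shift_eval /cs /cseries raddf_sum.
  apply: eq_bigr => k _ /=; rewrite mevalB !mevalM !mevalC.
  by have [-> ->] := rmorph_cpow (meval (fun i => x i 0 - p i 0)) (U N) (W N) k.
have h0 : (fun k => C * (2^-1 : R) ^+ k) @ \oo --> (0 : R).
  rewrite -(mulr0 C); apply: cvgM; first exact: cvg_cst.
  by apply: cvg_expr; rewrite ger0_norm //; lra.
under eq_fun do rewrite E.
rewrite -[h _ _]subr0.
have h2 : (fun N => h (shift_eval (U N) p x) (shift_eval (W N) p x) -
   cseries c d (shift_eval (U N) p x) (shift_eval (W N) p x) N) @ \oo --> (0 : R).
  apply: norm_cvg0; apply: (@squeeze_cvgr _ _ _ _ (fun=> 0) _ _ _ _ _ h0); last exact: cvg_cst.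
  by apply: nearW => N; rewrite normr_ge0 /= hs.
exact: cvgB.
Qed.

End SeriesComposition.

Lemma poly_limit_series r p (q : nat -> {mpoly R[n]}) (C : R) g : 0 <= r ->
  (forall k, mnorm r (q k) <= C * 2^-1 ^+ k) ->
  (forall x, ball p r x ->
     (fun N => \sum_(k < N) shift_eval (q k) p x) @ \oo --> g x) ->
  poly_limit r p g.
Proof.
move=> r0 qC qg; exists (fun N => \sum_(k < N) q k).
  by apply: (@mcauchy_geometric _ _ _ _ C) => // k; rewrite big_ord_recr /= addrAC subrr add0r.
move=> x px; have := qg x px; under eq_fun do rewrite /shift_eval -raddf_sum.
by [].
Qed.

Lemma sqrt_poly_limit p (P : {mpoly R[n]}) (b e : R) : P@_0 = 0 -> 0 < b -> 0 < e ->
  exists2 d : R, 0 < d & forall r, 0 < r -> r <= d ->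
  exists W, [/\ mcauchy r W, forall k, mnorm r (W k) <= e &
   forall x, ball p r x -> (fun k => shift_eval (W k) p x) @ \oo -->
     Num.sqrt (b ^+ 2 + shift_eval P p x) - b].
Proof.
(* The bound [b / 2] gives the iteration the ratio 1/2 and later keeps [b + l] positive. *)
move=> P0 b0 e0; pose D := Num.min e (b / 2).
have D0 : 0 < D by rewrite lt_min e0 divr_gt0.
have De : D <= e by rewrite ge_min lexx.
have Db : D <= b / 2 by rewrite ge_min lexx orbT.
have [d d0 Hd] := mnorm_small P0 (mulr_gt0 D0 b0).
exists d => // r r0 /(Hd _ (ltW r0)) PD; have r0' := ltW r0.
(* [Num.sqrt (b ^+ 2 + P) - b] is the fixed point of the contraction
   [W |-> (P - W ^ 2) / (2 b)], whose iterates are polynomials. *)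
pose W := fix W k : {mpoly R[n]} := if k is j.+1 then (2 * b)^-1 *: (P - W j * W j) else 0.
have b2 : 0 < (2 * b)^-1 by rewrite invr_gt0 mulr_gt0.
have bK : (2 * b)^-1 * b = 2^-1 by field; rewrite gt_eqF.
have WS k : W k.+1 = (2 * b)^-1 *: (P - W k * W k) by [].
have WD k : mnorm r (W k) <= D.
  elim: k => [|k IH]; first by rewrite mnorm0 ltW.
  rewrite WS mnormZ gtr0_norm //.
  have h1 := ler_mnormB P (W k * W k) r0'.
  have h2 := ler_mnormM (W k) (W k) r0'.
  have h3 : mnorm r (W k) * mnorm r (W k) <= D * (b / 2).
    by apply: ler_pM; rewrite ?mnorm_ge0 // (le_trans IH).
  have h4 : mnorm r (P - W k * W k) <= b * (3 / 2 * D) by lra.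
  have := ler_wpM2l (ltW b2) h4; rewrite mulrA bK; lra.
have Wd k : mnorm r (W k.+1 - W k) <= D * 2^-1 ^+ k.
  elim: k => [|k IH].
    by rewrite expr0 mulr1 [W 0%N]/= subr0; exact: WD.
  rewrite (WS k.+1) (WS k) -scalerBr mnormZ gtr0_norm //.
  have -> : P - W k.+1 * W k.+1 - (P - W k * W k) =
     - ((W k.+1 + W k) * (W k.+1 - W k)) by ring.
  rewrite mnormN exprS.
  have h1 := ler_mnormM (W k.+1 + W k) (W k.+1 - W k) r0'.
  have h2 := ler_mnormD (W k.+1) (W k) r0'.
  have h3 : mnorm r ((W k.+1 + W k) * (W k.+1 - W k)) <= b * (D * 2^-1 ^+ k).
    apply: le_trans h1 _; apply: ler_pM; rewrite ?mnorm_ge0 //.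
    have := WD k; have := WD k.+1; lra.
  have := ler_wpM2l (ltW b2) h3; rewrite mulrA bK; lra.
have cW : mcauchy r W by apply: mcauchy_geometric Wd.
exists W; split=> // [k|x px]; first exact: le_trans (WD k) De.
have /cvg_ex[l Wl] := shift_eval_cvg cW px.
suff <- : l = Num.sqrt (b ^+ 2 + shift_eval P p x) - b by [].
have lD : `|l| <= D.
  have al' : (fun k => `|shift_eval (W k) p x|) @ \oo --> `|l| by exact: cvg_norm.
  rewrite -(cvg_lim _ al') //; apply: limr_le; first by apply/cvg_ex; eexists; exact: al'.
  by apply: nearW => k /=; exact: le_trans (shift_eval_le _ px) (WD k).
have E : l = (2 * b)^-1 * (shift_eval P p x - l * l).
  have h1 : (fun k => shift_eval (W k.+1) p x) @ \oo --> l.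
    by rewrite (cvg_shiftS (fun k => shift_eval (W k) p x)).
  have h2 : (fun k => shift_eval (W k.+1) p x) @ \oo -->
      (2 * b)^-1 * (shift_eval P p x - l * l).
    rewrite /shift_eval; under eq_fun do rewrite WS mevalZ mevalB mevalM.
    apply: cvgM; first exact: cvg_cst.
    by apply: cvgB; [exact: cvg_cst|apply: cvgM].
  by rewrite -[LHS](cvg_lim _ h1) // (cvg_lim _ h2).
(* Completing the square in the fixed point equation; the sign of the root is then decided by
   [|l| <= b / 2]. *)
have l2 : (b + l) ^+ 2 = b ^+ 2 + shift_eval P p x.
  have := congr1 (fun z => 2 * b * z) E.
  rewrite /= mulrA divff ?mul1r ?mulf_neq0 ?(gt_eqF b0) // => h.
  have -> : (b + l) ^+ 2 = b ^+ 2 + (2 * b * l + l * l) by ring.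
  by rewrite h subrK.
rewrite -l2 sqrtr_sqr ger0_norm; first by rewrite addrC addKr.
move: lD; rewrite ler_norml => /andP[]; lra.
Qed.

(** Neumann iteration [V |-> (1 - P V) / a], a contraction of ratio 1/2 on a radius where the norm
    of [P] is at most [a / 2]. *)
Lemma germ_analytic_inv p (P : {mpoly R[n]}) (a : R) : P@_0 = 0 -> 0 < a ->
  germ_analytic p (fun x => (a + shift_eval P p x)^-1).
Proof.
move=> P0 a0; have [r r0 Hr] := mnorm_small P0 (divr_gt0 a0 (ltr0Sn R 1)).
have r0' := ltW r0; have {}Hr := Hr r r0' (lexx _); exists r => //.
pose V := fix V k : {mpoly R[n]} := if k is j.+1 then a^-1 *: (1 - P * V j) else 0.
have VS k : V k.+1 = a^-1 *: (1 - P * V k) by [].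
have ai : 0 < a^-1 by rewrite invr_gt0.
have Vd k : mnorm r (V k.+1 - V k) <= a^-1 * 2^-1 ^+ k.
  elim: k => [|k IH].
    rewrite (VS 0%N) [V 0%N]/= mulr0 !subr0 mnormZ mnorm1 gtr0_norm //.
  rewrite (VS k.+1) (VS k) -scalerBr mnormZ gtr0_norm //.
  have -> : 1 - P * V k.+1 - (1 - P * V k) = - (P * (V k.+1 - V k)) by ring.
  rewrite mnormN ler_wpM2l ?(ltW ai) //.
  apply: le_trans (ler_mnormM _ _ r0') _.
  have -> : (2^-1 : R) ^+ k.+1 = (a / 2) * (a^-1 * 2^-1 ^+ k).
    by rewrite exprS; field; rewrite gt_eqF.
  by apply: ler_pM; rewrite ?mnorm_ge0.
have cV : mcauchy r V by apply: mcauchy_geometric Vd.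
exists V => // x px.
have /cvg_ex[l Vl] := shift_eval_cvg cV px.
suff <- : l = (a + shift_eval P p x)^-1 by [].
have E : l = a^-1 * (1 - shift_eval P p x * l).
  have h1 : (fun k => shift_eval (V k.+1) p x) @ \oo --> l.
    by rewrite (cvg_shiftS (fun k => shift_eval (V k) p x)).
  have h2 : (fun k => shift_eval (V k.+1) p x) @ \oo -->
      a^-1 * (1 - shift_eval P p x * l).
    rewrite /shift_eval; under eq_fun do rewrite VS mevalZ mevalB mevalM meval1.
    apply: cvgM; first exact: cvg_cst.
    by apply: cvgB; [exact: cvg_cst|apply: cvgM => //; exact: cvg_cst].
  by rewrite -[LHS](cvg_lim _ h1) // (cvg_lim _ h2).
have l1 : (a + shift_eval P p x) * l = 1.
  have := congr1 (fun z => a * z) E.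
  rewrite /= mulrA divff ?mul1r ?(gt_eqF a0) //; lra.
have : a + shift_eval P p x != 0.
  by apply/eqP => z; move: l1; rewrite z mul0r => /eqP; rewrite eq_sym oner_eq0.
by move=> nz; rewrite -[LHS](mulKf nz) l1 mulr1.
Qed.

Lemma cvg_meval (T : Type) (F : set_system T) (FF : Filter F)
    (P : {mpoly R[n]}) (y : T -> 'I_n -> R) (l : 'I_n -> R) :
  (forall i, (fun t => y t i) @ F --> l i) ->
  (fun t => P.@[y t]) @ F --> P.@[l].
Proof.
move=> yl; under eq_fun do rewrite mevalE; rewrite mevalE.
apply: cvg_big => [|m _]; first exact: add_continuous.
apply: cvgM; first exact: cvg_cst.
apply: cvg_big => [|i _]; first exact: mul_continuous.
exact: continuous_cvg (@exprn_continuous _ (m i) _) (yl i).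
Qed.

Lemma shift_eval_continuous (P : {mpoly R[n]}) p : continuous (shift_eval P p).
Proof.
move=> x; apply: (@cvg_meval _ (nbhs x) (nbhs_filter x)) => i.
by apply: cvgB; [exact: coord_continuous|exact: cvg_cst].
Qed.

(** The weighted norm dominates the values, so the convergence is uniform on the ball. This
    continuity later carries an identity over to the real axis. *)
Lemma poly_limit_continuous r p g x : poly_limit r p g -> ball p r x ->
  {for x, continuous g}.
Proof.
move=> [S cS Sg] px; have r0 : 0 < r by case: px.
have unif (e : R) : 0 < e -> exists K, forall y, ball p r y ->
    `|g y - shift_eval (S K) p y| <= e.
  move=> e0; have [K HK] := cS _ e0; exists K => y py.
  have h : (fun k => `|shift_eval (S k) p y - shift_eval (S K) p y|) @ \oo -->
      `|g y - shift_eval (S K) p y|.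
    by apply: cvg_norm; apply: cvgB; [exact: Sg|exact: cvg_cst].
  rewrite -(cvg_lim _ h) //; apply: limr_le; first by apply/cvg_ex; eexists; exact: h.
  exists K => // k /= Kk; rewrite /shift_eval -mevalB.
  by apply: le_trans (shift_eval_le _ py) _; exact: HK.
apply/(@cvgrPdist_le _ _ _ (nbhs x) (nbhs_filter x)) => e e0.
have e3 : 0 < e / 3 by rewrite divr_gt0.
have [K HK] := unif _ e3.
have /(@cvgrPdist_le _ _ _ (nbhs x) (nbhs_filter x))/(_ _ e3) c :=
  @shift_eval_continuous (S K) p x.
have b : nbhs x (ball p r).
  by apply: open_nbhs_nbhs; split => //; exact: (@ball_open R 'cV[R]_n).
apply: (@filterS2 _ (nbhs x) (nbhs_filter x) _ _ _ _ b c) => y py.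
have := HK y py; have := HK x px; rewrite !ler_norml.
by move=> /andP[? ?] /andP[? ?] /andP[? ?]; apply/andP; split; lra.
Qed.

End Compositions.

(** * Integrals of continuous functions *)

Section RealCalculus.
Variable R : realType.
Implicit Types (f g : R -> R) (a b x t : R).

(** With functions written as abstractions, derivatives are assembled as terms; [is_derive_to] then
    leaves only an algebraic identity. *)
Lemma is_derive_addf f g x df dg : is_derive x 1 f df -> is_derive x 1 g dg ->
  is_derive x 1 (fun s => f s + g s) (df + dg).
Proof. exact: is_deriveD. Qed.

Lemma is_derive_subf f g x df dg : is_derive x 1 f df -> is_derive x 1 g dg ->
  is_derive x 1 (fun s => f s - g s) (df - dg).
Proof. exact: is_deriveB. Qed.

Lemma is_derive_oppf f x df :
  is_derive x 1 f df -> is_derive x 1 (fun s => - f s) (- df).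
Proof. exact: is_deriveN. Qed.

Lemma is_derive_mulf f g x df dg : is_derive x 1 f df -> is_derive x 1 g dg ->
  is_derive x 1 (fun s => f s * g s) (f x * dg + g x * df).
Proof. exact: is_deriveM. Qed.

Lemma is_derive_cstf (c x : R) : is_derive x 1 (fun=> c) 0.
Proof. exact: is_derive_cst. Qed.

Lemma is_derive_idf x : is_derive x 1 (fun s : R => s) 1.
Proof. exact: is_derive_id. Qed.

Lemma is_derive_to f x d d' : is_derive x 1 f d -> d = d' -> is_derive x 1 f d'.
Proof. by move=> h <-. Qed.

Lemma is_derive_cont f x df : is_derive x 1 f df -> {for x, continuous f}.
Proof.
by move=> [d _]; apply: differentiable_continuous; exact/derivable1_diffP.
Qed.

Lemma MVT_between f df a b :
  (forall x, Num.min a b <= x <= Num.max a b -> is_derive x 1 f (df x)) ->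
  exists2 c, Num.min a b <= c <= Num.max a b & f b - f a = df c * (b - a).
Proof.
wlog ab : a b / a <= b.
  move=> H; have [ab|] := boolP (a <= b); first exact: H.
  rewrite -ltNge => /ltW ba; rewrite minC maxC => /(H _ _ ba)[c cab e].
  by exists c => //; rewrite -opprB e; ring.
rewrite min_l // max_r // => D.
have [x|x|c] := @MVT_segment _ f df a b ab.
- by rewrite in_itv => /andP[/ltW ? /ltW ?]; apply: D; apply/andP.
- apply: continuous_in_subspaceT => {}x; rewrite inE /= in_itv /= => xab.
  exact: is_derive_cont (D _ xab).
- by rewrite in_itv /= => cab e; exists c.
Qed.

(** Continuity is two-sided even at the endpoints. The functions integrated here extend beyond the
    segment, and pointwise continuity is stable under arithmetic without subspace topologies. *)
Definition ccont a b f := forall x, a <= x <= b -> {for x, continuous f}.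

Lemma ccont_within a b f : ccont a b f -> {within `[a, b], continuous f}.
Proof.
move=> cf; apply: continuous_in_subspaceT => x; rewrite inE /= in_itv /=.
exact: cf.
Qed.

Lemma ccontD a b f g : ccont a b f -> ccont a b g -> ccont a b (fun x => f x + g x).
Proof. by move=> cf cg x xab; apply: cvgD; [exact: cf|exact: cg]. Qed.

Lemma ccontB a b f g : ccont a b f -> ccont a b g -> ccont a b (fun x => f x - g x).
Proof. by move=> cf cg x xab; apply: cvgB; [exact: cf|exact: cg]. Qed.

Lemma ccontM a b f g : ccont a b f -> ccont a b g -> ccont a b (fun x => f x * g x).
Proof. by move=> cf cg x xab; apply: cvgM; [exact: cf|exact: cg]. Qed.

Lemma ccont_cst a b (c : R) : ccont a b (fun=> c).
Proof. by move=> x _; exact: cvg_cst. Qed.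

Lemma ccont_sum a b N (F : nat -> R -> R) : (forall i, ccont a b (F i)) ->
  ccont a b (fun x => \sum_(i < N) F i x).
Proof.
move=> cF; elim: N => [|N IH].
  by under eq_fun do rewrite big_ord0; exact: ccont_cst.
by under eq_fun do rewrite big_ord_recr /=; apply: ccontD.
Qed.

Local Notation mu := (@lebesgue_measure R).

Definition rint a b f : R := \int[mu]_(x in `[a, b]) f x.

Lemma ccont_integrable a b f : ccont a b f -> mu.-integrable `[a, b] (EFin \o f).
Proof.
move=> cf; apply: continuous_compact_integrable; first exact: segment_compact.
exact: ccont_within.
Qed.

Lemma rintD a b f g : ccont a b f -> ccont a b g ->
  rint a b (fun x => f x + g x) = rint a b f + rint a b g.
Proof. by move=> cf cg; rewrite /rint RintegralD //; exact: ccont_integrable. Qed.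

Lemma rintB a b f g : ccont a b f -> ccont a b g ->
  rint a b (fun x => f x - g x) = rint a b f - rint a b g.
Proof. by move=> cf cg; rewrite /rint RintegralB //; exact: ccont_integrable. Qed.

Lemma rintZ a b (c : R) f : ccont a b f ->
  rint a b (fun x => c * f x) = c * rint a b f.
Proof. by move=> cf; rewrite /rint RintegralZl //; exact: ccont_integrable. Qed.

Lemma rint_FTC2 a b f F : a < b -> ccont a b f ->
  (forall x, a <= x <= b -> is_derive x 1 F (f x)) -> rint a b f = F b - F a.
Proof.
move=> ab cf dF; rewrite /rint /Rintegral (@continuous_FTC2 _ f F) //.
- exact: ccont_within.
- split.
  + by move=> x; rewrite in_itv /= => /andP[/ltW ? /ltW ?]; apply: ex_derive; apply: dF; apply/andP.
  + apply: cvg_at_right_filter; apply: is_derive_cont (dF a _).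
    by rewrite lexx ltW.
  + apply: cvg_at_left_filter; apply: is_derive_cont (dF b _).
    by rewrite lexx ltW.
- move=> x; rewrite in_itv /= => /andP[/ltW ? /ltW ?]; rewrite derive1E.
  by have -> := @derive_val _ _ _ _ _ _ _ (dF x _); rewrite //; apply/andP.
Qed.

Lemma rint_cst a b (c : R) : a <= b -> rint a b (fun=> c) = c * (b - a).
Proof.
rewrite le_eqVlt => /predU1P[->|ab].
  by rewrite subrr mulr0 /rint set_itv1 Rintegral_set1.
have dF x : a <= x <= b -> is_derive x 1 (fun x => c * x) c.
  by move=> _; apply: (is_derive_to (is_derive_mulf (is_derive_cstf c x) (is_derive_idf x))); ring.
by rewrite (rint_FTC2 ab (@ccont_cst a b c) dF); ring.
Qed.

Lemma rint_sum a b N (F : nat -> R -> R) : (forall i, ccont a b (F i)) -> a <= b ->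
  rint a b (fun x => \sum_(i < N) F i x) = \sum_(i < N) rint a b (F i).
Proof.
move=> cF ab; elim: N => [|N IH].
  by under eq_fun do rewrite big_ord0; rewrite big_ord0 rint_cst // mul0r.
under eq_fun do rewrite big_ord_recr /=.
by rewrite rintD ?IH ?big_ord_recr //; exact: ccont_sum.
Qed.

Lemma eq_rint a b f g : (forall x, a <= x <= b -> f x = g x) ->
  rint a b f = rint a b g.
Proof.
move=> fg; apply: eq_Rintegral => x; rewrite inE /= in_itv /=; exact: fg.
Qed.

Lemma rint_bound a b f M : a <= b -> ccont a b f ->
  (forall x, a <= x <= b -> `|f x| <= M) -> `|rint a b f| <= M * (b - a).
Proof.
move=> ab cf fM; rewrite -(rint_cst M ab).
apply: le_trans (le_normr_Rintegral _ (ccont_integrable cf)) _ => //.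
apply: le_Rintegral => //.
- by apply: (@ccont_integrable _ _ (fun x => `|f x|)) => x xab; apply: cvg_norm; exact: cf.
- exact: ccont_integrable (@ccont_cst a b M).
Qed.

Lemma rint_FTC1 a b f x : a < x -> x < b -> ccont a b f ->
  is_derive x 1 (fun y => rint a y f) (f x).
Proof.
move=> ax xb cf.
have [|d e] := @continuous_FTC1_closed _ f a x b xb (ccont_integrable cf) ax.
  by apply: cf; rewrite !ltW.
by apply: DeriveDef; [exact: d|rewrite -derive1E; exact: e].
Qed.

Lemma rint_derive a b u v (k k' : R -> R -> R) t (M : R) : u < t -> t < v -> a <= b ->
  (forall s, u < s < v -> ccont a b (k s)) ->
  (forall s y, u < s < v -> a <= y <= b -> is_derive s 1 (k^~ y) (k' s y)) ->
  (forall s y, u < s < v -> a <= y <= b -> `|k' s y| <= M) ->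
  is_derive t 1 (fun s => rint a b (k s)) (rint a b (k' t)).
Proof.
move=> ut tv ab ck dk kM.
have mI : measurable (`[a, b] : set R) by [].
have M0 : 0 <= M.
  by apply: le_trans (kM t a _ _); rewrite ?normr_ge0 ?ut ?tv ?lexx ?ab.
have It : (`]u, v[%classic : set R) t by rewrite /= in_itv /= ut tv.
have intf x : (`]u, v[%classic : set R) x -> mu.-integrable `[a, b] (EFin \o k x).
  by rewrite /= in_itv /= => xuv; apply: ccont_integrable; exact: ck.
have derf x y : (`]u, v[%classic : set R) x -> (`[a, b]%classic : set R) y -> derivable (k ^~ y) x 1.
  by rewrite /= !in_itv /= => xuv yab; apply: ex_derive; exact: dk.
have part x y : (`]u, v[%classic : set R) x -> (`[a, b]%classic : set R) y ->
    partial1of2 k x y = k' x y.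
  rewrite /= !in_itv /= => xuv yab; rewrite partial1of2E.
  by have -> := @derive_val _ _ _ _ _ _ _ (dk x y xuv yab).
have Gub x y : (`]u, v[%classic : set R) x -> (`[a, b]%classic : set R) y -> `|partial1of2 k x y| <= M.
  move=> xuv yab; rewrite part //; move: xuv yab; rewrite /= !in_itv /=; exact: kM.
have intM := ccont_integrable (@ccont_cst a b M).
apply: DeriveDef.
  exact: (@derivable_under_integral _ _ _ mu k _ mI t u v It intf derf (fun=> M) (fun=> M0) intM Gub).
rewrite -derive1E (@differentiation_under_integral _ _ _ mu k _ mI t u v It intf derf (fun=> M) (fun=> M0) intM Gub).
by apply: eq_Rintegral => y; rewrite inE /= => yab; rewrite part.
Qed.

End RealCalculus.

(** * Functions of class C1 on squares *)

Section C1Squares.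
Variable R : realType.
Implicit Types (g gx gy : R -> R -> R) (x y t a M : R).

Definition cont2 g x y := {for (x, y), continuous (fun z : R * R => g z.1 z.2)}.

(** The common bound [M] serves to dominate integrands when differentiating under the integral sign
    and to bound the series coefficients. *)
Definition C1sq a M g gx gy := forall x y, `|x| < a -> `|y| < a ->
  [/\ is_derive x 1 (g^~ y) (gx x y), is_derive y 1 (g x) (gy x y),
      cont2 gx x y, cont2 gy x y &
      [/\ `|g x y| <= M, `|gx x y| <= M & `|gy x y| <= M]].

Lemma cont2_near g x y e : cont2 g x y -> 0 < e ->
  exists2 d : R, 0 < d & forall x' y', `|x' - x| < d -> `|y' - y| < d ->
    `|g x y - g x' y'| <= e.
Proof.
move=> /cvgrPdist_le c e0; have /nbhs_ballP[d /= d0 H] := c _ e0.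
exists d => // x' y' xd yd; apply: (H (x', y')).
by split; rewrite /ball /= distrC.
Qed.

Lemma near_cont2 g x y :
  (forall e : R, 0 < e -> exists2 d : R, 0 < d & forall x' y',
     `|x' - x| < d -> `|y' - y| < d -> `|g x y - g x' y'| <= e) -> cont2 g x y.
Proof.
move=> H; apply/cvgrPdist_le => e e0; have [d d0 Hd] := H _ e0.
suff : nbhs ((x, y) : R * R) (fun z : R * R => `|g x y - g z.1 z.2| <= e) by [].
apply/nbhs_ballP; exists d => // -[x' y'] [/= bx by_].
by apply: Hd; rewrite distrC.
Qed.

(** The first-order expansion with increment zero allowed, which frees the chain rule from punctured
    neighbourhoods. *)
Lemma is_derive_small (f : R -> R) t df e : is_derive t 1 f df -> 0 < e ->
  exists2 d : R, 0 < d & forall h, `|h| < d -> `|f (t + h) - f t - df * h| <= e * `|h|.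
Proof.
move=> [df1 df2] e0.
have : (fun h => h^-1 *: ((f \o shift t) (h *: 1) - f t)) @ 0^' --> df.
  by rewrite -df2; exact: df1.
move/cvgrPdist_le => /(_ _ e0); rewrite near_withinE => /nbhs_ballP[d /= d0 H].
exists d => // h hd; have [->|h0] := eqVneq h 0.
  by rewrite addr0 subrr mulr0 subrr normr0 mulr0.
have := H h; rewrite /ball /= sub0r normrN => /(_ hd h0).
rewrite scaler1 /= /GRing.scale /= [h + t]addrC => h1.
have -> : f (t + h) - f t - df * h = - (df - h^-1 * (f (t + h) - f t)) * h by field.
by rewrite normrM normrN ler_wpM2r.
Qed.

Lemma small_is_derive (f : R -> R) t df : (forall e : R, 0 < e ->
  exists2 d : R, 0 < d & forall h, `|h| < d -> `|f (t + h) - f t - df * h| <= e * `|h|) ->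
  is_derive t 1 f df.
Proof.
move=> H.
have c : (fun h => h^-1 *: ((f \o shift t) (h *: 1) - f t)) @ 0^' --> df.
  apply/cvgrPdist_le => e e0; have [d d0 Hd] := H _ e0.
  rewrite near_withinE; apply/nbhs_ballP; exists d => // h /=.
  rewrite /ball /= sub0r normrN => hd h0.
  have := Hd _ hd; rewrite scaler1 /= /GRing.scale /= [h + t]addrC => h1.
  have -> : df - h^-1 * (f (t + h) - f t) = - (f (t + h) - f t - df * h) * h^-1 by field.
  by rewrite normrM normrN normfV ler_pdivrMr ?normr_gt0.
by apply: DeriveDef; [apply/cvg_ex; exists df|exact: cvg_lim c].
Qed.

(** Continuous partial derivatives give total differentiability: the increment is cut into a
    horizontal leg at height [y'] and a vertical leg at abscissa [x], with the mean value theorem on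
    each. *)
Lemma C1_lin a M g gx gy x y e : C1sq a M g gx gy -> `|x| < a -> `|y| < a ->
  0 < e -> exists2 d : R, 0 < d & forall x' y', `|x' - x| < d -> `|y' - y| < d ->
   `|g x' y' - g x y - (gx x y * (x' - x) + gy x y * (y' - y))| <=
     e * (`|x' - x| + `|y' - y|).
Proof.
move=> C xa ya e0.
have [_ _ cx cy _] := C x y xa ya.
have [d1 d10 H1] := cont2_near cx e0; have [d2 d20 H2] := cont2_near cy e0.
pose d := Num.min (Num.min d1 d2) (Num.min (a - `|x|) (a - `|y|)).
have d0 : 0 < d by rewrite !lt_min d10 d20 !subr_gt0 xa ya.
have dd1 : d <= d1 by rewrite !ge_min lexx.
have dd2 : d <= d2 by rewrite !ge_min lexx !orbT.
have dx : d <= a - `|x| by rewrite !ge_min lexx !orbT.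
have dy : d <= a - `|y| by rewrite !ge_min lexx !orbT.
exists d => // x' y' xd yd.
have btw (u v z : R) : Num.min u v <= z <= Num.max u v -> `|z - u| <= `|v - u|.
  rewrite ge_min le_max => /andP[h1 h2]; have [uv|/ltW vu] := lerP u v.
    have uz : u <= z by case/orP: h1 => // /(le_trans uv).
    have zv : z <= v by case/orP: h2 => // h; exact: le_trans h uv.
    by rewrite !ger0_norm ?subr_ge0 //; lra.
  have vz : v <= z by case/orP: h1 => // /(le_trans vu).
  have zu : z <= u by case/orP: h2 => // h; exact: le_trans h vu.
  by rewrite !ler0_norm ?subr_le0 //; lra.
have ya' : `|y'| < a.
  have := ler_normD (y' - y) y; rewrite subrK; move: yd dy; lra.
have inx z : `|z - x| < d -> `|z| < a.
  have := ler_normD (z - x) x; rewrite subrK; move: dx; lra.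
have iny z : `|z - y| < d -> `|z| < a.
  have := ler_normD (z - y) y; rewrite subrK; move: dy; lra.
have [z|xi /btw xi1 E1] := @MVT_between _ (g^~ y') (gx^~ y') x x'.
  by move=> /btw h; have [] := C z y' (inx _ (le_lt_trans h xd)) ya'.
have [z|eta /btw eta1 E2] := @MVT_between _ (g x) (gy x) y y'.
  by move=> /btw h; have [] := C x z xa (iny _ (le_lt_trans h yd)).
have -> : g x' y' - g x y - (gx x y * (x' - x) + gy x y * (y' - y)) =
  - ((gx x y - gx xi y') * (x' - x)) - ((gy x y - gy x eta) * (y' - y)).
  have -> : g x' y' - g x y = (g x' y' - g x y') + (g x y' - g x y) by ring.
  by rewrite E1 E2; ring.
apply: le_trans (ler_normB _ _) _; rewrite normrN !normrM mulrDr.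
apply: lerD; rewrite ler_wpM2r //.
  by apply: H1; [apply: le_lt_trans xi1 _; apply: lt_le_trans xd _|apply: lt_le_trans yd _].
by apply: H2; [rewrite subrr normr0|apply: le_lt_trans eta1 _; apply: lt_le_trans yd _].
Qed.

Lemma C1_cont2 a M g gx gy x y : C1sq a M g gx gy -> `|x| < a -> `|y| < a ->
  cont2 g x y.
Proof.
move=> C xa ya; apply: near_cont2 => e e0.
have [d d0 H] := C1_lin C xa ya ltr01.
pose K := 1 + (`|gx x y| + `|gy x y|).
have K0 : 0 < K by rewrite ltr_pwDl ?addr_ge0.
exists (Num.min d (e / (2 * K))).
  by rewrite lt_min d0 divr_gt0 ?mulr_gt0.
move=> x' y'; rewrite !lt_min => /andP[xd xe] /andP[yd ye].
have h := H _ _ xd yd; rewrite mul1r in h.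
rewrite distrC; set A := g x' y' - g x y in h *.
have h2 : `|gx x y * (x' - x) + gy x y * (y' - y)| <=
   `|gx x y| * `|x' - x| + `|gy x y| * `|y' - y|.
  by apply: le_trans (ler_normD _ _) _; rewrite !normrM.
have h3 : `|A| <= `|x' - x| + `|y' - y| + (`|gx x y| * `|x' - x| + `|gy x y| * `|y' - y|).
  rewrite -[A](subrK (gx x y * (x' - x) + gy x y * (y' - y))).
  by apply: le_trans (ler_normD _ _) _; exact: lerD.
apply: le_trans h3 _.
apply: (@le_trans _ _ (K * (`|x' - x| + `|y' - y|))).
  rewrite /K; have := normr_ge0 (gx x y); have := normr_ge0 (gy x y).
  have := normr_ge0 (x' - x); have := normr_ge0 (y' - y); nra.
rewrite -ler_pdivlMl //; have -> : K^-1 * e = e / (2 * K) + e / (2 * K).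
  by field; rewrite gt_eqF.
by rewrite lerD // ltW.
Qed.

Lemma C1_chain a M g gx gy (X Y : R -> R) t dX dY : C1sq a M g gx gy ->
  `|X t| < a -> `|Y t| < a -> is_derive t 1 X dX -> is_derive t 1 Y dY ->
  is_derive t 1 (fun s => g (X s) (Y s))
    (gx (X t) (Y t) * dX + gy (X t) (Y t) * dY).
Proof.
move=> C xa ya hX hY; apply: small_is_derive => e e0.
set x := X t; set y := Y t.
(* [K |h|] dominates the increments of [X] and [Y], and [G] the size of the gradient of [g]; each of
   the two remainders then costs half of [e]. *)
pose K := `|dX| + `|dY| + 2; have K0 : 0 < K by rewrite ltr_wpDl ?addr_ge0.
pose G := `|gx x y| + `|gy x y| + 1; have G0 : 0 < G by rewrite ltr_wpDl ?addr_ge0.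
have e1 : 0 < e / (2 * K) by rewrite divr_gt0 ?mulr_gt0.
have e2 : 0 < Num.min 1 (e / (2 * G)) by rewrite lt_min ltr01 divr_gt0 ?mulr_gt0.
have [d d0 H] := C1_lin C xa ya e1.
have [d1 d10 H1] := is_derive_small hX e2.
have [d2 d20 H2] := is_derive_small hY e2.
exists (Num.min (Num.min d1 d2) (d / K)).
  by rewrite !lt_min d10 d20 divr_gt0.
move=> h; rewrite !lt_min => /andP[/andP[h1 h2] h3].
have X1 := H1 _ h1; have Y1 := H2 _ h2.
rewrite -/x -/y in X1 Y1 *.
set x' := X (t + h) in X1 *; set y' := Y (t + h) in Y1 *.
have nh := normr_ge0 h.
have lip (z z' dz : R) : `|z' - z - dz * h| <= Num.min 1 (e / (2 * G)) * `|h| ->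
    `|z' - z| <= (`|dz| + 1) * `|h| /\ `|z' - z - dz * h| <= e / (2 * G) * `|h|.
  move=> hz; split; last first.
    by apply: le_trans hz _; rewrite ler_wpM2r // ge_min lexx orbT.
  rewrite -[z' - z](subrK (dz * h)); apply: le_trans (ler_normD _ _) _.
  rewrite mulrDl mul1r normrM addrC lerD2l; apply: le_trans hz _.
  by rewrite -[leRHS]mul1r ler_wpM2r // ge_min lexx.
have [X2 X3] := lip _ _ _ X1; have [Y2 Y3] := lip _ _ _ Y1.
have Kh : K * `|h| < d by rewrite mulrC -ltr_pdivlMr.
have Xd : `|x' - x| < d.
  apply: le_lt_trans X2 (le_lt_trans _ Kh); rewrite ler_wpM2r // /K.
  by have := normr_ge0 dY; lra.
have Yd : `|y' - y| < d.
  apply: le_lt_trans Y2 (le_lt_trans _ Kh); rewrite ler_wpM2r // /K.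
  by have := normr_ge0 dX; lra.
have H3 := H _ _ Xd Yd.
have -> : g x' y' - g x y - (gx x y * dX + gy x y * dY) * h =
  (g x' y' - g x y - (gx x y * (x' - x) + gy x y * (y' - y))) +
  (gx x y * (x' - x - dX * h) + gy x y * (y' - y - dY * h)) by ring.
apply: le_trans (ler_normD _ _) _.
have -> : e * `|h| = e / (2 * K) * (K * `|h|) + G * (e / (2 * G) * `|h|).
  by field; rewrite ?gt_eqF.
apply: lerD.
  apply: le_trans H3 _; rewrite ler_wpM2l ?(ltW e1) //.
  by rewrite /K; apply: le_trans (lerD X2 Y2) _; rewrite le_eqVlt; apply/orP; left; apply/eqP; ring.
apply: le_trans (ler_normD _ _) _; rewrite !normrM.
apply: (@le_trans _ _ ((`|gx x y| + `|gy x y|) * (e / (2 * G) * `|h|))).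
  by rewrite mulrDl lerD // ler_wpM2l.
have e3 : 0 < e / (2 * G) by rewrite divr_gt0 ?mulr_gt0.
by apply: ler_wpM2r; [exact: mulr_ge0 (ltW e3) nh|rewrite /G lerDl].
Qed.

Lemma cont2_path (T : Type) (F : set_system T) (FF : Filter F) g (X Y : T -> R) x y :
  cont2 g x y -> X @ F --> x -> Y @ F --> y -> (fun s => g (X s) (Y s)) @ F --> g x y.
Proof. by move=> c; exact: continuous2_cvg. Qed.

Lemma C1_ccont_y a M g gx gy x b c : C1sq a M g gx gy -> `|x| < a ->
  - a < b -> c < a -> ccont b c (g x).
Proof.
move=> C xa ab ca y /andP[yb yc].
have ya : `|y| < a by rewrite ltr_norml; apply/andP; split; lra.
by have [_ d _ _ _] := C x y xa ya; exact: is_derive_cont d.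
Qed.

Lemma C1_ccont_x a M g gx gy y b c : C1sq a M g gx gy -> `|y| < a ->
  - a < b -> c < a -> ccont b c (g^~ y).
Proof.
move=> C ya ab ca x /andP[xb xc].
have xa : `|x| < a by rewrite ltr_norml; apply/andP; split; lra.
by have [d _ _ _ _] := C x y xa ya; exact: is_derive_cont d.
Qed.

Lemma cont2_ccont_y a g x b c : (forall y, `|y| < a -> cont2 g x y) ->
  - a < b -> c < a -> ccont b c (g x).
Proof.
move=> H ab ca y /andP[yb yc].
have ya : `|y| < a by rewrite ltr_norml; apply/andP; split; lra.
by apply: (@cont2_path _ (nbhs y) _ g (fun=> x) id x y (H _ ya)); [exact: cvg_cst|exact: cvg_id].
Qed.

(** Poincare lemma along a horizontal and then a vertical leg from the corner [(l, l)]. In the first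
    variable the derivative is [P x l] plus the integral of [Qx = Py], which telescopes to [P x y].
    The two legs have length at most 3, hence a bound [6 M], within [7 M]. *)
Lemma C1_potential M P Px Py Q Qx Qy :
  C1sq 2 M P Px Py -> C1sq 2 M Q Qx Qy ->
  (forall x y, `|x| < 2 -> `|y| < 2 -> Py x y = Qx x y) ->
  exists phi, C1sq (3 / 2) (7 * M) phi P Q.
Proof.
move=> CP CQ PQ; pose l : R := - (3 / 2).
have l2 : `|l| < 2 by rewrite /l normrN ger0_norm; lra.
exists (fun x y => rint l x (P^~ l) + rint l y (Q x)) => x y xa ya.
have x2 : `|x| < 2 by lra.
have y2 : `|y| < 2 by lra.
have [xl xr] : l < x /\ x < 3 / 2 by move: xa; rewrite ltr_norml /l => /andP[].
have [yl yr] : l < y /\ y < 3 / 2 by move: ya; rewrite ltr_norml /l => /andP[].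
have [_ _ _ _ [PM _ _]] := CP x y x2 y2.
have [_ _ _ _ [QM _ _]] := CQ x y x2 y2.
have in2 z : l <= z <= 7 / 4 -> `|z| < 2.
  by rewrite ltr_norml /l => /andP[? ?]; apply/andP; split; lra.
(* The endpoint 7/4 lies strictly between 3/2 and 2, so the upper limits of integration are interior
   points, as [rint_FTC1] requires. *)
have cP : ccont l (7 / 4) (P^~ l) by apply: C1_ccont_x CP l2 _ _; rewrite /l; lra.
have cQ z : `|z| < 2 -> ccont l (7 / 4) (Q z).
  by move=> z2; apply: C1_ccont_y CQ z2 _ _; rewrite /l; lra.
have sub f z : z < 3 / 2 -> ccont l (7 / 4) f -> ccont l z f.
  by move=> zr cf w /andP[w1 w2]; apply: cf; rewrite w1 /=; lra.
split.
- have dP : is_derive x 1 (fun s => rint l s (P^~ l)) (P x l).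
    by apply: rint_FTC1 xl _ cP; lra.
  have dQ : is_derive x 1 (fun s => rint l y (Q s)) (rint l y (Qx x)).
    have [xn xp] : -2 < x /\ x < 2 by move: x2; rewrite ltr_norml => /andP[].
    have dQ1 (s z : R) : -2 < s < 2 -> l <= z <= y -> is_derive s 1 (Q^~ z) (Qx s z).
      rewrite -ltr_norml => s2 /andP[z1 z2].
      by have [] := CQ s z s2 (in2 z _); rewrite // z1 /=; lra.
    apply: (@rint_derive _ l y (-2) 2 Q Qx x M xn xp (ltW yl) _ dQ1).
      by move=> s; rewrite -ltr_norml => s2; apply: sub yr _; exact: cQ.
    move=> s z; rewrite -ltr_norml => s2 /andP[z1 z2].
    by have [] := CQ s z s2 (in2 z _); rewrite ?z1 /=; [lra|move=> ? ? ? ? []].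
  apply: (is_derive_to (is_derive_addf dP dQ)).
  have E : rint l y (Qx x) = rint l y (Py x).
    by apply: eq_rint => z /andP[z1 z2]; rewrite PQ // in2 // z1 /=; lra.
  have dPy z : l <= z <= y -> is_derive z 1 (P x) (Py x z).
    by move=> /andP[z1 z2]; have [] := CP x z x2 (in2 z _); rewrite // z1 /=; lra.
  rewrite E (rint_FTC2 yl _ dPy); first by ring.
  apply: (@cont2_ccont_y 2) => [z z2||]; [|rewrite /l; lra|lra].
  by have [] := CP x z x2 z2.
- have dQ : is_derive y 1 (fun s => rint l s (Q x)) (Q x y).
    by apply: rint_FTC1 yl _ (cQ x x2); lra.
  by apply: (is_derive_to (is_derive_addf (is_derive_cstf _ y) dQ)); rewrite add0r.
- exact: C1_cont2 CP x2 y2.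
- exact: C1_cont2 CQ x2 y2.
- have M0 : 0 <= M := le_trans (normr_ge0 _) PM.
  split; [|lra|lra].
  have b1 : `|rint l x (P^~ l)| <= M * (x - l).
    apply: rint_bound (ltW xl) _ _; first exact: sub.
    move=> z /andP[z1 z2]; have [] := CP z l (in2 z _) l2; first by rewrite z1 /=; lra.
    by move=> ? ? ? ? [].
  have b2 : `|rint l y (Q x)| <= M * (y - l).
    apply: rint_bound (ltW yl) _ _; first by apply: sub yr _; exact: cQ.
    move=> z /andP[z1 z2]; have [] := CQ x z x2 (in2 z _); first by rewrite z1 /=; lra.
    by move=> ? ? ? ? [].
  apply: le_trans (ler_normD _ _) _; apply: le_trans (lerD b1 b2) _.
  by rewrite /l; nra.
Qed.

End C1Squares.

(** * The Cauchy formula *)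

Lemma cpow_mul (A : comNzRingType) (x1 y1 x2 y2 : A) n :
  cre (x1 * x2 - y1 * y2) (x1 * y2 + y1 * x2) n =
    cre x1 y1 n * cre x2 y2 n - cim x1 y1 n * cim x2 y2 n /\
  cim (x1 * x2 - y1 * y2) (x1 * y2 + y1 * x2) n =
    cre x1 y1 n * cim x2 y2 n + cim x1 y1 n * cre x2 y2 n.
Proof.
elim: n => [|n [IH1 IH2]]; first by rewrite !cre0 !cim0; split; ring.
by rewrite !creS !cimS IH1 IH2; split; ring.
Qed.

Lemma cpow_norm (A : comNzRingType) (x y : A) n :
  cre x y n ^+ 2 + cim x y n ^+ 2 = (x ^+ 2 + y ^+ 2) ^+ n.
Proof.
elim: n => [|n IH]; first by rewrite cre0 cim0; ring.
by rewrite creS cimS [RHS]exprS -IH; ring.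
Qed.

Lemma norm_le_sqr (R : realType) (x d : R) : 0 <= d -> x ^+ 2 <= d ^+ 2 -> `|x| <= d.
Proof.
move=> d0 xd; rewrite -(@ler_pXn2r _ 2) ?nnegrE //.
by rewrite real_normK ?num_real.
Qed.

Lemma cpow_le (R : realType) (x y d : R) n : 0 <= d -> x ^+ 2 + y ^+ 2 <= d ^+ 2 ->
  `|cre x y n| <= d ^+ n /\ `|cim x y n| <= d ^+ n.
Proof.
move=> d0 xy; have h : cre x y n ^+ 2 + cim x y n ^+ 2 <= (d ^+ n) ^+ 2.
  rewrite cpow_norm exprAC; apply: lerXn2r => //; rewrite nnegrE ?sqr_ge0 //.
  by rewrite addr_ge0 ?sqr_ge0.
have := sqr_ge0 (cre x y n); have := sqr_ge0 (cim x y n) => i0 r0.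
by split; apply: norm_le_sqr; rewrite ?exprn_ge0 //; lra.
Qed.

Section CauchyFormula.
Variable R : realType.
Implicit Types (t th : R).

Let tau : R := pi *+ 2.
Let tau_gt0 : 0 < tau. Proof. by rewrite /tau mulrn_wgt0 // pi_gt0. Qed.

(** [er n th + i ei n th] is [exp (- i n th)], encoded as a complex power so that [cpow_mul] applies
    to it. *)
Definition er n th : R := cre (cos th) (- sin th) n.
Definition ei n th : R := cim (cos th) (- sin th) n.

Lemma is_derive_er_ei n th :
  is_derive th 1 (er n) (n%:R * ei n th) /\ is_derive th 1 (ei n) (- (n%:R * er n th)).
Proof.
elim: n => [|n [IH1 IH2]].
  split; rewrite mul0r ?oppr0; exact: is_derive_cstf.
have dc := is_derive_cos th; have ds := is_derive_sin th.
have dn := is_derive_subf (is_derive_cstf 0 th) ds.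
have e1 : er n.+1 = (fun s => cos s * er n s - (0 - sin s) * ei n s).
  by apply/funext => s; rewrite /er /ei creS sub0r.
have e2 : ei n.+1 = (fun s => cos s * ei n s + (0 - sin s) * er n s).
  by apply/funext => s; rewrite /er /ei cimS sub0r.
rewrite e1 e2; split.
  apply: (is_derive_to (is_derive_subf (is_derive_mulf dc IH1) (is_derive_mulf dn IH2))).
  by rewrite -natr1; ring.
apply: (is_derive_to (is_derive_addf (is_derive_mulf dc IH2) (is_derive_mulf dn IH1))).
by rewrite -natr1; ring.
Qed.

Lemma er_cont n a b : ccont a b (er n).
Proof. by move=> x _; have [d _] := is_derive_er_ei n x; exact: is_derive_cont d. Qed.

Lemma ei_cont n a b : ccont a b (ei n).
Proof. by move=> x _; have [_ d] := is_derive_er_ei n x; exact: is_derive_cont d. Qed.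

Lemma er_ei_le n th : `|er n th| <= 1 /\ `|ei n th| <= 1.
Proof.
have := @cpow_le R (cos th) (- sin th) 1 n ler01; rewrite sqrrN cos2Dsin2 !expr1n.
by apply.
Qed.

Lemma rint_er n : rint 0 tau (er n.+1) = 0.
Proof.
have nz : n.+1%:R != 0 :> R by rewrite pnatr_eq0.
have d x : 0 <= x <= tau -> is_derive x 1 (fun s => - n.+1%:R^-1 * ei n.+1 s) (er n.+1 x).
  move=> _; have [_ d] := is_derive_er_ei n.+1 x.
  by apply: (is_derive_to (is_derive_mulf (is_derive_cstf _ x) d)); field.
rewrite (rint_FTC2 tau_gt0 (@er_cont _ _ _) d).
by rewrite /ei /tau cos2pi sin2pi cos0 sin0 subrr.
Qed.

Lemma rint_ei n : rint 0 tau (ei n) = 0.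
Proof.
case: n => [|n].
  by rewrite (_ : ei 0 = fun=> 0) // rint_cst ?mul0r // ltW.
have nz : n.+1%:R != 0 :> R by rewrite pnatr_eq0.
have d x : 0 <= x <= tau -> is_derive x 1 (fun s => n.+1%:R^-1 * er n.+1 s) (ei n.+1 x).
  move=> _; have [d _] := is_derive_er_ei n.+1 x.
  by apply: (is_derive_to (is_derive_mulf (is_derive_cstf _ x) d)); field.
rewrite (rint_FTC2 tau_gt0 (@ei_cont _ _ _) d).
by rewrite /er /tau cos2pi sin2pi cos0 sin0 subrr.
Qed.

Section Kernel.
Variables w1 w2 : R.
Hypotheses (w1b : `|w1| <= 4^-1) (w2b : `|w2| <= 4^-1).

Let w1b' : - 4^-1 <= w1 <= 4^-1. Proof. by rewrite -ler_norml. Qed.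
Let w2b' : - 4^-1 <= w2 <= 4^-1. Proof. by rewrite -ler_norml. Qed.

(** The square of half-side 1/4 lies in the open disc of radius 1/2; this is the source of the ratio
    [2^-1] in the Taylor estimates. *)
Let wsq : w1 ^+ 2 + w2 ^+ 2 <= 8^-1.
Proof. by move: w1b' w2b' => /andP[? ?] /andP[? ?]; nra. Qed.

Definition kden th := (cos th - w1) ^+ 2 + (sin th - w2) ^+ 2.
(* [kre + i kim] is the Cauchy kernel [z / (z - w)] at [z = exp (i th)]. *)
Definition kre th := (1 - (cos th * w1 + sin th * w2)) / kden th.
Definition kim th := (cos th * w2 - sin th * w1) / kden th.

(** By Cauchy-Schwarz the scalar product of [w] with a unit vector is at most 3/8, because
    [1 / 8 <= (3 / 8) ^ 2]; hence [|z - w| ^ 2 >= 1 - 2 * (3 / 8)]. *)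
Lemma kden_ge th : 4^-1 <= kden th.
Proof.
have cs : cos th ^+ 2 + sin th ^+ 2 = 1 :> R by rewrite cos2Dsin2.
have h : (cos th * w1 + sin th * w2) ^+ 2 <= (3 / 8) ^+ 2.
  apply: (@le_trans _ _ ((cos th ^+ 2 + sin th ^+ 2) * (w1 ^+ 2 + w2 ^+ 2))).
    have := sqr_ge0 (cos th * w2 - sin th * w1); lra.
  by rewrite cs mul1r; have := wsq; lra.
have h2 : cos th * w1 + sin th * w2 <= 3 / 8.
  apply: le_trans (ler_norm _) _.
  by apply: norm_le_sqr; rewrite ?divr_ge0.
have := sqr_ge0 w1; have := sqr_ge0 w2; rewrite /kden; lra.
Qed.

Lemma kden_gt0 th : 0 < kden th.
Proof. by have := kden_ge th; lra. Qed.

Let kden_neq0 th : kden th != 0. Proof. by rewrite gt_eqF // kden_gt0. Qed.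

Lemma ccont_cos a b : ccont a b (@cos R).
Proof. by move=> x _; exact: continuous_cos. Qed.
Lemma ccont_sin a b : ccont a b (@sin R).
Proof. by move=> x _; exact: continuous_sin. Qed.

Lemma ccont_kinv a b : ccont a b (fun th => (kden th)^-1).
Proof.
move=> x xab; apply: cvgV => //.
have c : ccont a b kden.
  have c1 := ccontB (@ccont_cos a b) (@ccont_cst _ a b w1).
  have c2 := ccontB (@ccont_sin a b) (@ccont_cst _ a b w2).
  exact: ccontD (ccontM c1 c1) (ccontM c2 c2).
exact: c.
Qed.

Lemma kre_cont a b : ccont a b kre.
Proof.
apply: ccontM (@ccont_kinv _ _); apply: ccontB; first exact: ccont_cst.
by apply: ccontD; apply: ccontM; try exact: ccont_cst; [exact: ccont_cos|exact: ccont_sin].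
Qed.

Lemma kim_cont a b : ccont a b kim.
Proof.
apply: ccontM (@ccont_kinv _ _).
by apply: ccontB; apply: ccontM; try exact: ccont_cst; [exact: ccont_cos|exact: ccont_sin].
Qed.

Lemma norm_cos_le1 th : `|cos th| <= 1 :> R.
Proof. by rewrite ler_norml cos_geN1 cos_le1. Qed.
Lemma norm_sin_le1 th : `|sin th| <= 1 :> R.
Proof. by rewrite ler_norml sin_geN1 sin_le1. Qed.

Lemma kernel_le th : `|kre th| <= 8 /\ `|kim th| <= 8.
Proof.
have c1 := norm_cos_le1 th; have s1 := norm_sin_le1 th.
have cm (u v : R) : `|u| <= 1 -> `|v| <= 4^-1 -> `|u * v| <= 4^-1.
  by move=> u1 v1; rewrite normrM -[leRHS]mul1r ler_pM.
have h1 := cm _ _ c1 w1b; have h2 := cm _ _ c1 w2b.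
have h3 := cm _ _ s1 w1b; have h4 := cm _ _ s1 w2b.
have kd := kden_ge th; have k0 := kden_gt0 th.
rewrite /kre /kim !normrM !normfV !(gtr0_norm k0) !ler_pdivrMr //.
move: h1 h2 h3 h4; rewrite !ler_norml => /andP[? ?] /andP[? ?] /andP[? ?] /andP[? ?].
by split; apply/andP; split; lra.
Qed.

(** [wa + i wb] is [w / z] with [z = exp (i th)], left in the unsimplified shape of [cpow_mul]. *)
Let wa th : R := w1 * cos th - w2 * (- sin th).
Let wb th : R := w1 * (- sin th) + w2 * cos th.

(** The kernel is [1 / (1 - w / z)], so it satisfies [K = 1 + (w / z) K]. Iterating this yields the
    geometric expansion with an exact remainder. *)
Lemma kernel_fix th : kre th = 1 + (wa th * kre th - wb th * kim th) /\
  kim th = wa th * kim th + wb th * kre th.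
Proof.
have cs : cos th ^+ 2 = 1 - sin th ^+ 2 :> R by rewrite -(cos2Dsin2 th) addrK.
have kE : kden th = 1 - 2 * (cos th * w1 + sin th * w2) + (w1 ^+ 2 + w2 ^+ 2).
  by rewrite /kden; have := cs; lra.
have nz := kden_neq0 th; rewrite kE in nz.
rewrite /kre /kim /wa /wb kE.
by split; field: cs.
Qed.

Lemma kernel_expand N th :
  kre th = \sum_(i < N) cre (wa th) (wb th) i +
    (cre (wa th) (wb th) N * kre th - cim (wa th) (wb th) N * kim th) /\
  kim th = \sum_(i < N) cim (wa th) (wb th) i +
    (cre (wa th) (wb th) N * kim th + cim (wa th) (wb th) N * kre th).
Proof.
have [f1 f2] := kernel_fix th.
elim: N => [|N [IH1 IH2]]; first by rewrite !big_ord0 cre0 cim0; split; ring.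
rewrite !big_ord_recr /= !creS !cimS.
set A := cre _ _ N in IH1 IH2 *; set B := cim _ _ N in IH1 IH2 *.
set SA := \sum_(i < N) _ in IH1 *; set SB := \sum_(i < N) _ in IH2 *.
have g1 : A * kre th - B * kim th = A + ((wa th * A - wb th * B) * kre th -
     (wa th * B + wb th * A) * kim th).
  transitivity (A * (1 + (wa th * kre th - wb th * kim th)) -
    B * (wa th * kim th + wb th * kre th)); [by rewrite -f1 -f2|ring].
have g2 : A * kim th + B * kre th = B + ((wa th * A - wb th * B) * kim th +
     (wa th * B + wb th * A) * kre th).
  transitivity (A * (wa th * kim th + wb th * kre th) +
    B * (1 + (wa th * kre th - wb th * kim th))); [by rewrite -f1 -f2|ring].
by split; [rewrite {1}IH1 g1 addrA|rewrite {1}IH2 g2 addrA].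
Qed.

Variables (hp hq : R -> R) (M : R).
Hypotheses (chp : ccont 0 tau hp) (chq : ccont 0 tau hq).
Hypotheses (hpM : forall th, 0 <= th <= tau -> `|hp th| <= M).
Hypotheses (hqM : forall th, 0 <= th <= tau -> `|hq th| <= M).

(** Taylor coefficients as Fourier integrals of the boundary values [hp + i hq] against
    [exp (- i n th)], before division by [2 pi]. *)
Definition fcr n := rint 0 tau (fun th => hp th * er n th - hq th * ei n th).
Definition fci n := rint 0 tau (fun th => hp th * ei n th + hq th * er n th).

Let cR n : ccont 0 tau (fun th => hp th * er n th - hq th * ei n th).
Proof. exact: ccontB (ccontM chp (@er_cont n 0 tau)) (ccontM chq (@ei_cont n 0 tau)). Qed.
Let cI n : ccont 0 tau (fun th => hp th * ei n th + hq th * er n th).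
Proof. exact: ccontD (ccontM chp (@ei_cont n 0 tau)) (ccontM chq (@er_cont n 0 tau)). Qed.

Lemma fc_le n : `|fcr n| <= 2 * M * tau /\ `|fci n| <= 2 * M * tau.
Proof.
have b th : 0 <= th <= tau ->
   `|hp th * er n th - hq th * ei n th| <= 2 * M /\
   `|hp th * ei n th + hq th * er n th| <= 2 * M.
  move=> i; have [e1 e2] := er_ei_le n th.
  have -> : 2 * M = M + M by ring.
  have m (u v : R) : `|u| <= M -> `|v| <= 1 -> `|u * v| <= M.
    by move=> u1 v1; rewrite normrM -[leRHS]mulr1 ler_pM.
  split; [apply: le_trans (ler_normB _ _) _|apply: le_trans (ler_normD _ _) _];
  by apply: lerD; apply: m => //; [exact: hpM|exact: hqM].
have t0 := ltW tau_gt0.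
split; rewrite -[X in _ * X](subr0 tau); apply: rint_bound => // th /b[] //.
Qed.

(** The expanded kernel is integrated term by term against the boundary values, where [(w / z) ^ n]
    separates into [w ^ n] and a Fourier factor. Each component of the remainder is at most
    [(8 + 8) 2^-N]; two components of data bounded by [M] over a length [tau] give 32. *)
Lemma kernel_series N :
  `|rint 0 tau (fun th => hp th * kre th - hq th * kim th) -
    cseries fcr fci w1 w2 N| <= 32 * M * tau * 2^-1 ^+ N /\
  `|rint 0 tau (fun th => hp th * kim th + hq th * kre th) -
    \sum_(i < N) (fcr i * cim w1 w2 i + fci i * cre w1 w2 i)| <=
    32 * M * tau * 2^-1 ^+ N.
Proof.
have t0 := ltW tau_gt0.
pose A th := cre (wa th) (wb th) N; pose B th := cim (wa th) (wb th) N.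
have [AE BE] : (forall th, A th = cre w1 w2 N * er N th - cim w1 w2 N * ei N th) /\
    (forall th, B th = cre w1 w2 N * ei N th + cim w1 w2 N * er N th).
  by split=> th; have [e1 e2] := cpow_mul w1 w2 (cos th) (- sin th) N.
have AB th : `|A th| <= 2^-1 ^+ N /\ `|B th| <= 2^-1 ^+ N.
  apply: cpow_le => //; have cs := cos2Dsin2 th.
  have -> : wa th ^+ 2 + wb th ^+ 2 =
    (cos th ^+ 2 + sin th ^+ 2) * (w1 ^+ 2 + w2 ^+ 2) by rewrite /wa /wb; ring.
  by rewrite cs mul1r; have := wsq; lra.
have cA : ccont 0 tau A.
  rewrite (_ : A = fun th => cre w1 w2 N * er N th - cim w1 w2 N * ei N th); last exact/funext.
  by apply: ccontB; apply: ccontM; try exact: ccont_cst; [exact: er_cont|exact: ei_cont].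
have cB : ccont 0 tau B.
  rewrite (_ : B = fun th => cre w1 w2 N * ei N th + cim w1 w2 N * er N th); last exact/funext.
  by apply: ccontD; apply: ccontM; try exact: ccont_cst; [exact: ei_cont|exact: er_cont].
pose X th := A th * kre th - B th * kim th.
pose Y th := A th * kim th + B th * kre th.
have cX : ccont 0 tau X by exact: ccontB (ccontM cA (@kre_cont 0 tau)) (ccontM cB (@kim_cont 0 tau)).
have cY : ccont 0 tau Y by exact: ccontD (ccontM cA (@kim_cont 0 tau)) (ccontM cB (@kre_cont 0 tau)).
have m (u v a b : R) : `|u| <= a -> `|v| <= b -> `|u * v| <= a * b.
  by move=> u1 v1; rewrite normrM ler_pM.
have XY th : `|X th| <= 16 * 2^-1 ^+ N /\ `|Y th| <= 16 * 2^-1 ^+ N.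
  have [a1 b1] := AB th; have [k1 k2] := kernel_le th.
  have -> : 16 * 2^-1 ^+ N = 2^-1 ^+ N * 8 + 2^-1 ^+ N * 8 :> R by ring.
  by split; [apply: le_trans (ler_normB _ _) _|apply: le_trans (ler_normD _ _) _];
    apply: lerD; apply: m.
have bnd f : ccont 0 tau f -> (forall th, 0 <= th <= tau ->
     `|f th| <= M * (16 * 2^-1 ^+ N) + M * (16 * 2^-1 ^+ N)) ->
     `|rint 0 tau f| <= 32 * M * tau * 2^-1 ^+ N.
  move=> cf fM; apply: le_trans (rint_bound t0 cf fM) _.
  by rewrite subr0 le_eqVlt; apply/orP; left; apply/eqP; ring.
have cH f g : ccont 0 tau f -> ccont 0 tau g -> ccont 0 tau (fun th => hp th * f th - hq th * g th).
  by move=> cf cg; apply: ccontB; exact: ccontM.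
have cH' f g : ccont 0 tau f -> ccont 0 tau g -> ccont 0 tau (fun th => hp th * f th + hq th * g th).
  by move=> cf cg; apply: ccontD; exact: ccontM.
(* [T1 i] and [T2 i] are the real and imaginary parts of [w ^ i (hp + i hq) exp (- i i th)], the
   last [i i] being the imaginary unit times the index. *)
pose T1 i th := cre w1 w2 i * (hp th * er i th - hq th * ei i th) -
  cim w1 w2 i * (hp th * ei i th + hq th * er i th).
pose T2 i th := cim w1 w2 i * (hp th * er i th - hq th * ei i th) +
  cre w1 w2 i * (hp th * ei i th + hq th * er i th).
have cZ c f : ccont 0 tau f -> ccont 0 tau (fun th => c * f th).
  by move=> cf; exact: ccontM (@ccont_cst _ 0 tau c) cf.
have cT1 i : ccont 0 tau (T1 i) by apply: ccontB; apply: cZ.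
have cT2 i : ccont 0 tau (T2 i) by apply: ccontD; apply: cZ.
have pw th i : cre (wa th) (wb th) i = cre w1 w2 i * er i th - cim w1 w2 i * ei i th /\
   cim (wa th) (wb th) i = cre w1 w2 i * ei i th + cim w1 w2 i * er i th.
  exact: cpow_mul.
have expand th : kre th = \sum_(i < N) cre (wa th) (wb th) i + X th /\
   kim th = \sum_(i < N) cim (wa th) (wb th) i + Y th by exact: kernel_expand.
split.
- have E : rint 0 tau (fun th => hp th * kre th - hq th * kim th) =
    cseries fcr fci w1 w2 N + rint 0 tau (fun th => hp th * X th - hq th * Y th).
    have -> : cseries fcr fci w1 w2 N = \sum_(i < N) rint 0 tau (T1 i).
      apply: eq_bigr => i _; rewrite /T1 rintB; [|exact: cZ|exact: cZ].
      by rewrite !rintZ // /fcr /fci [_ * cre _ _ _]mulrC [_ * cim _ _ _]mulrC.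
    rewrite -rint_sum // -rintD; [|exact: ccont_sum|exact: cH].
    apply: eq_rint => th _; have [e1 e2] := expand th.
    rewrite e1 e2 !mulrDr opprD addrACA; congr (_ + _).
    rewrite !mulr_sumr -sumrB; apply: eq_bigr => i _.
    by have [-> ->] := pw th i; rewrite /T1; ring.
  rewrite E addrAC subrr add0r; apply: bnd; first exact: cH.
  move=> th i; have [x1 y1] := XY th; apply: le_trans (ler_normB _ _) _.
  by apply: lerD; apply: m => //; [exact: hpM|exact: hqM].
- have E : rint 0 tau (fun th => hp th * kim th + hq th * kre th) =
    \sum_(i < N) (fcr i * cim w1 w2 i + fci i * cre w1 w2 i)
     + rint 0 tau (fun th => hp th * Y th + hq th * X th).
    have -> : \sum_(i < N) (fcr i * cim w1 w2 i + fci i * cre w1 w2 i)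
        = \sum_(i < N) rint 0 tau (T2 i).
      apply: eq_bigr => i _; rewrite /T2 rintD; [|exact: cZ|exact: cZ].
      by rewrite !rintZ // /fcr /fci [_ * cre _ _ _]mulrC [_ * cim _ _ _]mulrC.
    rewrite -rint_sum // -rintD; [|exact: ccont_sum|exact: cH'].
    apply: eq_rint => th _; have [e1 e2] := expand th.
    rewrite e1 e2 !mulrDr addrACA; congr (_ + _).
    rewrite !mulr_sumr -big_split; apply: eq_bigr => i _ /=.
    by have [-> ->] := pw th i; rewrite /T2; ring.
  rewrite E addrAC subrr add0r; apply: bnd; first exact: cH'.
  move=> th i; have [x1 y1] := XY th; apply: le_trans (ler_normD _ _) _.
  by apply: lerD; apply: m => //; [exact: hpM|exact: hqM].
Qed.

End Kernel.
End CauchyFormula.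

(** * Cauchy formula and Taylor series for C1 solutions of the Cauchy-Riemann equations *)

Section CauchySeries.
Variable R : realType.
Implicit Types (t th x y : R).

Local Notation tau := (pi *+ 2 : R).

Lemma geometric_zero (x C : R) : (forall N, `|x| <= C * 2^-1 ^+ N) -> x = 0.
Proof.
move=> H; apply/eqP; rewrite -normr_le0.
have h0 : (fun k => C * (2^-1 : R) ^+ k) @ \oo --> (0 : R).
  rewrite -(mulr0 C); apply: cvgM; first exact: cvg_cst.
  by apply: cvg_expr; rewrite ger0_norm //; lra.
rewrite -(cvg_lim _ h0) //; apply: limr_ge; first by apply/cvg_ex; eexists; exact: h0.
by apply: nearW => k; exact: H.
Qed.

Lemma tau_gt0 : 0 < tau. Proof. by rewrite mulrn_wgt0 // pi_gt0. Qed.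

(** The kernel has total mass [2 pi]. Applying [kernel_series] to the boundary value 1 leaves only
    the coefficient of index 0, and an error below [C 2^-N] for every [N] is zero. *)
Lemma rint_kernel (w1 w2 : R) : `|w1| <= 4^-1 -> `|w2| <= 4^-1 ->
  rint 0 tau (kre w1 w2) = tau /\ rint 0 tau (kim w1 w2) = 0.
Proof.
move=> w1b w2b; have t0 := ltW tau_gt0.
have c1 : ccont 0 tau (fun=> 1 : R) by exact: ccont_cst.
have c0 : ccont 0 tau (fun=> 0 : R) by exact: ccont_cst.
have b1 (th : R) : 0 <= th <= tau -> `|1 : R| <= 1 by rewrite normr1.
have b0 (th : R) : 0 <= th <= tau -> `|0 : R| <= 1 by rewrite normr0.
have K := kernel_series w1b w2b c1 c0 b1 b0.
have F n : fcr (fun=> 1) (fun=> 0) n = (if n is 0 then tau else 0 : R).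
  rewrite /fcr; under [fun th => _]eq_fun do rewrite mul1r mul0r subr0.
  case: n => [|n]; last exact: rint_er.
  by rewrite (_ : er 0 = fun=> 1) // rint_cst // mul1r subr0.
have G n : fci (fun=> 1) (fun=> 0) n = 0 :> R.
  rewrite /fci; under [fun th => _]eq_fun do rewrite mul1r mul0r addr0.
  exact: rint_ei.
have S1 N : cseries (fcr (fun=> 1) (fun=> 0)) (fci (fun=> 1) (fun=> 0)) w1 w2 N.+1 = tau.
  rewrite /cseries big_ord_recl big1 => [|i _]; last by rewrite F G !mul0r subr0.
  by rewrite F G cre0 mul0r mulr1 subr0 addr0.
have S2 N : \sum_(i < N) (fcr (fun=> 1) (fun=> 0) i * cim w1 w2 i +
     fci (fun=> 1) (fun=> 0) i * cre w1 w2 i) = 0 :> R.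
  by apply: big1 => -[[|i] ?] _; rewrite F G /= ?cim0 !(mul0r, mulr0) addr0.
have E1 : rint 0 tau (fun th => 1 * kre w1 w2 th - 0 * kim w1 w2 th) = rint 0 tau (kre w1 w2).
  by apply: eq_rint => th _; ring.
have E2 : rint 0 tau (fun th => 1 * kim w1 w2 th + 0 * kre w1 w2 th) = rint 0 tau (kim w1 w2).
  by apply: eq_rint => th _; ring.
split; apply/eqP; rewrite -subr_eq0; apply/eqP.
  apply: (@geometric_zero _ (32 * 1 * tau * 2^-1)) => N.
  have [+ _] := K N.+1; rewrite E1 S1 => /le_trans; apply.
  by rewrite exprS mulrA.
apply: (@geometric_zero _ (32 * 1 * tau)) => N.
by have [_] := K N; rewrite E2 S2.
Qed.

Section Holomorphic.
Variables (M : R) (p px py q qx qy : R -> R -> R).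
Hypotheses (Cp : C1sq (3 / 2) M p px py) (Cq : C1sq (3 / 2) M q qx qy).
Hypothesis CR1 : forall x y, `|x| < 3 / 2 -> `|y| < 3 / 2 -> qy x y = px x y.
Hypothesis CR2 : forall x y, `|x| < 3 / 2 -> `|y| < 3 / 2 -> py x y = - qx x y.

Section Point.
Variables w1 w2 : R.
Hypotheses (w1b : `|w1| <= 4^-1) (w2b : `|w2| <= 4^-1).

(** The segment from [w] to the point of the unit circle at angle [th]: [t] contracts the circle to
    the centre [w]. *)
Let X t th : R := w1 + t * (cos th - w1).
Let Y t th : R := w2 + t * (sin th - w2).

(** The parameter interval exceeds [[0, 1]] on both sides so that derivatives at 0 and 1 are
    two-sided; the curves still stay in the square of half-side 3/2. *)
Let inner (w c t : R) : `|w| <= 4^-1 -> `|c| <= 1 -> -8^-1 < t < 9 / 8 ->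
  `|w + t * (c - w)| < 3 / 2.
Proof.
rewrite ler_norml ler_norml ltr_norml => /andP[? ?] /andP[? ?] /andP[? ?].
by apply/andP; split; nra.
Qed.

Let Xin t th : -8^-1 < t < 9 / 8 -> `|X t th| < 3 / 2.
Proof. by apply: inner => //; exact: norm_cos_le1. Qed.
Let Yin t th : -8^-1 < t < 9 / 8 -> `|Y t th| < 3 / 2.
Proof. by apply: inner => //; exact: norm_sin_le1. Qed.

Let dXt t th : is_derive t 1 (X^~ th) (cos th - w1).
Proof.
apply: (is_derive_to (is_derive_addf (is_derive_cstf w1 t)
  (is_derive_mulf (is_derive_idf t) (is_derive_cstf (cos th - w1) t)))); ring.
Qed.
Let dYt t th : is_derive t 1 (Y^~ th) (sin th - w2).
Proof.
apply: (is_derive_to (is_derive_addf (is_derive_cstf w2 t)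
  (is_derive_mulf (is_derive_idf t) (is_derive_cstf (sin th - w2) t)))); ring.
Qed.
Let dXth t th : is_derive th 1 (X t) (t * (- sin th)).
Proof.
apply: (is_derive_to (is_derive_addf (is_derive_cstf w1 th)
  (is_derive_mulf (is_derive_cstf t th)
    (is_derive_subf (is_derive_cos th) (is_derive_cstf w1 th))))); ring.
Qed.
Let dYth t th : is_derive th 1 (Y t) (t * cos th).
Proof.
apply: (is_derive_to (is_derive_addf (is_derive_cstf w2 th)
  (is_derive_mulf (is_derive_cstf t th)
    (is_derive_subf (is_derive_sin th) (is_derive_cstf w2 th))))); ring.
Qed.

Let pc t : -8^-1 < t < 9 / 8 -> ccont 0 tau (fun th => p (X t th) (Y t th)).
Proof.
move=> ti th _.
exact: is_derive_cont (C1_chain Cp (Xin th ti) (Yin th ti) (dXth t th) (dYth t th)).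
Qed.
Let qc t : -8^-1 < t < 9 / 8 -> ccont 0 tau (fun th => q (X t th) (Y t th)).
Proof.
move=> ti th _.
exact: is_derive_cont (C1_chain Cq (Xin th ti) (Yin th ti) (dXth t th) (dYth t th)).
Qed.

Let gc (g : R -> R -> R) t : -8^-1 < t < 9 / 8 ->
  (forall x y, `|x| < 3 / 2 -> `|y| < 3 / 2 -> cont2 g x y) ->
  ccont 0 tau (fun th => g (X t th) (Y t th)).
Proof.
move=> ti H th _; apply: (@cont2_path _ _ (nbhs th) _ g (X t) (Y t)).
- exact: H (Xin th ti) (Yin th ti).
- exact: is_derive_cont (dXth t th).
- exact: is_derive_cont (dYth t th).
Qed.

Let pxc t : -8^-1 < t < 9 / 8 -> ccont 0 tau (fun th => px (X t th) (Y t th)).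
Proof. by move=> ti; apply: gc => // x y xi yi; have [] := Cp xi yi. Qed.
Let qxc t : -8^-1 < t < 9 / 8 -> ccont 0 tau (fun th => qx (X t th) (Y t th)).
Proof. by move=> ti; apply: gc => // x y xi yi; have [] := Cq xi yi. Qed.

Let kr := kre w1 w2.
Let ki := kim w1 w2.
(** With [f = p + i q] and [zeta = w + t (z - w)], [k1 + i k2] is [f (zeta)] times the Cauchy kernel
    and [l1 + i l2] is [f' (zeta) z]. *)
Let k1 t th := p (X t th) (Y t th) * kr th - q (X t th) (Y t th) * ki th.
Let k2 t th := p (X t th) (Y t th) * ki th + q (X t th) (Y t th) * kr th.
Let l1 t th := px (X t th) (Y t th) * cos th - qx (X t th) (Y t th) * sin th.
Let l2 t th := px (X t th) (Y t th) * sin th + qx (X t th) (Y t th) * cos th.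

Let kz th : (cos th - w1) * kr th - (sin th - w2) * ki th = cos th /\
  (cos th - w1) * ki th + (sin th - w2) * kr th = sin th.
Proof.
have nz : kden w1 w2 th != 0 by rewrite gt_eqF // kden_gt0.
have cs : cos th ^+ 2 = 1 - sin th ^+ 2 :> R by rewrite -(cos2Dsin2 th) addrK.
rewrite /kr /ki /kre /kim; split.
  rewrite mulrA mulrA -mulrBl; apply/(canLR (mulfK nz)).
  by rewrite /kden; ring: cs.
rewrite mulrA mulrA -mulrDl; apply/(canLR (mulfK nz)).
by rewrite /kden; ring: cs.
Qed.

(** The factor [z - w] from the chain rule cancels the denominator of the kernel, by [kz]. *)
Let dk t th : -8^-1 < t < 9 / 8 ->
  is_derive t 1 (k1^~ th) (l1 t th) /\ is_derive t 1 (k2^~ th) (l2 t th).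
Proof.
move=> ti; have xi := Xin th ti; have yi := Yin th ti.
have dp := @C1_chain _ _ _ _ _ _ (X^~ th) (Y^~ th) t _ _ Cp xi yi (dXt t th) (dYt t th).
have dq := @C1_chain _ _ _ _ _ _ (X^~ th) (Y^~ th) t _ _ Cq xi yi (dXt t th) (dYt t th).
have [z1 z2] := kz th.
have c0 (c : R) := is_derive_cstf c t.
split.
  apply: (is_derive_to (is_derive_subf (is_derive_mulf dp (c0 (kr th))) (is_derive_mulf dq (c0 (ki th))))).
  rewrite /= CR1 // CR2 //.
  transitivity (px (X t th) (Y t th) * ((cos th - w1) * kr th - (sin th - w2) * ki th) -
    qx (X t th) (Y t th) * ((cos th - w1) * ki th + (sin th - w2) * kr th)); first by ring.
  by rewrite z1 z2.
apply: (is_derive_to (is_derive_addf (is_derive_mulf dp (c0 (ki th))) (is_derive_mulf dq (c0 (kr th))))).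
rewrite /= CR1 // CR2 //.
transitivity (px (X t th) (Y t th) * ((cos th - w1) * ki th + (sin th - w2) * kr th) +
  qx (X t th) (Y t th) * ((cos th - w1) * kr th - (sin th - w2) * ki th)); first by ring.
by rewrite z1 z2.
Qed.

Let lc t : -8^-1 < t < 9 / 8 -> ccont 0 tau (l1 t) /\ ccont 0 tau (l2 t).
Proof.
move=> ti; split.
  exact: ccontB (ccontM (pxc ti) (@ccont_cos R 0 tau)) (ccontM (qxc ti) (@ccont_sin R 0 tau)).
exact: ccontD (ccontM (pxc ti) (@ccont_sin R 0 tau)) (ccontM (qxc ti) (@ccont_cos R 0 tau)).
Qed.

(** The derivative of [f (zeta)] in [th] is [i t] times [l1 + i l2], and [f (zeta)] is periodic.
    Dividing by [t] is what excludes [t = 0]. *)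
Let l0 t : -8^-1 < t < 9 / 8 -> t != 0 -> rint 0 tau (l1 t) = 0 /\ rint 0 tau (l2 t) = 0.
Proof.
move=> ti tn; have [c1 c2] := lc ti.
have per g : g (X t tau) (Y t tau) - g (X t 0) (Y t 0) = 0 :> R.
  by rewrite /X /Y cos2pi sin2pi cos0 sin0 subrr.
split; apply: (mulfI tn); rewrite mulr0 -rintZ //.
  have d th : 0 <= th <= tau -> is_derive th 1 (fun s => q (X t s) (Y t s)) (t * l1 t th).
    move=> _; have xi := Xin th ti; have yi := Yin th ti.
    apply: (is_derive_to (C1_chain Cq xi yi (dXth t th) (dYth t th))).
    by rewrite CR1 // /l1; ring.
  by rewrite (rint_FTC2 tau_gt0 _ d) //; exact: ccontM (@ccont_cst _ 0 tau t) c1.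
have d th : 0 <= th <= tau -> is_derive th 1 (fun s => 0 - p (X t s) (Y t s)) (t * l2 t th).
  move=> _; have xi := Xin th ti; have yi := Yin th ti.
  apply: (is_derive_to (is_derive_subf (is_derive_cstf 0 th) (C1_chain Cp xi yi (dXth t th) (dYth t th)))).
  by rewrite CR2 // /l2; ring.
rewrite (rint_FTC2 tau_gt0 _ d); first by rewrite (per (fun x y => 0 - p x y)).
exact: ccontM (@ccont_cst _ 0 tau t) c2.
Qed.

Let krc : ccont 0 tau kr. Proof. exact: kre_cont. Qed.
Let kic : ccont 0 tau ki. Proof. exact: kim_cont. Qed.

Let kc t : -8^-1 < t < 9 / 8 -> ccont 0 tau (k1 t) /\ ccont 0 tau (k2 t).
Proof.
move=> ti; split.
  exact: ccontB (ccontM (pc ti) krc) (ccontM (qc ti) kic).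
exact: ccontD (ccontM (pc ti) kic) (ccontM (qc ti) krc).
Qed.

Let lM t th : -8^-1 < t < 9 / 8 -> `|l1 t th| <= M + M /\ `|l2 t th| <= M + M.
Proof.
move=> ti; have xi := Xin th ti; have yi := Yin th ti.
have [_ _ _ _ [_ m1 _]] := Cp xi yi; have [_ _ _ _ [_ m2 _]] := Cq xi yi.
have m (u v : R) : `|u| <= M -> `|v| <= 1 -> `|u * v| <= M.
  by move=> u1 v1; rewrite normrM -[leRHS]mulr1 ler_pM.
have c1 := norm_cos_le1 th; have s1 := norm_sin_le1 th.
by split; [apply: le_trans (ler_normB _ _) _|apply: le_trans (ler_normD _ _) _];
  apply: lerD; apply: m.
Qed.

(** The mean value theorem picks a point in the open interval []0, 1[], where the excluded value 0
    cannot occur. *)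
Let const_zero (I I' : R -> R) :
  (forall t, -8^-1 < t < 9 / 8 -> is_derive t 1 I (I' t)) ->
  (forall t, -8^-1 < t < 9 / 8 -> t != 0 -> I' t = 0) -> I 1 = I 0.
Proof.
move=> dI I0; have [||c] := @MVT _ I I' 0 1 ltr01.
- by move=> t; rewrite in_itv /= => /andP[? ?]; apply: dI; apply/andP; split; lra.
- apply: continuous_in_subspaceT => t; rewrite inE /= in_itv /= => /andP[? ?].
  by apply: is_derive_cont (dI t _); apply/andP; split; lra.
rewrite in_itv /= => /andP[c0 c1]; rewrite I0 ?gt_eqF //; last by apply/andP; split; lra.
by rewrite mul0r => /eqP; rewrite subr_eq0 => /eqP.
Qed.

(** The integral does not depend on [t]: at [t = 1] it is the boundary integral, at [t = 0] it is
    [f w] times the mass of the kernel. *)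
Lemma cauchy_formula :
  tau * p w1 w2 = rint 0 tau (fun th => p (cos th) (sin th) * kre w1 w2 th -
     q (cos th) (sin th) * kim w1 w2 th) /\
  tau * q w1 w2 = rint 0 tau (fun th => p (cos th) (sin th) * kim w1 w2 th +
     q (cos th) (sin th) * kre w1 w2 th).
Proof.
have t0 := ltW tau_gt0.
have i1 : rint 0 tau (k1 1) = rint 0 tau (k1 0).
  apply: (@const_zero (fun t => rint 0 tau (k1 t)) (fun t => rint 0 tau (l1 t))).
    move=> t /andP[ta tb]; apply: (@rint_derive _ 0 tau (-8^-1) (9 / 8) k1 l1 t (M + M) ta tb t0).
    - by move=> s si; have [] := kc si.
    - by move=> s y si _; have [] := dk y si.
    - by move=> s y si _; have [] := lM y si.
  by move=> t ti tn; have [] := l0 ti tn.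
have i2 : rint 0 tau (k2 1) = rint 0 tau (k2 0).
  apply: (@const_zero (fun t => rint 0 tau (k2 t)) (fun t => rint 0 tau (l2 t))).
    move=> t /andP[ta tb]; apply: (@rint_derive _ 0 tau (-8^-1) (9 / 8) k2 l2 t (M + M) ta tb t0).
    - by move=> s si; have [] := kc si.
    - by move=> s y si _; have [] := dk y si.
    - by move=> s y si _; have [] := lM y si.
  by move=> t ti tn; have [] := l0 ti tn.
have [r1 r2] := rint_kernel w1b w2b.
have e0 th : X 0 th = w1 /\ Y 0 th = w2 by rewrite /X /Y; split; ring.
have e1 th : X 1 th = cos th /\ Y 1 th = sin th by rewrite /X /Y; split; ring.
have cz (c : R) f : ccont 0 tau f -> ccont 0 tau (fun th => c * f th).
  by move=> cf; exact: ccontM (@ccont_cst _ 0 tau c) cf.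
split.
  transitivity (rint 0 tau (k1 1)); last first.
    by apply: eq_rint => th _; rewrite /k1; have [-> ->] := e1 th.
  rewrite i1; transitivity (rint 0 tau (fun th => p w1 w2 * kr th - q w1 w2 * ki th)).
    rewrite rintB; [|exact: cz|exact: cz].
    by rewrite !rintZ // r1 r2; ring.
  by apply: eq_rint => th _; rewrite /k1; have [-> ->] := e0 th.
transitivity (rint 0 tau (k2 1)); last first.
  by apply: eq_rint => th _; rewrite /k2; have [-> ->] := e1 th.
rewrite i2; transitivity (rint 0 tau (fun th => p w1 w2 * ki th + q w1 w2 * kr th)).
  rewrite rintD; [|exact: cz|exact: cz].
  by rewrite !rintZ // r1 r2; ring.
by apply: eq_rint => th _; rewrite /k2; have [-> ->] := e0 th.
Qed.

End Point.

Lemma cauchy_series : exists c d : nat -> R, exists C : R,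
  [/\ forall n, `|c n| <= C, forall n, `|d n| <= C &
   forall x y N, `|x| <= 4^-1 -> `|y| <= 4^-1 ->
    `|p x y - cseries c d x y N| <= C * 2^-1 ^+ N /\
    `|q x y - cseries d (fun n => - c n) x y N| <= C * 2^-1 ^+ N].
Proof.
pose hp th := p (cos th) (sin th); pose hq th := q (cos th) (sin th).
have lt1 (z : R) : `|z| <= 1 -> `|z| < 3 / 2 by lra.
have ci th := lt1 _ (norm_cos_le1 th); have si th := lt1 _ (norm_sin_le1 th).
have chp : ccont 0 tau hp.
  by move=> th _; exact: is_derive_cont (C1_chain Cp (ci th) (si th) (is_derive_cos th) (is_derive_sin th)).
have chq : ccont 0 tau hq.
  by move=> th _; exact: is_derive_cont (C1_chain Cq (ci th) (si th) (is_derive_cos th) (is_derive_sin th)).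
have hpM (th : R) : 0 <= th <= tau -> `|hp th| <= M.
  by move=> _; have [_ _ _ _ []] := Cp (ci th) (si th).
have hqM (th : R) : 0 <= th <= tau -> `|hq th| <= M.
  by move=> _; have [_ _ _ _ []] := Cq (ci th) (si th).
have t0 := tau_gt0; have tn : tau != 0 by rewrite gt_eqF.
have M0 : 0 <= M := le_trans (normr_ge0 _) (hpM 0 (andb_true_intro (conj (lexx _) (ltW t0)))).
pose c n := fcr hp hq n / tau; pose d n := fci hp hq n / tau.
exists c, d, (32 * M).
have [cM dM] : (forall n, `|c n| <= 32 * M) /\ (forall n, `|d n| <= 32 * M).
  split=> n; have [b1 b2] := fc_le chp chq hpM hqM n;
  rewrite normrM normfV (gtr0_norm t0) ler_pdivrMr //.
    by apply: le_trans b1 _; rewrite ler_wpM2r ?(ltW t0) //; lra.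
  by apply: le_trans b2 _; rewrite ler_wpM2r ?(ltW t0) //; lra.
split=> // x y N xb yb.
have [f1 f2] := cauchy_formula xb yb.
have [s1 s2] := kernel_series xb yb chp chq hpM hqM N.
have key (a b : R) e : `|tau * a - tau * b| <= e * tau -> `|a - b| <= e.
  by rewrite -mulrBr normrM (gtr0_norm t0) [e * _]mulrC ler_pM2l.
have sc (a b u v T : R) : T != 0 -> T * (a / T * u - b / T * v) = a * u - b * v.
  by move=> Tn; field.
have sc' (a b u v T : R) : T != 0 -> T * (b / T * u + a / T * v) = a * v + b * u.
  by move=> Tn; field.
split; apply: key.
  rewrite f1; apply: le_trans (le_trans _ s1) _; last first.
    by rewrite le_eqVlt; apply/orP; left; apply/eqP; ring.
  rewrite le_eqVlt; apply/orP; left; apply/eqP; congr (`|_ - _|).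
  by rewrite /cseries mulr_sumr; apply: eq_bigr => i _; exact: sc.
rewrite f2; apply: le_trans (le_trans _ s2) _; last first.
  by rewrite le_eqVlt; apply/orP; left; apply/eqP; ring.
rewrite le_eqVlt; apply/orP; left; apply/eqP; congr (`|_ - _|).
by rewrite /cseries mulr_sumr; apply: eq_bigr => i _; rewrite mulNr opprK; exact: sc'.
Qed.

End Holomorphic.
End CauchySeries.

(** * The axial system and its power series *)

Lemma cpow_scale (A : comNzRingType) (t x y : A) n :
  cre (t * x) (t * y) n = t ^+ n * cre x y n /\
  cim (t * x) (t * y) n = t ^+ n * cim x y n.
Proof.
elim: n => [|n [IH1 IH2]]; first by rewrite !cre0 !cim0 expr0; split; ring.
by rewrite !creS !cimS IH1 IH2 exprS; split; ring.
Qed.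

Lemma cpow_conj (A : comNzRingType) (x y : A) n :
  cre x (- y) n = cre x y n /\ cim x (- y) n = - cim x y n.
Proof.
elim: n => [|n [IH1 IH2]]; first by rewrite !cre0 !cim0 oppr0.
by rewrite !creS !cimS IH1 IH2; split; ring.
Qed.

Section Vekua.
Variable R : realType.
Implicit Types (x y t rho : R) (c d : nat -> R).

(* Coefficients of a primitive of [\sum_n (c n + i d n) z ^ n]. *)
Definition prim_coef (a : R) c n := if n is m.+1 then c m / m.+1%:R else a.

(** Here [b] is the real part of a primitive of [p + i q]. Along the ray through [(x, y)] the
    derivative of its difference with the integrated partial sum is the real part of [z] times the
    error of the given series. Integration shifts the index by one, which costs the factor 2 before
    [C]; [M] covers the empty sum. *)
Lemma ray_series C M (p q b : R -> R -> R) c d :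
  C1sq (3 / 2) M b p (fun x y => - q x y) ->
  (forall x y N, `|x| <= 4^-1 -> `|y| <= 4^-1 ->
    `|p x y - cseries c d x y N| <= C * 2^-1 ^+ N /\
    `|q x y - cseries d (fun n => - c n) x y N| <= C * 2^-1 ^+ N) ->
  forall x y N, `|x| <= 4^-1 -> `|y| <= 4^-1 ->
    `|b x y - cseries (prim_coef (b 0 0) c) (prim_coef 0 d) x y N| <=
      (M + 2 * C) * 2^-1 ^+ N.
Proof.
move=> Cb S x y N xb yb.
have C0 : 0 <= C.
  have [+ _] := S x y 0%N xb yb; rewrite expr0 mulr1; exact: le_trans.
have q0 (z : R) : `|z| <= 4^-1 -> `|z| < 3 / 2 by lra.
have [_ _ _ _ [bM _ _]] := Cb x y (q0 _ xb) (q0 _ yb).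
have M0 : 0 <= M := le_trans (normr_ge0 _) bM.
case: N => [|N].
  by rewrite /cseries big_ord0 subr0 expr0 mulr1; lra.
have fr1 (e1 e2 e3 e4 k : R) : k != 0 -> e1 / k * e3 - e2 / k * e4 = (e1 * e3 - e2 * e4) / k.
  by move=> kn; field.
have fr2 (e1 e2 e3 k : R) : k != 0 -> e1 * 0 + e3 / k * (k * e2) = e2 * e3.
  by move=> kn; field.
pose a n := (c n * cre x y n.+1 - d n * cim x y n.+1) / n.+1%:R.
have -> : cseries (prim_coef (b 0 0) c) (prim_coef 0 d) x y N.+1 =
    b 0 0 + \sum_(n < N) a n.
  rewrite /cseries big_ord_recl /= cre0 cim0; congr (_ + _); first ring.
  by apply: eq_bigr => n _; apply: fr1; rewrite pnatr_eq0.
have in1 (z t : R) : `|z| <= 4^-1 -> 0 <= t <= 1 -> `|t * z| <= 4^-1.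
  by move=> zb /andP[t0 t1]; rewrite normrM (ger0_norm t0) -[leRHS]mul1r ler_pM.
pose g t := b (t * x) (t * y) - \sum_(n < N) t ^+ n.+1 * a n.
pose g' t := x * (p (t * x) (t * y) - cseries c d (t * x) (t * y) N) -
  y * (q (t * x) (t * y) - cseries d (fun n => - c n) (t * x) (t * y) N).
have dg t : 0 <= t <= 1 -> is_derive t 1 g (g' t).
  move=> t01.
  have dz z : is_derive t 1 (fun s => s * z) z.
    by apply: (is_derive_to (is_derive_mulf (is_derive_idf t) (is_derive_cstf z t))); ring.
  have d1 := @C1_chain _ _ _ _ _ _ (fun s => s * x) (fun s => s * y) t _ _ Cb
    (q0 _ (in1 _ _ xb t01)) (q0 _ (in1 _ _ yb t01)) (dz x) (dz y).
  have dp n : is_derive t 1 (fun s => s ^+ n.+1) (n.+1%:R * t ^+ n).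
    elim: n => [|n IH].
      by apply: (is_derive_to (is_derive_idf t)); rewrite expr0 mulr1.
    have -> : (fun s : R => s ^+ n.+2) = (fun s => s * s ^+ n.+1).
      by apply/funext => s; rewrite exprS.
    apply: (is_derive_to (is_derive_mulf (is_derive_idf t) IH)).
    by rewrite [in RHS]exprS -[in RHS]natr1 exprS; ring.
  have d2 : forall K, is_derive t 1 (fun s => \sum_(n < K) s ^+ n.+1 * a n)
      (\sum_(n < K) t ^+ n * (c n * cre x y n.+1 - d n * cim x y n.+1)).
    elim=> [|K IH].
      rewrite big_ord0 (_ : (fun s => _) = fun=> 0); first exact: is_derive_cstf.
      by apply/funext => s; rewrite big_ord0.
    have -> : (fun s => \sum_(n < K.+1) s ^+ n.+1 * a n) =
      (fun s => \sum_(n < K) s ^+ n.+1 * a n + s ^+ K.+1 * a K).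
      by apply/funext => s; rewrite big_ord_recr.
    rewrite big_ord_recr /=.
    apply: (is_derive_to (is_derive_addf IH (is_derive_mulf (dp K) (is_derive_cstf (a K) t)))).
    by congr (_ + _); apply: fr2; rewrite pnatr_eq0.
  apply: (is_derive_to (is_derive_subf d1 (d2 N))).
  have E : \sum_(n < N) t ^+ n * (c n * cre x y n.+1 - d n * cim x y n.+1) =
    x * cseries c d (t * x) (t * y) N - y * cseries d (fun n => - c n) (t * x) (t * y) N.
    rewrite /cseries !mulr_sumr -sumrB; apply: eq_bigr => n _.
    by have [-> ->] := cpow_scale t x y n; rewrite creS cimS; ring.
  by rewrite E /g'; ring.
have g01 : `|g 1 - g 0| <= C * 2^-1 ^+ N.
  have [t t01|t t01 ->] := @MVT_between _ g g' 0 1.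
    by apply: dg; move: t01; rewrite min_l ?max_r.
  rewrite min_l ?max_r // in t01.
  rewrite subr0 mulr1; have [s1 s2] := S _ _ N (in1 _ _ xb t01) (in1 _ _ yb t01).
  apply: le_trans (ler_normB _ _) _; rewrite !normrM.
  apply: (@le_trans _ _ (4^-1 * (C * 2^-1 ^+ N) + 4^-1 * (C * 2^-1 ^+ N))).
    by apply: lerD; apply: ler_pM.
  have : 0 <= C * 2^-1 ^+ N by rewrite mulr_ge0 ?exprn_ge0.
  lra.
have E : b x y - (b 0 0 + \sum_(n < N) a n) = g 1 - g 0.
  rewrite /g !mul1r !mul0r opprB opprD.
  rewrite [X in _ = _ - _ + (X - _)]big1 => [|n _]; last by rewrite expr0n mul0r.
  rewrite sub0r -addrA; congr (_ + _); rewrite addrC; congr (_ - _).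
  by apply: eq_bigr => n _; rewrite expr1n mul1r.
rewrite E; apply: le_trans g01 _; rewrite exprS mulrA.
by rewrite ler_wpM2r ?exprn_ge0 //; lra.
Qed.

Section System.
Variables (b0 rho M : R) (u ux uy v vx vy : R -> R -> R).
Hypotheses (Cu : C1sq 2 M u ux uy) (Cv : C1sq 2 M v vx vy).
Let B y := b0 + rho * y.
Hypothesis E1 : forall x y, `|x| < 2 -> `|y| < 2 -> uy x y + vx x y = 0.
Hypothesis E2 : forall x y, `|x| < 2 -> `|y| < 2 ->
  B y * (ux x y - vy x y) = 2 * rho * v x y.

Lemma vekua_potential : exists phi, C1sq (3 / 2) (7 * M) phi u (fun x y => - v x y).
Proof.
apply: (C1_potential Cu (Qx := fun x y => - vx x y) (Qy := fun x y => - vy x y)); last first.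
  by move=> x y xb yb; apply/eqP; rewrite -addr_eq0 E1.
move=> x y xb yb; have [d1 d2 c1 c2 [m1 m2 m3]] := Cv xb yb.
split; rewrite ?normrN //.
- exact: is_derive_oppf.
- exact: is_derive_oppf.
- exact: cvgN.
- exact: cvgN.
Qed.

(** [p] and [- q] are the partial derivatives of [b = B phi]. For [p + i q] the Cauchy-Riemann
    equation [q_y = p_x] is hypothesis [E2], and [p_y = - q_x] is [E1]. *)
Lemma vekua_series : exists phi p q b : R -> R -> R, exists c d : nat -> R,
  exists C : R, 
  [/\ C1sq (3 / 2) (7 * M) phi u (fun x y => - v x y),
      forall x y, [/\ p x y = B y * u x y, q x y = B y * v x y - rho * phi x y &
        b x y = B y * phi x y],
      (forall n, `|c n| <= C) /\ (forall n, `|d n| <= C),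
      forall x y, `|x| < 3 / 2 -> `|y| < 3 / 2 -> [/\ cont2 p x y, cont2 q x y & cont2 b x y] &
      forall x y N, `|x| <= 4^-1 -> `|y| <= 4^-1 ->
    [/\ `|p x y - cseries c d x y N| <= C * 2^-1 ^+ N,
     `|q x y - cseries d (fun n => - c n) x y N| <= C * 2^-1 ^+ N &
     `|b x y - cseries (prim_coef (b 0 0) c) (prim_coef 0 d) x y N| <= C * 2^-1 ^+ N]].
Proof.
have [phi Cphi] := vekua_potential.
pose p x y := B y * u x y; pose q x y := B y * v x y - rho * phi x y.
pose b x y := B y * phi x y.
pose K := `|b0| + `|rho| * 2.
have M0 : 0 <= M.
  have [] := Cu (x := 0) (y := 0); rewrite ?normr0 // => _ _ _ _ [h _ _].
  exact: le_trans h.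
have K0 : 0 <= K by rewrite addr_ge0 ?mulr_ge0.
have r0 : 0 <= `|rho| by [].
have BK y : `|y| < 2 -> `|B y| <= K.
  move=> /ltW y2; apply: le_trans (ler_normD _ _) _; rewrite lerD2l normrM.
  by rewrite ler_wpM2l.
have dB y : is_derive y 1 B rho.
  apply: (is_derive_to (is_derive_addf (is_derive_cstf b0 y)
    (is_derive_mulf (is_derive_cstf rho y) (is_derive_idf y)))); ring.
have to2 (z : R) : `|z| < 3 / 2 -> `|z| < 2 by lra.
have cB x y : cont2 (fun _ y => B y) x y.
  apply: (@cvg_comp _ _ _ snd B _ _ _ cvg_snd).
  exact: is_derive_cont (dB y).
have cM f g x y : cont2 f x y -> cont2 g x y -> cont2 (fun x y => f x y * g x y) x y.
  by move=> cf cg; exact: cvgM.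
have cD f g x y : cont2 f x y -> cont2 g x y -> cont2 (fun x y => f x y + g x y) x y.
  by move=> cf cg; exact: cvgD.
have cS f g x y : cont2 f x y -> cont2 g x y -> cont2 (fun x y => f x y - g x y) x y.
  by move=> cf cg; exact: cvgB.
have cN f x y : cont2 f x y -> cont2 (fun x y => - f x y) x y.
  by move=> cf; exact: cvgN.
have cc (a : R) x y : cont2 (fun _ _ => a) x y by exact: cvg_cst.
have mul (f g s e : R) : `|f| <= s -> `|g| <= e -> `|f * g| <= s * e.
  by move=> h1 h2; rewrite normrM ler_pM.
have add (f g s e : R) : `|f| <= s -> `|g| <= e -> `|f + g| <= s + e.
  by move=> h1 h2; apply: le_trans (ler_normD _ _) _; exact: lerD.
have sub (f g s e : R) : `|f| <= s -> `|g| <= e -> `|f - g| <= s + e.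
  by move=> h1 h2; apply: le_trans (ler_normB _ _) _; exact: lerD.
(* The factor 8 covers the bound [7 M] of [phi] and every sum of two terms below. *)
pose M' := 8 * (K * M + `|rho| * M).
have KM : 0 <= K * M by rewrite mulr_ge0.
have rM : 0 <= `|rho| * M by rewrite mulr_ge0.
have Cp : C1sq (3 / 2) M' p (fun x y => B y * ux x y)
    (fun x y => rho * u x y + B y * uy x y).
  move=> x y /to2 xb /to2 yb; have [d1 d2 c1 c2 [m1 m2 m3]] := Cu xb yb.
  have cu := C1_cont2 Cu xb yb; have Bk := BK _ yb.
  split.
  - by apply: (is_derive_to (is_derive_mulf (is_derive_cstf (B y) x) d1)); ring.
  - by apply: (is_derive_to (is_derive_mulf (dB y) d2)); ring.
  - exact: (cM (fun _ y => B y)).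
  - by apply: cD; [apply: (cM (fun _ _ => rho))|apply: (cM (fun _ y => B y))].
  - split; [apply: le_trans (mul _ _ _ _ Bk m1) _|apply: le_trans (mul _ _ _ _ Bk m2) _|
      apply: le_trans (add _ _ _ _ (mul _ _ _ _ (lexx _) m1) (mul _ _ _ _ Bk m3)) _];
      rewrite /M'; lra.
have Cq : C1sq (3 / 2) M' q (fun x y => B y * vx x y - rho * u x y)
    (fun x y => B y * ux x y).
  move=> x y xb yb; have [e1 e2 _ _ [n1 n2 n3]] := Cphi x y xb yb.
  move: xb yb => /to2 xb /to2 yb; have [d1 d2 c1 c2 [m1 m2 m3]] := Cv xb yb.
  have [_ _ cux _ [k1 k2 _]] := Cu xb yb.
  have cu := C1_cont2 Cu xb yb; have Bk := BK _ yb.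
  split.
  - apply: (is_derive_to (is_derive_subf (is_derive_mulf (is_derive_cstf (B y) x) d1)
      (is_derive_mulf (is_derive_cstf rho x) e1))); ring.
  - apply: (is_derive_to (is_derive_subf (is_derive_mulf (dB y) d2)
      (is_derive_mulf (is_derive_cstf rho y) e2))).
    by have := E2 xb yb; rewrite mulrBr => h; rewrite -[B y * ux x y](subrK (B y * vy x y)) h; ring.
  - by apply: cS; [apply: (cM (fun _ y => B y))|apply: (cM (fun _ _ => rho))].
  - exact: (cM (fun _ y => B y)).
  - have n1' : `|rho * phi x y| <= `|rho| * (7 * M) by apply: mul.
    split; [apply: le_trans (sub _ _ _ _ (mul _ _ _ _ Bk m1) n1') _|
      apply: le_trans (sub _ _ _ _ (mul _ _ _ _ Bk m2) (mul _ _ _ _ (lexx _) k1)) _|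
      apply: le_trans (mul _ _ _ _ Bk k2) _]; rewrite /M'; lra.
have Cb : C1sq (3 / 2) M' b p (fun x y => - q x y).
  move=> x y xb yb; have [e1 e2 _ _ [n1 n2 n3]] := Cphi x y xb yb.
  have cp := C1_cont2 Cp xb yb; have cq := C1_cont2 Cq xb yb.
  have [_ _ _ _ [pM _ _]] := Cp x y xb yb; have [_ _ _ _ [qM _ _]] := Cq x y xb yb.
  move: xb yb => /to2 xb /to2 yb; have Bk := BK _ yb.
  split.
  - by apply: (is_derive_to (is_derive_mulf (is_derive_cstf (B y) x) e1)); rewrite /p; ring.
  - by apply: (is_derive_to (is_derive_mulf (dB y) e2)); rewrite /q; ring.
  - exact: cp.
  - exact: cN.
  - split; rewrite ?normrN //.
    by apply: le_trans (mul _ _ _ _ Bk n1) _; rewrite /M'; lra.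
have [||c [d [C [cC dC S]]]] := @cauchy_series _ M' _ _ _ _ _ _ Cp Cq.
- by [].
- move=> x y /to2 xb /to2 yb; have := E1 xb yb.
  by move/eqP; rewrite addr_eq0 => /eqP ->; ring.
have C0 : 0 <= C := le_trans (normr_ge0 _) (cC 0%N).
have M'0 : 0 <= M' by rewrite /M'; lra.
exists phi, p, q, b, c, d, (M' + 2 * C).
split=> //.
- by split=> n; [apply: le_trans (cC n) _|apply: le_trans (dC n) _]; lra.
- move=> x y xb yb; split; [exact: C1_cont2 Cp xb yb|exact: C1_cont2 Cq xb yb|exact: C1_cont2 Cb xb yb].
move=> x y N xb yb; have [s1 s2] := S x y N xb yb.
have up : C * 2^-1 ^+ N <= (M' + 2 * C) * 2^-1 ^+ N.
  by rewrite ler_wpM2r ?exprn_ge0 //; lra.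
split; [exact: le_trans s1 up|exact: le_trans s2 up|].
exact: ray_series Cb S _ _ _ xb yb.
Qed.

End System.
End Vekua.

(** * Complex powers as polynomials in the real part and the squared imaginary part *)

Section EvenPowers.
Variable A : comNzRingType.
Implicit Types x s : A.

(* [(x + i y) ^ n = rre + i y rim] with [rre], [rim] polynomials in [x] and
   [s = y ^ 2]. *)
Fixpoint rpow x s (n : nat) : A * A :=
  if n is m.+1 then
    let z := rpow x s m in (x * z.1 - s * z.2, x * z.2 + z.1)
  else (1, 0).

Definition rre x s n : A := (rpow x s n).1.
Definition rim x s n : A := (rpow x s n).2.

Lemma rreS x s n : rre x s n.+1 = x * rre x s n - s * rim x s n.
Proof. by []. Qed.
Lemma rimS x s n : rim x s n.+1 = x * rim x s n + rre x s n.
Proof. by []. Qed.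

(** The quotient of [rim x s n.+1 - n.+1%:R * rre x s n] by [s], given by a recursion so that it is
    visibly a polynomial. This combination is the one that arises for [v / y]. *)
Fixpoint rtau x s (n : nat) : A :=
  if n is m.+1 then x * rtau x s m + m.+1%:R * rim x s m else 0.

Lemma rtauS x s n : rtau x s n.+1 = x * rtau x s n + n.+1%:R * rim x s n.
Proof. by []. Qed.

Lemma cpow_rpow x y n :
  cre x y n = rre x (y ^+ 2) n /\ cim x y n = y * rim x (y ^+ 2) n.
Proof.
elim: n => [|n [IH1 IH2]]; first by rewrite cre0 cim0 /rre /rim /= mulr0.
by rewrite creS cimS IH1 IH2 rreS rimS; split; ring.
Qed.

Lemma rtauE x s n : s * rtau x s n = rim x s n.+1 - n.+1%:R * rre x s n.
Proof.
elim: n => [|n IH]; first by rewrite rimS /rre /rim /=; ring.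
by rewrite rtauS mulrDr mulrCA IH [rim x s n.+2]rimS rreS -(natr1 n.+1); ring.
Qed.

End EvenPowers.

Lemma rmorph_rpow (A B : comNzRingType) (f : {rmorphism A -> B}) x s n :
  [/\ f (rre x s n) = rre (f x) (f s) n, f (rim x s n) = rim (f x) (f s) n &
   f (rtau x s n) = rtau (f x) (f s) n].
Proof.
elim: n => [|n [IH1 IH2 IH3]].
  by rewrite /rre /rim /= rmorph1 rmorph0.
rewrite !rreS !rimS !rtauS rmorphB !rmorphD !rmorphM rmorph_nat IH1 IH2 IH3.
by [].
Qed.

Section EvenPowerNorm.
Variables (R : realType) (n : nat) (r : R) (x s : {mpoly R[n]}).
Hypotheses (r0 : 0 <= r) (xb : mnorm r x <= 16^-1) (sb : mnorm r s <= 16^-1).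

(** The recursion adds [rre] undamped to the next [rim]; with weight 1/4 on [rim] the combination
    shrinks by 5/16 at each step. *)
Lemma mnorm_rpow k : mnorm r (rre x s k) + 4^-1 * mnorm r (rim x s k) <= 2^-1 ^+ k.
Proof.
elim: k => [|k IH].
  by rewrite /rre /rim /= mnorm1 mnorm0 mulr0 addr0 expr0.
rewrite rreS rimS exprS.
have N0 P := @mnorm_ge0 _ n r P r0.
have h1 := ler_mnormB (x * rre x s k) (s * rim x s k) r0.
have h2 := ler_mnormD (x * rim x s k) (rre x s k) r0.
have bd (P Q : {mpoly R[n]}) : mnorm r P <= 16^-1 -> mnorm r (P * Q) <= 16^-1 * mnorm r Q.
  by move=> h; apply: le_trans (ler_mnormM _ _ r0) _; rewrite ler_wpM2r.
have h3 := bd _ (rre x s k) xb; have h4 := bd _ (rim x s k) xb.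
have h5 := bd _ (rim x s k) sb.
have := N0 (rre x s k); have := N0 (rim x s k).
move: h1 h2 h3 h4 h5 IH; move: (mnorm r (x * rre x s k)) (mnorm r (s * rim x s k))
  (mnorm r (x * rim x s k)) (mnorm r (x * rre x s k - _)) (mnorm r (x * rim x s k + _))
  (mnorm r (rre x s k)) (mnorm r (rim x s k)) (2^-1 ^+ k).
by move=> *; lra.
Qed.

Lemma mnorm_rim k : mnorm r (rim x s k) <= 4 * 2^-1 ^+ k.
Proof.
have := mnorm_rpow k; have := mnorm_ge0 (rre x s k) r0.
by move: (mnorm r _) (mnorm r _) (2^-1 ^+ k) => *; lra.
Qed.

(** The linear factor comes from the coefficient [k.+1] in the recursion; the series uses [rtau]
    divided by [k.+1], which cancels it. *)
Lemma mnorm_rtau k : mnorm r (rtau x s k) <= 20 * k.+1%:R * 2^-1 ^+ k.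
Proof.
elim: k => [|k IH].
  by rewrite /= mnorm0 expr0 !mulr1 // mulr_ge0.
rewrite rtauS exprS.
have h1 := ler_mnormD (x * rtau x s k) (k.+1%:R * rim x s k) r0.
have h2 : mnorm r (x * rtau x s k) <= 16^-1 * (20 * k.+1%:R * 2^-1 ^+ k).
  apply: le_trans (ler_mnormM _ _ r0) _.
  by apply: ler_pM => //; exact: mnorm_ge0.
have h3 : mnorm r (k.+1%:R * rim x s k) <= k.+1%:R * (4 * 2^-1 ^+ k).
  rewrite mulr_natl -scaler_nat mnormZ ger0_norm //.
  by rewrite ler_wpM2l // mnorm_rim.
apply: le_trans h1 _; apply: le_trans (lerD h2 h3) _.
have k0 : 0 <= k.+1%:R * 2^-1 ^+ k :> R by rewrite mulr_ge0 ?exprn_ge0.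
have p0 : 0 <= 2^-1 ^+ k :> R by rewrite exprn_ge0.
rewrite -(natr1 k.+1); move: (k.+1%:R : R) (2^-1 ^+ k : R) k0 p0 => a b ab0 b0.
have -> : 20 * (a + 1) * (2^-1 * b) = 10 * (a * b) + 10 * b by field.
have -> : 16^-1 * (20 * a * b) + a * (4 * b) = (20 / 16 + 4) * (a * b) by field.
lra.
Qed.

End EvenPowerNorm.

(** * Series of the axial system at the real axis *)

Section VekuaReal.
Variable R : realType.
Implicit Types (x y : R).

Lemma geometric_cvg (a : nat -> R) (l C : R) :
  (forall N, `|l - a N| <= C * 2^-1 ^+ N) -> a @ \oo --> l.
Proof.
move=> H; apply/cvgrPdist_le => e e0.
have h0 : (fun k => C * (2^-1 : R) ^+ k) @ \oo --> (0 : R).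
  rewrite -(mulr0 C); apply: cvgM; first exact: cvg_cst.
  by apply: cvg_expr; rewrite ger0_norm //; lra.
move/cvgrPdist_le: h0 => /(_ _ e0)[N _ HN]; exists N => // k /= Nk.
apply: le_trans (H k) _; have := HN _ Nk; rewrite /= sub0r normrN.
exact: le_trans (ler_norm _).
Qed.

Variables (rho M : R) (u ux uy v vx vy : R -> R -> R).
Hypotheses (Cu : C1sq 2 M u ux uy) (Cv : C1sq 2 M v vx vy).
Hypothesis E1 : forall x y, `|x| < 2 -> `|y| < 2 -> uy x y + vx x y = 0.
Hypothesis E2 : forall x y, `|x| < 2 -> `|y| < 2 ->
  (0 + rho * y) * (ux x y - vy x y) = 2 * rho * v x y.
Hypothesis ueven : forall x y, `|x| < 2 -> `|y| < 2 -> u x (- y) = u x y.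
Hypothesis vodd : forall x y, `|x| < 2 -> `|y| < 2 -> v x (- y) = - v x y.

(** By parity [p] and [b] are odd in [y] and [q] is even, so averaging over [y] and [- y] removes
    the coefficients [c] and leaves [e = - d]. The error bounds deteriorate like [1 / |y|] and
    [1 / |y| ^ 3], which suffices for pointwise limits; uniformity comes later from the bound on [e]
    and the norms of [rim] and [rtau]. *)
Lemma vekua_real_series : exists e : nat -> R, exists C : R,
  (forall n, `|e n| <= C) /\
  forall x y, `|x| <= 4^-1 -> `|y| <= 4^-1 -> y != 0 ->
    (fun N => \sum_(n < N) e n * rim x (y ^+ 2) n) @ \oo --> rho * u x y /\
    (fun N => \sum_(n < N) e n / n.+1%:R * rtau x (y ^+ 2) n) @ \oo -->
      rho * v x y / y.
Proof.
have [phi [p [q [b [c [d [C [Cphi pqb [cC dC] _ S]]]]]]]] := vekua_series Cu Cv E1 E2.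
exists (fun n => - d n), C; split=> [n|x y xb yb yn]; first by rewrite normrN.
have C0 : 0 <= C := le_trans (normr_ge0 _) (cC 0%N).
have lt (z : R) : `|z| <= 4^-1 -> `|z| < 3 / 2 by lra.
have lt2 (z : R) : `|z| < 3 / 2 -> `|z| < 2 by lra.
(* In [y], [phi] is a primitive of the odd function [- v]. *)
have phieven : phi x (- y) = phi x y.
  pose g t := phi x t - phi x (- t).
  have dg t : Num.min 0 y <= t <= Num.max 0 y -> is_derive t 1 g 0.
    move=> tb; have tb' : `|t| <= 4^-1.
      move: tb yb; rewrite ge_min le_max !ler_norml => /andP[/orP[h1|h1] /orP[h2|h2]] /andP[h3 h4];
      by apply/andP; split; lra.
    have t3 := lt _ tb'; have t3' : `|- t| < 3 / 2 by rewrite normrN.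
    have [_ d1 _ _ _] := Cphi x t (lt _ xb) t3.
    have [_ d2 _ _ _] := Cphi x (- t) (lt _ xb) t3'.
    have dn : is_derive t 1 (fun s => - s) (-1 : R) := is_derive_oppf (is_derive_idf t).
    have d3 := @is_derive1_comp _ (phi x) (fun s => - s) t _ _ d2 dn.
    apply: (is_derive_to (is_derive_subf d1 d3)).
    by rewrite vodd ?lt2 ?lt //; ring.
  have [z _] := @MVT_between _ g (fun=> 0) 0 y dg.
  rewrite mul0r /g oppr0 subrr subr0 => /eqP; rewrite subr_eq0 => /eqP ->.
  by [].
have yb' : `|- y| <= 4^-1 by rewrite normrN.
have [p1 q1 b1] := pqb x y; have [p2 q2 b2] := pqb x (- y).
have conj k := @cpow_conj R x y k.
have half (f g s t h : R) : `|f - s| <= h -> `|g - t| <= h -> `|(f + g) / 2 - (s + t) / 2| <= h.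
  move=> h1 h2; have -> : (f + g) / 2 - (s + t) / 2 = ((f - s) + (g - t)) / 2 by field.
  rewrite normrM normfV (ger0_norm (ler0n _ 2)) ler_pdivrMr //.
  by apply: le_trans (ler_normD _ _) _; lra.
have SP N : `|p x y - \sum_(n < N) (- d n) * cim x y n| <= C * 2^-1 ^+ N.
  have [s1 _ _] := S x y N xb yb; have [s2 _ _] := S x (- y) N xb yb'.
  have s3 : `|- p x (- y) - (- cseries c d x (- y) N)| <= C * 2^-1 ^+ N.
    by rewrite -opprD normrN.
  have := half _ _ _ _ _ s1 s3; rewrite p2 ueven ?lt2 ?lt // p1.
  have -> : ((0 + rho * y) * u x y + - ((0 + rho * - y) * u x y)) / 2 = (0 + rho * y) * u x y by field.
  suff -> : (cseries c d x y N - cseries c d x (- y) N) / 2 = \sum_(n < N) - d n * cim x y n by [].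
  rewrite /cseries -sumrB mulr_suml; apply: eq_bigr => k _.
  by have [-> ->] := conj k; field.
have SQ N : `|q x y - \sum_(n < N) d n * cre x y n| <= C * 2^-1 ^+ N.
  have [_ s1 _] := S x y N xb yb; have [_ s2 _] := S x (- y) N xb yb'.
  have := half _ _ _ _ _ s1 s2; rewrite q2 phieven vodd ?lt2 ?lt // q1.
  have -> : ((0 + rho * y) * v x y - rho * phi x y + ((0 + rho * - y) * - v x y - rho * phi x y)) / 2
    = (0 + rho * y) * v x y - rho * phi x y by field.
  set c' := fun n => - c n.
  suff -> : (cseries d c' x y N + cseries d c' x (- y) N) / 2 = \sum_(n < N) d n * cre x y n by [].
  rewrite /cseries -big_split mulr_suml; apply: eq_bigr => k _ /=.
  by have [-> ->] := conj k; field.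
have SB N : `|b x y - \sum_(n < N) (- d n / n.+1%:R) * cim x y n.+1| <= C * 2^-1 ^+ N.
  have [_ _ s1] := S x y N.+1 xb yb; have [_ _ s2] := S x (- y) N.+1 xb yb'.
  set c' := prim_coef (b 0 0) c in s1 s2; set d' := prim_coef 0 d in s1 s2.
  have s3 : `|- b x (- y) - (- cseries c' d' x (- y) N.+1)| <= C * 2^-1 ^+ N.+1.
    by rewrite -opprD normrN.
  have := half _ _ _ _ _ s1 s3; rewrite b2 phieven b1.
  have -> : ((0 + rho * y) * phi x y + - ((0 + rho * - y) * phi x y)) / 2 = (0 + rho * y) * phi x y by field.
  suff -> : (cseries c' d' x y N.+1 - cseries c' d' x (- y) N.+1) / 2 =
     \sum_(n < N) - d n / n.+1%:R * cim x y n.+1.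
    move/le_trans; apply; rewrite ler_wpM2l // exprS ger_pMl ?exprn_gt0 //; lra.
  rewrite /cseries -sumrB mulr_suml big_ord_recl /=.
  rewrite !cim0 !cre0 !mulr0 subrr mul0r add0r; apply: eq_bigr => k _.
  have [-> ->] := conj k.+1.
  have gen (e1 e2 e3 e4 : R) : (e1 * e3 - e2 * e4 - (e1 * e3 - e2 * - e4)) / 2 = - e2 * e4 by field.
  by rewrite gen /d' /= -mulNr.
have ny : 0 < `|y| by rewrite normr_gt0.
split.
  apply: (@geometric_cvg _ _ (C / `|y|)) => N.
  rewrite mulrAC ler_pdivlMr // -normrM; apply: le_trans (SP N).
  rewrite p1 le_eqVlt; apply/orP; left; apply/eqP; congr (`|_|).
  rewrite mulrBl; congr (_ - _); first ring.
  rewrite mulr_suml; apply: eq_bigr => k _.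
  by have [_ ->] := cpow_rpow x y k; ring.
apply: (@geometric_cvg _ _ (2 * C / `|y| ^+ 3)) => N.
rewrite [leRHS]mulrAC ler_pdivlMr ?exprn_gt0 // -normrX -normrM.
(* Since [B y = rho y], one has [rho v y ^ 2 = y q + b]. The terms of [y q] and [b] combine through
   [rtauE] into [y ^ 3] times [rtau], which allows the division. *)
have -> : (rho * v x y / y - \sum_(n < N) - d n / n.+1%:R * rtau x (y ^+ 2) n) * y ^+ 3 =
   y * (q x y - \sum_(n < N) d n * cre x y n) +
   (b x y - \sum_(n < N) (- d n / n.+1%:R) * cim x y n.+1).
  have -> : \sum_(n < N) - d n / n.+1%:R * cim x y n.+1 =
     (\sum_(n < N) - d n / n.+1%:R * rtau x (y ^+ 2) n) * y ^+ 3 -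
     y * \sum_(n < N) d n * cre x y n.
    rewrite mulr_suml mulr_sumr -sumrB; apply: eq_bigr => k _.
    have [-> _] := cpow_rpow x y k; have [_ ->] := cpow_rpow x y k.+1.
    have := rtauE x (y ^+ 2) k; move: (rtau _ _ _) (rim _ _ _) (rre _ _ _) => a1 a2 a3 h.
    have kn : k.+1%:R != 0 :> R by rewrite pnatr_eq0.
    have -> : a2 = y ^+ 2 * a1 + k.+1%:R * a3 by rewrite h; ring.
    by move: (k.+1%:R : R) kn => z zn; field.
  by rewrite q1 b1; field.
apply: le_trans (ler_normD _ _) _.
have -> : 2 * C * 2^-1 ^+ N = C * 2^-1 ^+ N + C * 2^-1 ^+ N by ring.
apply: lerD => //; rewrite normrM; apply: le_trans (ler_pM _ _ (_ : `|y| <= 1) (SQ N)) _ => //.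
  lra.
by rewrite mul1r.
Qed.

End VekuaReal.

(** * Germs of axially symmetric functions *)

Section AxialGerms.
Variables (R : realType) (n : nat).
Implicit Types (p x : 'cV[R]_n.+2).

Definition imsq x : R := \sum_(i < n.+1) x (lift ord0 i) 0 ^+ 2.

Definition imsq_poly p : {mpoly R[n.+2]} :=
  \sum_(i < n.+1) ((2 * p (lift ord0 i) 0) *: 'X_(lift ord0 i) + 'X_(lift ord0 i) ^+ 2).

Lemma imsq_ge0 x : 0 <= imsq x.
Proof. by apply: sumr_ge0 => i _; exact: sqr_ge0. Qed.

Lemma imsq_eval p x : imsq x = imsq p + shift_eval (imsq_poly p) p x.
Proof.
rewrite /shift_eval /imsq_poly raddf_sum /= -big_split; apply: eq_bigr => i _ /=.
by rewrite mevalD mevalZ rmorphXn /= !mevalXU; ring.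
Qed.

Lemma mcoeff0X (i : 'I_n.+2) : ('X_i : {mpoly R[n.+2]})@_0 = 0.
Proof. by rewrite mcoeffX mnm1_eq0. Qed.

Lemma imsq_poly0 p : (imsq_poly p)@_0 = 0.
Proof.
rewrite /imsq_poly raddf_sum big1 // => i _ /=.
rewrite mcoeffD mcoeffZ mcoeff0X mulr0 add0r mcoeffXn.
by rewrite -mdeg_eq0 mdegMn mdeg1.
Qed.

Lemma mcauchyZ r (c : R) (S : nat -> {mpoly R[n.+2]}) : 0 <= r -> mcauchy r S ->
  mcauchy r (fun k => c *: S k).
Proof.
move=> r0 cS e e0; have [N H] := mcauchyM r0 (mcauchy_cst r c%:MP) cS e0.
by exists N => i j Ni Nj; have := H i j Ni Nj; rewrite !mul_mpolyC.
Qed.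

Lemma germ_sqrt_imsq p : 0 < imsq p -> germ_analytic p (fun x => Num.sqrt (imsq x)).
Proof.
move=> p0; pose b := Num.sqrt (imsq p).
have b0 : 0 < b by rewrite sqrtr_gt0.
have b2 : b ^+ 2 = imsq p by rewrite sqr_sqrtr // ltW.
have [d d0 H] := sqrt_poly_limit p (imsq_poly0 p) b0 ltr01.
have [W [cW _ Wl]] := H d d0 (lexx _).
have g : germ_analytic p (fun x => Num.sqrt (imsq x) - b).
  exists d => //; exists W => // x px; rewrite (imsq_eval p x) -b2; exact: Wl.
apply: germ_analytic_near (germ_analyticD g (germ_analytic_cst p b)) _.
by apply: filterE => x; rewrite subrK.
Qed.

Lemma germ_inv_imsq p : 0 < imsq p -> germ_analytic p (fun x => (imsq x)^-1).
Proof.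
move=> p0; apply: germ_analytic_near (germ_analytic_inv p (imsq_poly0 p) p0) _.
by apply: filterE => x; rewrite -imsq_eval.
Qed.

Lemma imsq_continuous : continuous imsq.
Proof.
move=> p; have -> : imsq = (fun x => imsq p + shift_eval (imsq_poly p) p x).
  by apply/funext => x; exact: imsq_eval.
apply: (@cvgD _ _ _ (nbhs p) (nbhs_filter p)); first exact: cvg_cst.
exact: shift_eval_continuous.
Qed.

Lemma imsq_near p : 0 < imsq p -> \forall x \near p, 0 < imsq x.
Proof.
move=> p0.
exact: (@cvgr_gt _ _ (nbhs p) (nbhs_filter p) imsq (imsq p) (@imsq_continuous p) 0 p0).
Qed.

(** The radius makes each of the two substituted polynomials of norm at most 1/8, so that their sum
    meets the bound 1/4 of [poly_limit_cseries]. *)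
Lemma germ_compose p (rho C M : R) (h : R -> R -> R) (c d : nat -> R) :
  0 < imsq p -> 0 < rho ->
  (forall k, `|c k| <= M) -> (forall k, `|d k| <= M) ->
  (forall X Y : R, `|X| <= 4^-1 -> `|Y| <= 4^-1 -> cont2 h X Y) ->
  (forall (X Y : R) N, `|X| <= 4^-1 -> `|Y| <= 4^-1 ->
     `|h X Y - cseries c d X Y N| <= C * 2^-1 ^+ N) ->
  germ_analytic p (fun x => h ((x ord0 0 - p ord0 0) / rho)
    ((Num.sqrt (imsq x) - Num.sqrt (imsq p)) / rho)).
Proof.
move=> p0 rho0 cM dM hc hs; pose b := Num.sqrt (imsq p).
have b0 : 0 < b by rewrite sqrtr_gt0.
have b2 : b ^+ 2 = imsq p by rewrite sqr_sqrtr // ltW.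
have e0 : 0 < rho / 8 by rewrite divr_gt0.
have [d1 d10 H] := sqrt_poly_limit p (imsq_poly0 p) b0 e0.
pose r := Num.min d1 (rho / 8).
have r0 : 0 < r by rewrite lt_min d10.
have rd : r <= d1 by rewrite ge_min lexx.
have rr : r <= rho / 8 by rewrite ge_min lexx orbT.
have [W [cW We Wl]] := H r r0 rd.
have ri : 0 < rho^-1 by rewrite invr_gt0.
have r8 : rho^-1 * (rho / 8) = 8^-1 by field; rewrite gt_eqF.
exists r => //.
apply: (@poly_limit_cseries _ _ c d M cM dM r p (fun=> rho^-1 *: 'X_ord0)
   (fun k => rho^-1 *: W k) _ _ h C (ltW r0)) => //.
- exact: mcauchy_cst.
- exact: mcauchyZ (ltW r0) cW.
- move=> k; rewrite !mnormZ mnormX gtr0_norm //.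
  have := ler_wpM2l (ltW ri) rr; have := ler_wpM2l (ltW ri) (We k).
  by rewrite r8; lra.
- move=> x px; rewrite /shift_eval mevalZ mevalXU mulrC; exact: cvg_cst.
- move=> x px; rewrite /shift_eval; under eq_fun do rewrite mevalZ mulrC.
  apply: cvgM; last exact: cvg_cst.
  by rewrite -/b (imsq_eval p x) -b2; exact: Wl.
Qed.

(** With [s = Num.sqrt (imsq x)], which is [B] at the rescaled point, [u = f / s] and
    [v / s = (s q + rho b) / s ^ 3]. The quotients are written with [s] and [(imsq x)^-1], the germs
    already known to be analytic. *)
Lemma germ_nonreal p (rho M : R) (u ux uy v vx vy : R -> R -> R) :
  0 < imsq p -> 0 < rho ->
  C1sq 2 M u ux uy -> C1sq 2 M v vx vy ->
  (forall X Y, `|X| < 2 -> `|Y| < 2 -> uy X Y + vx X Y = 0) ->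
  (forall X Y, `|X| < 2 -> `|Y| < 2 ->
    (Num.sqrt (imsq p) + rho * Y) * (ux X Y - vy X Y) = 2 * rho * v X Y) ->
  germ_analytic p (fun x => u ((x ord0 0 - p ord0 0) / rho)
    ((Num.sqrt (imsq x) - Num.sqrt (imsq p)) / rho)) /\
  germ_analytic p (fun x => v ((x ord0 0 - p ord0 0) / rho)
    ((Num.sqrt (imsq x) - Num.sqrt (imsq p)) / rho) / Num.sqrt (imsq x)).
Proof.
move=> p0 rho0 Cu Cv E1 E2.
have [phi [f [q [b [c [d [C [Cphi fqb [cC dC] cont S]]]]]]]] := vekua_series Cu Cv E1 E2.
have lt (z : R) : `|z| <= 4^-1 -> `|z| < 3 / 2 by lra.
have C0 : 0 <= C := le_trans (normr_ge0 _) (cC 0%N).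
pose C' := C + `|b 0 0|.
have gf : germ_analytic p (fun x => f ((x ord0 0 - p ord0 0) / rho)
    ((Num.sqrt (imsq x) - Num.sqrt (imsq p)) / rho)).
  apply: (@germ_compose p rho C C f c d) => //.
    by move=> X Y /lt Xb /lt Yb; have [] := cont X Y Xb Yb.
  by move=> X Y N Xb Yb; have [] := S X Y N Xb Yb.
have gq : germ_analytic p (fun x => q ((x ord0 0 - p ord0 0) / rho)
    ((Num.sqrt (imsq x) - Num.sqrt (imsq p)) / rho)).
  apply: (@germ_compose p rho C C q d (fun k => - c k)) => //.
  - by move=> k; rewrite normrN.
  - by move=> X Y /lt Xb /lt Yb; have [] := cont X Y Xb Yb.
  - by move=> X Y N Xb Yb; have [] := S X Y N Xb Yb.
have prim (a : R) (s : nat -> R) k : (forall j, `|s j| <= C) -> `|a| <= `|b 0 0| ->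
    `|prim_coef a s k| <= C'.
  move=> sC ab; have b00 := normr_ge0 (b 0 0); case: k => [|k] /=; first by rewrite /C'; lra.
  apply: (@le_trans _ _ C); last by rewrite /C'; lra.
  rewrite normrM normfV (ger0_norm (ler0n _ _)) ler_pdivrMr ?ltr0Sn //.
  by apply: le_trans (sC k) _; rewrite ler_peMr // ler1n.
have gb : germ_analytic p (fun x => b ((x ord0 0 - p ord0 0) / rho)
    ((Num.sqrt (imsq x) - Num.sqrt (imsq p)) / rho)).
  apply: (@germ_compose p rho C C' b (prim_coef (b 0 0) c) (prim_coef 0 d)) => //.
  - by move=> k; apply: prim.
  - by move=> k; apply: prim => //; rewrite normr0.
  - by move=> X Y /lt Xb /lt Yb; have [] := cont X Y Xb Yb.
  - by move=> X Y N Xb Yb; have [] := S X Y N Xb Yb.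
have gs := germ_sqrt_imsq p0; have gi := germ_inv_imsq p0.
split.
  apply: germ_analytic_near (germ_analyticM (germ_analyticM gf gs) gi) _.
  apply: (@filterS _ (nbhs p) (nbhs_filter p) _ _ _ (imsq_near p0)) => x x0.
  set X := (_ / rho); set Y := (_ / rho); have [-> _ _] := fqb X Y.
  have s0 : 0 < Num.sqrt (imsq x) by rewrite sqrtr_gt0.
  have s2 : imsq x = Num.sqrt (imsq x) ^+ 2 by rewrite sqr_sqrtr // ltW.
  have -> : Num.sqrt (imsq p) + rho * Y = Num.sqrt (imsq x).
    by rewrite /Y; field; rewrite gt_eqF.
  rewrite [X in _ / X]s2; move: (Num.sqrt (imsq x)) s0 => s s0.
  by field; rewrite gt_eqF.
apply: germ_analytic_near (germ_analyticM (germ_analyticM (germ_analyticD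
  (germ_analyticM gs gq) (germ_analyticM (germ_analytic_cst p rho) gb)) gs)
  (germ_analyticM gi gi)) _.
apply: (@filterS _ (nbhs p) (nbhs_filter p) _ _ _ (imsq_near p0)) => x x0.
set X := ((x ord0 0 - _) / rho); set Y := (_ / rho); have [_ -> ->] := fqb X Y.
have s0 : 0 < Num.sqrt (imsq x) by rewrite sqrtr_gt0.
have s2 : imsq x = Num.sqrt (imsq x) ^+ 2 by rewrite sqr_sqrtr // ltW.
have -> : Num.sqrt (imsq p) + rho * Y = Num.sqrt (imsq x).
  by rewrite /Y; field; rewrite gt_eqF.
have -> : (imsq x)^-1 = (Num.sqrt (imsq x) ^+ 2)^-1 by rewrite -s2.
move: (Num.sqrt (imsq x)) s0 (v X Y) (phi X Y) => s s0 v0 f0.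
by field; rewrite gt_eqF.
Qed.

End AxialGerms.

(** * Germs at real points *)

Section RealGerm.
Variables (R : realType) (n : nat).
Implicit Types (p x : 'cV[R]_n.+2).

Lemma poly_limit_of_series r p (q : nat -> {mpoly R[n.+2]}) (C : R) : 0 <= r ->
  (forall k, mnorm r (q k) <= C * 2^-1 ^+ k) ->
  exists2 g, poly_limit r p g & forall x, ball p r x ->
     (fun N => \sum_(k < N) shift_eval (q k) p x) @ \oo --> g x.
Proof.
move=> r0 qC.
have cS : mcauchy r (fun N => \sum_(k < N) q k).
  by apply: (@mcauchy_geometric _ _ _ _ C) => // k; rewrite big_ord_recr /= addrAC subrr add0r.
pose g x := lim ((fun N => \sum_(k < N) shift_eval (q k) p x) @ \oo).
have gl x : ball p r x -> (fun N => \sum_(k < N) shift_eval (q k) p x) @ \oo --> g x.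
  move=> px; have := shift_eval_cvg cS px; rewrite /g.
  have -> : (fun N => shift_eval (\sum_(k < N) q k) p x) =
      (fun N => \sum_(k < N) shift_eval (q k) p x).
    by apply/funext => N; rewrite /shift_eval raddf_sum.
  by [].
exists g => //; exact: poly_limit_series r0 qC gl.
Qed.

Lemma imsq0P x : imsq x = 0 -> forall i, x (lift ord0 i) 0 = 0.
Proof.
move=> /eqP; rewrite psumr_eq0 => [/allP h i|i _]; last exact: sqr_ge0.
by have := h i (mem_index_enum i); rewrite /= sqrf_eq0 => /eqP.
Qed.

(** Only the square of the second variable enters the series, and [imsq x / rho ^ 2] is a polynomial
    in [x]: the square root disappears. Identification with [u] and [v / b] is first made where
    [imsq x != 0]; for [u] it extends by continuity, while [v / b] has no meaningful value at the
    axis. *)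
Lemma germ_real p (rho M : R) (u ux uy v vx vy : R -> R -> R) :
  imsq p = 0 -> 0 < rho ->
  C1sq 2 M u ux uy -> C1sq 2 M v vx vy ->
  (forall X Y, `|X| < 2 -> `|Y| < 2 -> uy X Y + vx X Y = 0) ->
  (forall X Y, `|X| < 2 -> `|Y| < 2 ->
    (0 + rho * Y) * (ux X Y - vy X Y) = 2 * rho * v X Y) ->
  (forall X Y, `|X| < 2 -> `|Y| < 2 -> u X (- Y) = u X Y) ->
  (forall X Y, `|X| < 2 -> `|Y| < 2 -> v X (- Y) = - v X Y) ->
  germ_analytic p (fun x => u ((x ord0 0 - p ord0 0) / rho)
    (Num.sqrt (imsq x) / rho)) /\
  exists2 g, germ_analytic p g & \forall x \near p, imsq x != 0 ->
   g x = v ((x ord0 0 - p ord0 0) / rho)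
    (Num.sqrt (imsq x) / rho) / Num.sqrt (imsq x).
Proof.
move=> p0 rho0 Cu Cv E1 E2 ueven vodd.
have [e [C [eC L]]] := vekua_real_series Cu Cv E1 E2 ueven vodd.
have C0 : 0 <= C := le_trans (normr_ge0 _) (eC 0%N).
have ri : 0 < rho^-1 by rewrite invr_gt0.
pose U : {mpoly R[n.+2]} := rho^-1 *: 'X_ord0.
pose G : {mpoly R[n.+2]} := (rho^-1 ^+ 2) *: imsq_poly p.
have U0 : U@_0 = 0 by rewrite mcoeffZ mcoeff0X mulr0.
have G0 : G@_0 = 0 by rewrite mcoeffZ imsq_poly0 mulr0.
(* The value 1/16 is what the norm bounds on [rim] and [rtau] ask for; as a bound on a square it
   also gives [|Y| <= 1/4]. *)
have s16 : 0 < 16^-1 :> R by [].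
have [r1 r10 H1] := mnorm_small U0 s16; have [r2 r20 H2] := mnorm_small G0 s16.
pose r := Num.min r1 r2.
have r0 : 0 < r by rewrite lt_min r10.
have r0' := ltW r0.
have Ub : mnorm r U <= 16^-1 by apply: H1 => //; rewrite ge_min lexx.
have Gb : mnorm r G <= 16^-1 by apply: H2 => //; rewrite ge_min lexx orbT.
have Ue x : shift_eval U p x = (x ord0 0 - p ord0 0) / rho.
  by rewrite /shift_eval mevalZ mevalXU mulrC.
have Ge x : shift_eval G p x = (Num.sqrt (imsq x) / rho) ^+ 2.
  rewrite /shift_eval mevalZ -/(shift_eval _ p x) expr_div_n sqr_sqrtr ?imsq_ge0 //.
  by rewrite exprVn mulrC (imsq_eval p x) p0 add0r.
pose q k := (rho^-1 * e k) *: rim U G k.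
pose t k := (rho^-1 ^+ 2 * (e k / k.+1%:R)) *: rtau U G k.
have qb k : mnorm r (q k) <= (rho^-1 * C * 4) * 2^-1 ^+ k.
  rewrite mnormZ -mulrA; apply: ler_pM; rewrite ?mnorm_ge0 //.
    by rewrite normrM gtr0_norm // ler_wpM2l // ltW.
  exact: mnorm_rim.
have tb k : mnorm r (t k) <= (rho^-1 ^+ 2 * C * 20) * 2^-1 ^+ k.
  have kk : 0 < k.+1%:R :> R by [].
  have -> : rho^-1 ^+ 2 * C * 20 * 2^-1 ^+ k =
     (rho^-1 ^+ 2 * (C / k.+1%:R)) * (20 * k.+1%:R * 2^-1 ^+ k).
    move: (k.+1%:R : R) kk (2^-1 ^+ k : R) (rho^-1) => z z0 w s.
    by field; rewrite gt_eqF.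
  rewrite mnormZ; apply: ler_pM; rewrite ?mnorm_ge0 //; last exact: mnorm_rtau.
  rewrite normrM ger0_norm ?exprn_ge0 ?(ltW ri) // ler_wpM2l ?exprn_ge0 ?(ltW ri) //.
  by rewrite normrM normfV (gtr0_norm kk) ler_wpM2r // invr_ge0 ltW.
have [g lg gq] := poly_limit_of_series p r0' qb.
have [g1 lg1 g1t] := poly_limit_of_series p r0' tb.
have small x : ball p r x -> `|(x ord0 0 - p ord0 0) / rho| <= 4^-1 /\
    `|Num.sqrt (imsq x) / rho| <= 4^-1.
  move=> px; have h1 := shift_eval_le U px; have h2 := shift_eval_le G px.
  rewrite Ue in h1; rewrite Ge in h2; split.
    by apply: le_trans h1 (le_trans Ub _); lra.
  apply: norm_le_sqr => //; apply: le_trans (ler_norm _) _.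
  by apply: le_trans h2 (le_trans Gb _); lra.
have nz x : imsq x != 0 -> Num.sqrt (imsq x) / rho != 0.
  move=> x0; rewrite mulf_neq0 ?invr_eq0 ?(gt_eqF rho0) // gt_eqF // sqrtr_gt0.
  by rewrite lt_neqAle eq_sym x0 imsq_ge0.
have gu x : ball p r x -> imsq x != 0 ->
    g x = u ((x ord0 0 - p ord0 0) / rho) (Num.sqrt (imsq x) / rho).
  move=> px x0; have [Xb Yb] := small x px; have [l1 _] := L _ _ Xb Yb (nz x x0).
  have l2 := gq x px.
  have l3 : (fun N => \sum_(k < N) shift_eval (q k) p x) @ \oo -->
      rho^-1 * (rho * u ((x ord0 0 - p ord0 0) / rho) (Num.sqrt (imsq x) / rho)).
    have -> : (fun N => \sum_(k < N) shift_eval (q k) p x) = (fun N => rho^-1 *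
       \sum_(k < N) e k * rim ((x ord0 0 - p ord0 0) / rho) ((Num.sqrt (imsq x) / rho) ^+ 2) k).
      apply/funext => N; rewrite mulr_sumr; apply: eq_bigr => k _.
      rewrite /shift_eval mevalZ mulrA -Ue -Ge.
      by have [_ -> _] := rmorph_rpow (meval (fun i => x i 0 - p i 0)) U G k.
    by apply: cvgM => //; exact: cvg_cst.
  rewrite -(cvg_lim _ l2) // (cvg_lim _ l3) //.
  by rewrite mulKf // gt_eqF.
have gv x : ball p r x -> imsq x != 0 ->
    g1 x = v ((x ord0 0 - p ord0 0) / rho) (Num.sqrt (imsq x) / rho) / Num.sqrt (imsq x).
  move=> px x0; have [Xb Yb] := small x px; have [_ l1] := L _ _ Xb Yb (nz x x0).
  have l2 := g1t x px.
  have l3 : (fun N => \sum_(k < N) shift_eval (t k) p x) @ \oo -->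
      rho^-1 ^+ 2 * (rho * v ((x ord0 0 - p ord0 0) / rho) (Num.sqrt (imsq x) / rho) /
         (Num.sqrt (imsq x) / rho)).
    have -> : (fun N => \sum_(k < N) shift_eval (t k) p x) = (fun N => rho^-1 ^+ 2 *
       \sum_(k < N) e k / k.+1%:R *
        rtau ((x ord0 0 - p ord0 0) / rho) ((Num.sqrt (imsq x) / rho) ^+ 2) k).
      apply/funext => N; rewrite mulr_sumr; apply: eq_bigr => k _.
      rewrite /shift_eval mevalZ [RHS]mulrA -Ue -Ge.
      by have [_ _ ->] := rmorph_rpow (meval (fun i => x i 0 - p i 0)) U G k.
    by apply: cvgM => //; exact: cvg_cst.
  rewrite -(cvg_lim _ l2) // (cvg_lim _ l3) //.
  have s0 : Num.sqrt (imsq x) != 0.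
    by have := nz x x0; rewrite mulf_eq0 negb_or => /andP[].
  move: (Num.sqrt (imsq x)) s0 (v _ _) => s s0 w.
  by field; rewrite s0 gt_eqF.
have pb : nbhs p (ball p r) by apply/nbhs_ballP; exists r.
split; last first.
  exists g1; first by exists r.
  exact: (@filterS _ (nbhs p) (nbhs_filter p) _ _ gv pb).
apply: (@germ_analytic_near _ _ p g); first by exists r.
apply: (@filterS _ (nbhs p) (nbhs_filter p) _ _ _ pb) => x px.
have [x0|] := eqVneq (imsq x) 0; last exact: gu.
have xi := imsq0P x0.
(* The real point [x] is approached along one imaginary direction by points with
   [imsq = k.+1%:R^-1 ^+ 2], where [g] and [u] already agree. *)
pose o : 'I_n.+2 := lift ord0 ord0.
pose z (k : nat) : 'cV[R]_n.+2 := x + k.+1%:R^-1 *: delta_mx o 0.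
have zx : z @ \oo --> x.
  rewrite -[X in _ --> X]addr0 -(scale0r (delta_mx o 0 : 'cV[R]_n.+2)).
  apply: cvgD; first exact: cvg_cst.
  by apply: cvgZr_tmp; exact: cvg_harmonic.
have h1 : (fun k => g (z k)) @ \oo --> g x.
  exact: continuous_cvg (poly_limit_continuous lg px) zx.
have [Xb _] := small x px.
have X2 : `|(x ord0 0 - p ord0 0) / rho| < 2 by lra.
have h2 : (fun k => u ((x ord0 0 - p ord0 0) / rho) (k.+1%:R^-1 / rho)) @ \oo -->
    u ((x ord0 0 - p ord0 0) / rho) (0 / rho).
  have z2 : `|0 / rho| < 2 by rewrite mul0r normr0.
  have [_ du _ _ _] := Cu _ _ X2 z2.
  apply: continuous_cvg; first exact: is_derive_cont du.
  by apply: cvgM; [exact: cvg_harmonic|exact: cvg_cst].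
have zb : \forall k \near \oo, ball p r (z k).
  apply: zx; apply: open_nbhs_nbhs; split => //; exact: (@ball_open R 'cV[R]_n.+2).
have z0 k : z k ord0 0 = x ord0 0.
  by rewrite !mxE /= mulr0 addr0.
have zi k : imsq (z k) = k.+1%:R^-1 ^+ 2.
  rewrite /imsq (bigD1 ord0) //= big1 => [|i i0].
    by rewrite !mxE xi !eqxx mulr1 add0r addr0.
  by rewrite !mxE xi eqxx andbT (inj_eq lift_inj) (negbTE i0) mulr0 addr0 expr0n.
have h3 : (fun k => u ((x ord0 0 - p ord0 0) / rho) (k.+1%:R^-1 / rho)) @ \oo --> g x.
  apply: cvg_trans h1; apply: near_eq_cvg.
  near=> k.
  have zk : ball p r (z k) by near: k; exact: zb.
  rewrite gu // zi; last by rewrite sqrf_eq0 invr_eq0 pnatr_eq0.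
  by rewrite z0 sqrtr_sqr ger0_norm.
by rewrite x0 sqrtr0 -(cvg_lim _ h3) // (cvg_lim _ h2).
Unshelve. all: by end_near.
Qed.

End RealGerm.

(** * Axial reduction of a stem function *)

Section FourVectors.
Variable R : realType.

Lemma ord4_ind (P : 'I_4 -> Prop) :
  P (inord 0) -> P (inord 1) -> P (inord 2) -> P (inord 3) -> forall i, P i.
Proof.
move=> P0 P1 P2 P3 i; rewrite -(inord_val i).
by case: i => [[|[|[|[|]]]] //= ?].
Qed.

Lemma sum4 (V : nmodType) (f : 'I_4 -> V) :
  \sum_(s < 4) f s = f (inord 0) + f (inord 1) + f (inord 2) + f (inord 3).
Proof.
rewrite !big_ord_recl big_ord0 addr0 !addrA.
by congr (f _ + f _ + f _ + f _); apply/val_inj; rewrite /= inordK.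
Qed.

Definition col4 (a b c d : R) : 'cV[R]_4 :=
  \col_i match val i with 0 => a | 1 => b | 2 => c | _ => d end.

(** Entries indexed by natural numbers let matrix identities reduce by case analysis and
    computation. *)
Definition mat4 (L : nat -> nat -> R) : 'M[R]_4 := \matrix_(i, j) L i j.

Lemma mat4E L a b : (a < 4)%N -> (b < 4)%N -> mat4 L (inord a) (inord b) = L a b.
Proof. by move=> a4 b4; rewrite mxE !inordK. Qed.

Lemma e4E a b : (a < 4)%N -> (b < 4)%N -> e4 R a (inord b) 0 = (b == a)%:R.
Proof. by move=> a4 b4; rewrite mxE eqxx andbT -val_eqE /= !inordK. Qed.

Lemma mat4_O3 L :
  (forall a b, (a < 4)%N -> (b < 4)%N ->
    L 0%N a * L 0%N b + L 1%N a * L 1%N b + L 2%N a * L 2%N b + L 3%N a * L 3%N b = (a == b)%:R) ->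
  (forall a, (a < 4)%N -> L a 0%N = (a == 0)%:R) -> @O3 R (mat4 L).
Proof.
move=> H1 H2; split.
  apply/matrixP => i j; rewrite mxE sum4 !mxE !inordK // H1 //.
apply/matrixP => i j; rewrite (ord1 j) mxE sum4 !e4E // !mulr0 mulr1 !addr0.
by rewrite mxE inordK // H2 // mxE eqxx andbT -val_eqE /= inordK.
Qed.

Lemma col4E a b c d : [/\ col4 a b c d (inord 0) 0 = a, col4 a b c d (inord 1) 0 = b,
  col4 a b c d (inord 2) 0 = c & col4 a b c d (inord 3) 0 = d].
Proof. by split; rewrite mxE /= inordK. Qed.

Lemma mat4_col4 L a b c d : mat4 L *m col4 a b c d =
  col4 (L 0%N 0%N * a + L 0%N 1%N * b + L 0%N 2%N * c + L 0%N 3%N * d)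
       (L 1%N 0%N * a + L 1%N 1%N * b + L 1%N 2%N * c + L 1%N 3%N * d)
       (L 2%N 0%N * a + L 2%N 1%N * b + L 2%N 2%N * c + L 2%N 3%N * d)
       (L 3%N 0%N * a + L 3%N 1%N * b + L 3%N 2%N * c + L 3%N 3%N * d).
Proof.
apply/matrixP => i j; rewrite (ord1 j) mxE sum4.
have [-> -> -> ->] := col4E a b c d.
set b0 := (X in col4 X); set b1 := (X in col4 _ X); set b2 := (X in col4 _ _ X).
set b3 := (X in col4 _ _ _ X); have [h0 h1 h2 h3] := col4E b0 b1 b2 b3.
by elim/ord4_ind: i; rewrite ?h0 ?h1 ?h2 ?h3 !mat4E.
Qed.

Lemma col4D h k a b c d : (k < 4)%N -> h *: e4 R k + col4 a b c d =
  col4 (a + (k == 0)%:R * h) (b + (k == 1)%:R * h) (c + (k == 2)%:R * h) (d + (k == 3)%:R * h).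
Proof.
move=> k4; apply/matrixP => i j; rewrite (ord1 j) !mxE.
elim/ord4_ind: i; rewrite -val_eqE /= !inordK // eqxx andbT addrC mulrC; congr (_ + _ * _);
  by case: k k4 => [|[|[|[|]]]].
Qed.

End FourVectors.

Section Reduction.
Variables (R : realType) (D : set (R * R)) (F : 'cV[R]_4 -> 'I_4 -> oct R).
Hypotheses (Dopen : open D) (Dsym : forall a b, D (a, b) -> D (a, - b)).
Hypotheses (stem : o3_stem D F) (C1 : C1_on D F) (fueter : fueter_system D F).
Implicit Types a b c d h : R.

Definition G0 a b : oct R := F (col4 a b 0 0) (inord 0).
Definition G1 a b : oct R := F (col4 a b 0 0) (inord 1).

Lemma Dabs a b : D (a, b) -> D (a, `|b|).
Proof. by move=> Dab; have [b0|b0] := ger0P b => //; exact: Dsym. Qed.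

Lemma ED_col4 a b c d : ED D (col4 a b c d) <->
  D (a, Num.sqrt (b ^+ 2 + c ^+ 2 + d ^+ 2)).
Proof. by rewrite /ED /= /c4; have [-> -> -> ->] := col4E a b c d. Qed.

Lemma ED_axis a b : D (a, b) -> ED D (col4 a b 0 0).
Proof. by move=> /Dabs Dab; apply/ED_col4; rewrite expr0n !addr0 sqrtr_sqr. Qed.

Lemma stem4 (L : nat -> nat -> R) v r : O3 (mat4 L) -> ED D v -> (r < 4)%N ->
  F (mat4 L *m v) (inord r) = L r 0%N *: F v (inord 0) + L r 1%N *: F v (inord 1)
    + L r 2%N *: F v (inord 2) + L r 3%N *: F v (inord 3).
Proof. by move=> oL Ev r4; rewrite stem // sum4 !mat4E. Qed.

Definition refl (k : nat) (i j : nat) : R :=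
  if i == j then (if i == k then -1 else 1) else 0.

Lemma refl_O3 k : (0 < k < 4)%N -> O3 (mat4 (refl k)).
Proof.
case: k => [|[|[|[|]]]] // _; apply: mat4_O3;
  by [move=> [|[|[|[|?]]]] [|[|[|[|?]]]] //= _ _; rewrite /refl /=; ring
     |move=> [|[|[|[|?]]]]].
Qed.

Definition swap23 (i j : nat) : R :=
  (j == match i with 2 => 3%N | 3 => 2%N | _ => i end)%:R.

Lemma swap23_O3 : O3 (mat4 swap23).
Proof.
apply: mat4_O3;
  by [move=> [|[|[|[|?]]]] [|[|[|[|?]]]] //= _ _; rewrite /swap23 /=; ring
     |move=> [|[|[|[|?]]]]].
Qed.

Definition rot12 (c s : R) (i j : nat) : R :=
  match i, j with
  | 0, 0 => 1 | 1, 1 => c | 1, 2 => - s | 2, 1 => s | 2, 2 => c | 3, 3 => 1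
  | _, _ => 0 end.

Lemma rot12_O3 (c s : R) : c ^+ 2 + s ^+ 2 = 1 -> O3 (mat4 (rot12 c s)).
Proof.
move=> cs; have cE : c ^+ 2 = 1 - s ^+ 2 by rewrite -cs addrK.
apply: mat4_O3;
  by [move=> [|[|[|[|?]]]] [|[|[|[|?]]]] //= _ _; rewrite /rot12 /=; ring: cE
     |move=> [|[|[|[|?]]]]].
Qed.

Lemma eqN0 (x : oct R) : x = - x -> x = 0.
Proof.
move=> h; have : x *+ 2 = 0 by rewrite mulr2n {2}h subrr.
by move/eqP; rewrite -scaler_nat scaler_eq0 pnatr_eq0 /= => /eqP.
Qed.

Lemma G0_even a b : D (a, b) -> G0 a (- b) = G0 a b.
Proof.
move=> /ED_axis Eab; have := stem4 (refl_O3 (k := 1) isT) Eab (isT : (0 < 4)%N).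
rewrite mat4_col4 /refl /= /G0 !(scale1r, scale0r, mul0r, mul1r, mulr0, addr0, add0r, mulN1r).
by [].
Qed.

Lemma G1_odd a b : D (a, b) -> G1 a (- b) = - G1 a b.
Proof.
move=> /ED_axis Eab; have := stem4 (refl_O3 (k := 1) isT) Eab (isT : (1 < 4)%N).
rewrite mat4_col4 /refl /= /G1 !(scale1r, scale0r, mul0r, mul1r, mulr0, addr0, add0r, mulN1r).
by rewrite scaleN1r.
Qed.

(** The reflection of the third coordinate fixes the point and changes the sign of this
    component. *)
Lemma F2_refl a b d : ED D (col4 a b 0 d) -> F (col4 a b 0 d) (inord 2) = 0.
Proof.
move=> Eab; apply: eqN0; have := stem4 (refl_O3 (k := 2) isT) Eab (isT : (2 < 4)%N).
rewrite mat4_col4 /refl /= !(scale1r, scale0r, mul0r, mul1r, mulr0, addr0, add0r, mulN1r).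
by rewrite scaleN1r.
Qed.

Lemma F3_refl a b c : ED D (col4 a b c 0) -> F (col4 a b c 0) (inord 3) = 0.
Proof.
move=> Eab; apply: eqN0; have := stem4 (refl_O3 (k := 3) isT) Eab (isT : (3 < 4)%N).
rewrite mat4_col4 /refl /= !(scale1r, scale0r, mul0r, mul1r, mulr0, addr0, add0r, mulN1r).
by rewrite scaleN1r.
Qed.

Lemma F3_swap a b c : ED D (col4 a b c 0) ->
  F (col4 a b 0 c) (inord 3) = F (col4 a b c 0) (inord 2).
Proof.
move=> Eab; have := stem4 swap23_O3 Eab (isT : (3 < 4)%N).
by rewrite mat4_col4 /swap23 /= !(scale1r, scale0r, mul0r, mul1r, mulr0, addr0, add0r, mulN1r).
Qed.

(** The rotation with cosine [b / c] and sine [h / c] carries the axis point [(a, c, 0, 0)] to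
    [(a, b, h, 0)]. The sign of [c] is left free. *)
Lemma F2_rot a b h c : b != 0 -> c ^+ 2 = b ^+ 2 + h ^+ 2 -> D (a, c) ->
  F (col4 a b h 0) (inord 2) = (h / c) *: G1 a c.
Proof.
move=> b0 cE /ED_axis Eac.
have c0 : c != 0.
  apply/eqP => z; move/eqP: cE; rewrite z expr0n /= eq_sym paddr_eq0 ?sqr_ge0 //.
  by rewrite sqrf_eq0 (negbTE b0).
have cs : (b / c) ^+ 2 + (h / c) ^+ 2 = 1.
  by rewrite !expr_div_n -mulrDl -cE divff // sqrf_eq0.
have := stem4 (rot12_O3 cs) Eac (isT : (2 < 4)%N).
rewrite mat4_col4 /rot12 /= !(scale1r, scale0r, mul0r, mul1r, mulr0, addr0, add0r) !divfK //.
by move=> ->; rewrite F2_refl // scaler0 addr0.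
Qed.

End Reduction.

Section LineDerivatives.
Variable R : realType.

Lemma is_derive_line (f : 'cV[R]_4 -> R) (gam : R -> 'cV[R]_4) (e : 'cV[R]_4) (s : R) :
  (forall h, gam (h + s) = h *: e + gam s) -> derivable f (gam s) e ->
  is_derive s 1 (fun t => f (gam t)) ('D_e f (gam s)).
Proof.
move=> gE df.
have E : (fun h : R => h^-1 *: (((fun t => f (gam t)) \o shift s) (h *: 1) - f (gam s))) =
   (fun h : R => h^-1 *: ((f \o shift (gam s)) (h *: e) - f (gam s))).
  by apply/funext => h; rewrite /= scaler1 gE.
apply: DeriveDef; first by rewrite /derivable E; exact: df.
by rewrite /derive E.
Qed.

(** Transverse derivatives on the axis: there [f] is a component whose quotient by the displacement
    is explicit through the symmetries of the stem. *)
Lemma derive_at0 (f g : R -> R) (d : R) : is_derive (0 : R) 1 f d -> f 0 = 0 ->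
  (\forall h \near (0 : R), f h = h * g h) -> {for (0 : R), continuous g} -> d = g 0.
Proof.
move=> df f0 /nbhs_ballP[r /= r0 fg] /cvgrPdist_le cg.
apply/eqP; rewrite -subr_eq0 -normr_le0; apply/ler_addgt0Pl => e e0; rewrite addr0.
have e2 : 0 < e / 2 by rewrite divr_gt0.
have [d1 d10 H1] := is_derive_small df e2.
have /nbhs_ballP[d2 /= d20 H2] := cg _ e2.
pose h := Num.min (Num.min r d1) d2 / 2.
have m0 : 0 < Num.min (Num.min r d1) d2 by rewrite !lt_min r0 d10 d20.
have h0 : 0 < h by rewrite divr_gt0.
have hm : h < Num.min (Num.min r d1) d2 by rewrite /h; lra.
move: hm; rewrite !lt_min => /andP[/andP[hr h1] h2].
have := H1 h; rewrite (gtr0_norm h0) add0r f0 subr0 => /(_ h1).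
have bh z : h < z -> ball (0 : R) z h by rewrite /ball /= sub0r normrN gtr0_norm.
rewrite fg; last exact: bh.
have -> : h * g h - d * h = (g h - d) * h by ring.
rewrite normrM (gtr0_norm h0) ler_pM2r // => k1.
have k2 := H2 h (bh _ h2).
have -> : d - g 0 = - ((g 0 - g h) + (g h - d)) by ring.
rewrite normrN; apply: le_trans (ler_normD _ _) _.
by rewrite [e]splitr lerD.
Qed.

End LineDerivatives.

(** * The Fueter system restricted to the axis plane *)

Section AxialSystem.
Variables (R : realType) (D : set (R * R)) (F : 'cV[R]_4 -> 'I_4 -> oct R).
Hypotheses (Dopen : open D) (Dsym : forall a b, D (a, b) -> D (a, - b)).
Hypotheses (stem : o3_stem D F) (C1 : C1_on D F) (fueter : fueter_system D F).
Variable k : 'I_8.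
Implicit Types a b c d h : R.

Definition apd (r h : nat) (a b : R) : R := pd F r h (col4 a b 0 0) k 0.

Lemma derivable_coord r (h : nat) (v : 'cV[R]_4) : (r < 4)%N -> (h < 4)%N -> ED D v ->
  derivable (fun w => F w (inord r) k 0) v (e4 R h) /\
  'D_(e4 R h) (fun w => F w (inord r) k 0) v = pd F r h v k 0.
Proof.
move=> r4 h4 Ev; have [df _] := C1 (inord r) h4 Ev.
have dk := (derivable_mxP _ _ _).1 df.
split; first exact: dk.
by rewrite /pd derive_mx // mxE.
Qed.

Lemma is_derive_coord r (h : nat) (gam : R -> 'cV[R]_4) s : (r < 4)%N -> (h < 4)%N ->
  (forall t, gam (t + s) = t *: e4 R h + gam s) -> ED D (gam s) ->
  is_derive s 1 (fun t => F (gam t) (inord r) k 0) (pd F r h (gam s) k 0).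
Proof.
move=> r4 h4 gE Ev; have [df <-] := derivable_coord r4 h4 Ev.
exact: (is_derive_line (f := fun w => F w (inord r) k 0) gE df).
Qed.

Lemma is_derive_a r a b : (r < 4)%N -> D (a, b) ->
  is_derive a 1 (fun s => F (col4 s b 0 0) (inord r) k 0) (apd r 0 a b).
Proof.
move=> r4 /(ED_axis Dsym) E.
apply: (@is_derive_coord r 0 (fun s => col4 s b 0 0) a r4 isT _ E) => t.
by rewrite col4D //= mul1r !mul0r !addr0 addrC.
Qed.

Lemma is_derive_b r a b : (r < 4)%N -> D (a, b) ->
  is_derive b 1 (fun s => F (col4 a s 0 0) (inord r) k 0) (apd r 1 a b).
Proof.
move=> r4 /(ED_axis Dsym) E.
apply: (@is_derive_coord r 1 (fun s => col4 a s 0 0) b r4 isT _ E) => t.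
by rewrite col4D //= mul1r !mul0r !addr0 addrC.
Qed.

Lemma cont2_apd r (h : nat) a b : (r < 4)%N -> (h < 4)%N -> D (a, b) -> cont2 (apd r h) a b.
Proof.
move=> r4 h4 /(ED_axis Dsym) E; have [_ c] := C1 (inord r) h4 E.
have c1 : (fun w => 'D_(e4 R h) (fun w => F w (inord r)) w k 0) @ nbhs (col4 a b 0 0) -->
    'D_(e4 R h) (fun w => F w (inord r)) (col4 a b 0 0) k 0.
  move=> A nA; apply: (c (fun M : 'cV[R]_8 => A (M k 0))).
  exact: (@coord_continuous R 8 1 k 0 _ A nA).
apply: near_cont2 => e e0.
have /nbhs_ballP[d /= d0 H] := (@cvgrPdist_le _ _ _ _ (nbhs_filter (col4 a b 0 0)) _ _).1 c1 _ e0.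
exists d => // a' b' ad bd; apply: H; split => // i j; rewrite (ord1 j) !mxE.
by case: (val i) => [|[|[|?]]]; rewrite ?(distrC a) ?(distrC b) /ball /= ?subrr ?normr0 // distrC.
Qed.

Lemma near_D (phi : R -> R) a : {for (0 : R), continuous phi} -> D (a, phi 0) ->
  \forall h \near (0 : R), D (a, phi h).
Proof.
move=> /cvgrPdist_lt c Da; have := open_nbhs_nbhs (conj Dopen Da).
move=> /nbhs_ballP[e /= e0 H]; have := c _ e0; apply: filterS => h hh.
by apply: H; split => /=; [exact: ballxx|exact: hh].
Qed.

Lemma near_ED_sqrt a b : D (a, b) ->
  \forall h \near (0 : R), D (a, Num.sqrt (b ^+ 2 + h ^+ 2)).
Proof.
move=> Dab; apply: (near_D (phi := fun h => Num.sqrt (b ^+ 2 + h ^+ 2))).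
  apply: continuous_cvg; first exact: sqrt_continuous.
  apply: cvgD; first exact: cvg_cst.
  exact: exprn_continuous.
by rewrite expr0n addr0 sqrtr_sqr; exact: Dabs.
Qed.

(** [F_2] vanishes where [x2 = 0] and [F_3] where [x3 = 0], so the mixed derivatives [d_3 F_2] and
    [d_2 F_3] drop out of the second Fueter equation. *)
Lemma axial_curl a b : D (a, b) -> apd 0 1 a b + apd 1 0 a b = 0.
Proof.
move=> Dab; have E := ED_axis Dsym Dab.
have nD := near_ED_sqrt Dab.
have d1 : apd 2 3 a b = 0.
  have d : is_derive (0 : R) 1 (fun t => F (col4 a b 0 t) (inord 2) k 0) (apd 2 3 a b).
    apply: (@is_derive_coord 2 3 (fun t => col4 a b 0 t) 0 isT isT _ E) => t.
    by rewrite col4D //= mul1r !mul0r !addr0 add0r.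
  apply: (derive_at0 (g := fun=> 0) d); first by rewrite (F2_refl stem E) mxE.
    apply: filterS nD => h Dh; rewrite mulr0 (F2_refl stem) ?mxE //.
    by apply/ED_col4; rewrite expr0n addr0.
  exact: cvg_cst.
have d2 : apd 3 2 a b = 0.
  have d : is_derive (0 : R) 1 (fun t => F (col4 a b t 0) (inord 3) k 0) (apd 3 2 a b).
    apply: (@is_derive_coord 3 2 (fun t => col4 a b t 0) 0 isT isT _ E) => t.
    by rewrite col4D //= mul1r !mul0r !addr0 add0r.
  apply: (derive_at0 (g := fun=> 0) d); first by rewrite (F3_refl stem E) mxE.
    apply: filterS nD => h Dh; rewrite mulr0 (F3_refl stem) ?mxE //.
    by apply/ED_col4; rewrite expr0n addr0.
  exact: cvg_cst.
have lin (A1 A2 A3 A4 : oct R) : A1 + A2 - A3 + A4 = 0 ->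
    A1 k 0 + A2 k 0 - A3 k 0 + A4 k 0 = 0.
  by move=> /(congr1 (fun M : oct R => M k 0)); rewrite !mxE.
have [_ /lin h _ _] := fueter E.
have {h} : apd 0 1 a b + apd 1 0 a b - apd 2 3 a b + apd 3 2 a b = 0 := h.
by rewrite d1 d2 subr0 addr0.
Qed.

(** By rotation and exchange of the last two axes, [d_2 F_2 = d_3 F_3 = F_1 / b] on the axis plane;
    the first Fueter equation does the rest. For [b = 0] both sides vanish by oddness. *)
Lemma axial_div a b : D (a, b) -> b * (apd 0 0 a b - apd 1 1 a b) = 2 * G1 F a b k 0.
Proof.
move=> Dab; have E := ED_axis Dsym Dab.
have [b0|b0] := eqVneq b 0.
  have := congr1 (fun M : oct R => M k 0) (G1_odd Dsym stem Dab).
  by rewrite b0 oppr0 !mxE mul0r => h; lra.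
(* The square root of [b ^ 2 + h ^ 2] with the sign of [b]: then [c 0 = b] also for negative [b],
   and the rotation starts at the identity. *)
pose c h := b * Num.sqrt (1 + (h / b) ^+ 2).
pose g h := (c h)^-1 * G1 F a (c h) k 0.
have c0 : c 0 = b by rewrite /c mul0r expr0n addr0 sqrtr1 mulr1.
have c2 h : c h ^+ 2 = b ^+ 2 + h ^+ 2.
  rewrite /c exprMn sqr_sqrtr ?addr_ge0 ?sqr_ge0 // mulrDr mulr1 expr_div_n.
  by rewrite mulrCA divff ?sqrf_eq0 // mulr1.
have cc : {for (0 : R), continuous c}.
  apply: cvgM; first exact: cvg_cst.
  apply: continuous_cvg; first exact: sqrt_continuous.
  apply: cvgD; first exact: cvg_cst.
  apply: (@continuous_cvg _ _ _ _ _ (fun h => h / b) (fun z : R => z ^+ 2)); first exact: exprn_continuous.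
  by apply: cvgM; [exact: cvg_id|exact: cvg_cst].
have nc : \forall h \near (0 : R), D (a, c h) by apply: near_D => //; rewrite c0.
have cg : {for (0 : R), continuous g}.
  apply: cvgM; first by apply: cvgV; [rewrite c0|exact: cc].
  have := is_derive_b (r := 1) isT Dab => /is_derive_cont cb.
  rewrite -c0 in cb; exact: continuous_cvg cb cc.
have gE : g 0 = G1 F a b k 0 / b by rewrite /g c0 mulrC.
have frot h : D (a, c h) -> F (col4 a b h 0) (inord 2) k 0 = h * g h.
  by move=> Dc; rewrite (F2_rot Dsym stem b0 (c2 h) Dc) mxE /g mulrA.
have f0 : F (col4 a b 0 0) (inord 2) k 0 = 0 by rewrite (F2_refl stem E) mxE.
have d2 : apd 2 2 a b = g 0.
  have d : is_derive (0 : R) 1 (fun t => F (col4 a b t 0) (inord 2) k 0) (apd 2 2 a b).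
    apply: (@is_derive_coord 2 2 (fun t => col4 a b t 0) 0 isT isT _ E) => t.
    by rewrite col4D //= mul1r !mul0r !addr0 add0r.
  by apply: (derive_at0 d f0) => //; apply: filterS nc => h; exact: frot.
have d3 : apd 3 3 a b = g 0.
  have d : is_derive (0 : R) 1 (fun t => F (col4 a b 0 t) (inord 3) k 0) (apd 3 3 a b).
    apply: (@is_derive_coord 3 3 (fun t => col4 a b 0 t) 0 isT isT _ E) => t.
    by rewrite col4D //= mul1r !mul0r !addr0 add0r.
  apply: (derive_at0 d); [by rewrite (F3_swap stem E)| |exact: cg].
  near=> h.
  have Dc : D (a, c h) by near: h; exact: nc.
  rewrite (F3_swap stem) ?frot //; apply/ED_col4; rewrite expr0n addr0.
  by near: h; exact: near_ED_sqrt.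
have lin (A1 A2 A3 A4 : oct R) : A1 - A2 - A3 - A4 = 0 ->
    A1 k 0 - A2 k 0 - A3 k 0 - A4 k 0 = 0.
  by move=> /(congr1 (fun M : oct R => M k 0)); rewrite !mxE.
have [/lin h _ _ _] := fueter E.
have {h} : apd 0 0 a b - apd 1 1 a b - apd 2 2 a b - apd 3 3 a b = 0 := h.
rewrite d2 d3 gE; move: (apd 0 0 a b) (apd 1 1 a b) (G1 F a b k 0) => e1 e2 e3 h.
have -> : e1 - e2 = 2 * (e3 / b) by lra.
by field.
Unshelve. all: by end_near.
Qed.

End AxialSystem.

Lemma min_max_norm (R : realType) (c z t : R) : `|z| < c ->
  Num.min 0 z <= t <= Num.max 0 z -> `|t| < c.
Proof.
rewrite ge_min le_max !ltr_norml => /andP[? ?] /andP[/orP[?|?] /orP[?|?]];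
by apply/andP; split; lra.
Qed.

(** * Rescaling to the square of half-side 2 *)

Section LocalScaling.
Variables (R : realType) (D : set (R * R)).
Hypothesis Dopen : open D.
Implicit Types (u ux uy : R -> R -> R) (a b rho M : R).

Definition C1D u ux uy := forall a b, D (a, b) ->
  [/\ is_derive a 1 (u^~ b) (ux a b), is_derive b 1 (u a) (uy a b),
      cont2 ux a b & cont2 uy a b].

Definition rescale a b rho u := fun X Y => u (a + rho * X) (b + rho * Y).

Lemma C1sq_le c M M' u ux uy : M <= M' -> C1sq c M u ux uy -> C1sq c M' u ux uy.
Proof.
move=> MM C x y xc yc; have [d1 d2 c1 c2 [m1 m2 m3]] := C x y xc yc.
by split=> //; split; [exact: le_trans m1 MM|exact: le_trans m2 MM|exact: le_trans m3 MM].
Qed.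

Lemma is_derive_affine (f : R -> R) (a rho X d : R) :
  is_derive (a + rho * X) 1 f d -> is_derive X 1 (fun s => f (a + rho * s)) (rho * d).
Proof.
move=> df.
have da : is_derive X 1 (fun s => a + rho * s) rho.
  apply: (is_derive_to (is_derive_addf (is_derive_cstf a X)
    (is_derive_mulf (is_derive_cstf rho X) (is_derive_idf X)))); ring.
apply: (is_derive_to (@is_derive1_comp _ f (fun s => a + rho * s) X _ _ df da)).
exact: mulrC.
Qed.

Lemma cont2_rescale a b rho u X Y : cont2 u (a + rho * X) (b + rho * Y) ->
  cont2 (fun X Y => rho * rescale a b rho u X Y) X Y.
Proof.
move=> c; apply: cvgM; first exact: cvg_cst.
apply: (@cont2_path _ _ (nbhs (X, Y)) _ u (fun z : R * R => a + rho * z.1)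
  (fun z : R * R => b + rho * z.2) _ _ c).
  apply: cvgD; first exact: cvg_cst.
  by apply: cvgM; [exact: cvg_cst|exact: cvg_fst].
apply: cvgD; first exact: cvg_cst.
by apply: cvgM; [exact: cvg_cst|exact: cvg_snd].
Qed.

(** [M] does not depend on [rho], so one [rho] can be chosen for two functions. As [rho <= 1], the
    bound [K] of the partial derivatives near [(a, b)] survives, and two legs of length below 2
    bound the function by [|u a b| + 4 K]. *)
Lemma C1D_rescale u ux uy a b : C1D u ux uy -> D (a, b) ->
  exists2 r0 : R, 0 < r0 & exists M : R, forall rho, 0 < rho -> rho <= r0 ->
    C1sq 2 M (rescale a b rho u) (fun X Y => rho * rescale a b rho ux X Y)
      (fun X Y => rho * rescale a b rho uy X Y) /\
    forall X Y, `|X| < 2 -> `|Y| < 2 -> D (a + rho * X, b + rho * Y).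
Proof.
move=> C Dab; have [_ _ cx cy] := C _ _ Dab.
have [d1 d10 H1] := cont2_near cx ltr01; have [d2 d20 H2] := cont2_near cy ltr01.
have /nbhs_ballP[d3 /= d30 H3] := open_nbhs_nbhs (conj Dopen Dab).
pose r0 := Num.min 1 (Num.min (d1 / 2) (Num.min (d2 / 2) (d3 / 2))).
have r00 : 0 < r0 by rewrite !lt_min ltr01 !divr_gt0.
pose K : R := 1 + `|ux a b| + `|uy a b|.
exists r0 => //; exists (`|u a b| + 4 * K) => rho rho0.
rewrite !le_min => /andP[rho1 /andP[rd1 /andP[rd2 rd3]]].
have small (X d : R) : `|X| < 2 -> rho <= d / 2 -> `|rho * X| < d.
  move=> X2 rd; rewrite normrM (gtr0_norm rho0).
  by apply: lt_le_trans (_ : rho * 2 <= d); [rewrite ltr_pM2l|lra].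
have shift (c X d : R) : `|X| < 2 -> rho <= d / 2 -> `|c + rho * X - c| < d.
  by move=> X2 rd; rewrite addrAC subrr add0r; exact: small.
have inD (X Y : R) : `|X| < 2 -> `|Y| < 2 -> D (a + rho * X, b + rho * Y).
  move=> X2 Y2; apply: H3; split; rewrite /ball /= distrC; exact: shift.
have K1 : 1 <= K by rewrite /K -addrA lerDl addr_ge0.
have bx (X Y : R) : `|X| < 2 -> `|Y| < 2 -> `|rho * rescale a b rho ux X Y| <= K.
  move=> X2 Y2; have h := H1 _ _ (shift a _ _ X2 rd1) (shift b _ _ Y2 rd1).
  have {}h : `|rescale a b rho ux X Y| <= K.
    rewrite /rescale -[X in `|X|](subrK (ux a b)); apply: le_trans (ler_normD _ _) _.
    by rewrite /K distrC; have := normr_ge0 (uy a b); lra.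
  by rewrite normrM (gtr0_norm rho0) -[leRHS]mul1r ler_pM // ltW.
have by_ (X Y : R) : `|X| < 2 -> `|Y| < 2 -> `|rho * rescale a b rho uy X Y| <= K.
  move=> X2 Y2; have h := H2 _ _ (shift a _ _ X2 rd2) (shift b _ _ Y2 rd2).
  have {}h : `|rescale a b rho uy X Y| <= K.
    rewrite /rescale -[X in `|X|](subrK (uy a b)); apply: le_trans (ler_normD _ _) _.
    by rewrite /K distrC; have := normr_ge0 (ux a b); lra.
  by rewrite normrM (gtr0_norm rho0) -[leRHS]mul1r ler_pM // ltW.
have dX (X Y : R) : `|X| < 2 -> `|Y| < 2 ->
    is_derive X 1 ((rescale a b rho u)^~ Y) (rho * rescale a b rho ux X Y).
  move=> X2 Y2; have [d _ _ _] := C _ _ (inD X Y X2 Y2).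
  exact: (is_derive_affine (f := u^~ (b + rho * Y)) d).
have dY (X Y : R) : `|X| < 2 -> `|Y| < 2 ->
    is_derive Y 1 (rescale a b rho u X) (rho * rescale a b rho uy X Y).
  move=> X2 Y2; have [_ d _ _] := C _ _ (inD X Y X2 Y2).
  exact: is_derive_affine.
have btw := @min_max_norm R 2.
have z2 : `|0 : R| < 2 by rewrite normr0.
split=> // X Y X2 Y2; have [d1' d2' c1 c2] := C _ _ (inD X Y X2 Y2).
split; [exact: dX|exact: dY|exact: cont2_rescale|exact: cont2_rescale|].
have u0 := normr_ge0 (u a b).
have := bx _ _ X2 Y2; have := by_ _ _ X2 Y2 => m1 m2.
split; [|lra|lra].
have [t tb e1] : exists2 t, `|t| < 2 & rescale a b rho u X Y - rescale a b rho u 0 Y =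
    rho * rescale a b rho ux t Y * (X - 0).
  have [t tb|t /(btw _ _ X2) tb ->] := @MVT_between _ ((rescale a b rho u)^~ Y)
    (fun X => rho * rescale a b rho ux X Y) 0 X; last by exists t.
  exact: dX (btw _ _ X2 tb) Y2.
have [s sb e2] : exists2 s, `|s| < 2 & rescale a b rho u 0 Y - rescale a b rho u 0 0 =
    rho * rescale a b rho uy 0 s * (Y - 0).
  have [t' tb'|t' /(btw _ _ Y2) tb' ->] := @MVT_between _ (rescale a b rho u 0)
    (fun Y => rho * rescale a b rho uy 0 Y) 0 Y; last by exists t'.
  exact: dY z2 (btw _ _ Y2 tb').
have E : rescale a b rho u X Y = u a b + (rescale a b rho u X Y - rescale a b rho u 0 Y) +
   (rescale a b rho u 0 Y - rescale a b rho u 0 0).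
  by rewrite {5}/rescale !mulr0 !addr0; ring.
rewrite E e1 e2 !subr0; apply: le_trans (ler_normD _ _) _.
have b1 : `|rho * rescale a b rho ux t Y * X| <= K * 2.
  by rewrite normrM ler_pM // ?bx // ltW.
have b2 : `|rho * rescale a b rho uy 0 s * Y| <= K * 2.
  by rewrite normrM ler_pM // ?by_ // ltW.
have := ler_normD (u a b) (rho * rescale a b rho ux t Y * X); lra.
Qed.

End LocalScaling.

(** * Analyticity of the two axial components *)

Section AxialGermF.
Variables (R : realType) (D : set (R * R)) (F : 'cV[R]_4 -> 'I_4 -> oct R).
Hypotheses (Dopen : open D) (Dsym : forall a b, D (a, b) -> D (a, - b)).
Hypotheses (stem : o3_stem D F) (C1 : C1_on D F) (fueter : fueter_system D F).
Variables (k : 'I_8) (n : nat).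
Implicit Types (p x : 'cV[R]_n.+2).

Let u a b := G0 F a b k 0.
Let v a b := G1 F a b k 0.

Lemma axial_germs p : D (p ord0 0, Num.sqrt (imsq p)) ->
  germ_analytic p (fun x => u (x ord0 0) (Num.sqrt (imsq x))) /\
  exists2 g, germ_analytic p g & \forall x \near p, imsq x != 0 ->
    g x = v (x ord0 0) (Num.sqrt (imsq x)) / Num.sqrt (imsq x).
Proof.
move=> Dp; set a := p ord0 0 in Dp *; set b := Num.sqrt (imsq p) in Dp *.
have Cu : C1D D u (apd F k 0 0) (apd F k 0 1).
  move=> c d Dcd; split.
  - exact: (is_derive_a Dsym C1 k (r := 0) isT Dcd).
  - exact: (is_derive_b Dsym C1 k (r := 0) isT Dcd).
  - by apply: (@cont2_apd _ _ _ Dsym C1 k 0 0).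
  - by apply: (@cont2_apd _ _ _ Dsym C1 k 0 1).
have Cv : C1D D v (apd F k 1 0) (apd F k 1 1).
  move=> c d Dcd; split.
  - exact: (is_derive_a Dsym C1 k (r := 1) isT Dcd).
  - exact: (is_derive_b Dsym C1 k (r := 1) isT Dcd).
  - by apply: (@cont2_apd _ _ _ Dsym C1 k 1 0).
  - by apply: (@cont2_apd _ _ _ Dsym C1 k 1 1).
have [r1 r10 [M1 H1]] := C1D_rescale Dopen Cu Dp.
have [r2 r20 [M2 H2]] := C1D_rescale Dopen Cv Dp.
pose rho := Num.min r1 r2.
have rho0 : 0 < rho by rewrite lt_min r10.
have [Cu' inD] := H1 rho rho0 (ltac:(by rewrite ge_min lexx)).
have [Cv' _] := H2 rho rho0 (ltac:(by rewrite ge_min lexx orbT)).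
pose M := Num.max M1 M2.
have {}Cu' := C1sq_le (_ : M1 <= M) Cu'.
have {}Cv' := C1sq_le (_ : M2 <= M) Cv'.
have {}Cu' := Cu' (ltac:(by rewrite le_max lexx)).
have {}Cv' := Cv' (ltac:(by rewrite le_max lexx orbT)).
have E1 (X Y : R) : `|X| < 2 -> `|Y| < 2 ->
   rho * rescale a b rho (apd F k 0 1) X Y + rho * rescale a b rho (apd F k 1 0) X Y = 0.
  move=> X2 Y2; rewrite -mulrDr /rescale.
  by rewrite (axial_curl Dopen Dsym stem C1 fueter) ?mulr0 //; exact: inD.
have E2 (X Y : R) : `|X| < 2 -> `|Y| < 2 ->
   (b + rho * Y) * (rho * rescale a b rho (apd F k 0 0) X Y -
     rho * rescale a b rho (apd F k 1 1) X Y) = 2 * rho * rescale a b rho v X Y.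
  move=> X2 Y2; rewrite -mulrBr /rescale mulrCA.
  rewrite (axial_div Dopen Dsym stem C1 fueter) //; last exact: inD.
  by rewrite /v; ring.
have rn : rho != 0 by rewrite gt_eqF.
have back (c z : R) : c + rho * ((z - c) / rho) = z by field.
have [p0|p0] := eqVneq (imsq p) 0.
  have b0 : b = 0 by rewrite /b p0 sqrtr0.
  have E2' (X Y : R) : `|X| < 2 -> `|Y| < 2 ->
    (0 + rho * Y) * (rho * rescale a b rho (apd F k 0 0) X Y -
     rho * rescale a b rho (apd F k 1 1) X Y) = 2 * rho * rescale a b rho v X Y.
    by move=> X2 Y2; rewrite -E2 // b0.
  have ev (X Y : R) : `|X| < 2 -> `|Y| < 2 -> rescale a b rho u X (- Y) = rescale a b rho u X Y.
    move=> X2 Y2; have := inD X Y X2 Y2.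
    by rewrite /rescale /u b0 !add0r mulrN => DXY; rewrite (G0_even Dsym stem DXY).
  have od (X Y : R) : `|X| < 2 -> `|Y| < 2 -> rescale a b rho v X (- Y) = - rescale a b rho v X Y.
    move=> X2 Y2; have := inD X Y X2 Y2.
    by rewrite /rescale /v b0 !add0r mulrN => DXY; rewrite (G1_odd Dsym stem DXY) mxE.
  have [gu [g gg gv]] := germ_real p0 rho0 Cu' Cv' E1 E2' ev od.
  have Yb (z : R) : b + rho * (z / rho) = z by rewrite b0 add0r mulrC divfK.
  split.
    apply: germ_analytic_near gu _; apply: filterE => x.
    by rewrite /rescale back Yb.
  exists g => //; apply: (@filterS _ (nbhs p) (nbhs_filter p) _ _ _ gv) => x h x0.
  by rewrite h // /rescale back Yb.
have ip : 0 < imsq p by rewrite lt_neqAle eq_sym p0 imsq_ge0.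
have [gu gv] := germ_nonreal ip rho0 Cu' Cv' E1 E2.
split.
  apply: germ_analytic_near gu _; apply: filterE => x.
  by rewrite /rescale !back.
eexists; first exact: gv.
by apply: filterE => x _; rewrite /rescale !back.
Qed.

End AxialGermF.

(** * Octonions *)

Section OctonionCoordinates.
Variable R : realType.
Implicit Types x y I J : oct R.

Lemma ord8_ind (P : 'I_8 -> Prop) :
  (forall i, (i < 8)%N -> P (inord i)) -> forall i, P i.
Proof. by move=> H i; rewrite -(inord_val i); exact: H. Qed.

(** Octonion product read on sequences of coordinates: explicit enough for [ring] and [lra], and
    applicable to coordinates that are merely functions, as the germs of [v / b] are. *)
Definition omc (i : nat) (X Y : nat -> R) : R :=
  let a := Quat (X 0%N) (X 1%N) (X 2%N) (X 3%N) in
  let b := Quat (X 4%N) (X 5%N) (X 6%N) (X 7%N) in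
  let c := Quat (Y 0%N) (Y 1%N) (Y 2%N) (Y 3%N) in
  let d := Quat (Y 4%N) (Y 5%N) (Y 6%N) (Y 7%N) in
  let s := qsub (qmul a c) (qmul d (qconj b)) in
  let t := qadd (qmul (qconj a) d) (qmul c b) in
  match i with 0 => qr s | 1 => qi s | 2 => qj s | 3 => qk s
             | 4 => qr t | 5 => qi t | 6 => qj t | _ => qk t end.

Lemma omulE i x y : (i < 8)%N -> omul x y (inord i) 0 =
  omc i (fun j => x (inord j) 0) (fun j => y (inord j) 0).
Proof. by move=> i8; rewrite /omul /mkO [LHS]mxE /= inordK. Qed.

Lemma ooneE i : (i < 8)%N -> oone R (inord i) 0 = (i == 0)%:R.
Proof. by move=> i8; rewrite /oone /mkO [LHS]mxE /= inordK //; case: i i8 => [|[|[|[|[|[|[|[|]]]]]]]]. Qed.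

Lemma sum8 (V : nmodType) (f : 'I_8 -> V) : \sum_(s < 8) f s =
  f (inord 0) + f (inord 1) + f (inord 2) + f (inord 3) + f (inord 4) + f (inord 5)
  + f (inord 6) + f (inord 7).
Proof.
rewrite !big_ord_recl big_ord0 addr0 !addrA.
by congr (f _ + f _ + f _ + f _ + f _ + f _ + f _ + f _); apply/val_inj; rewrite /= inordK.
Qed.

Lemma imsq8 x : imsq x = x (inord 1) 0 ^+ 2 + x (inord 2) 0 ^+ 2 + x (inord 3) 0 ^+ 2 +
  x (inord 4) 0 ^+ 2 + x (inord 5) 0 ^+ 2 + x (inord 6) 0 ^+ 2 + x (inord 7) 0 ^+ 2.
Proof.
rewrite /imsq !big_ord_recl big_ord0 addr0 !addrA.
by do ![congr (_ + _)|congr (x _ _ ^+ _)]; apply/val_inj; rewrite /= inordK.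
Qed.

Lemma inord0 : inord 0 = ord0 :> 'I_8.
Proof. by apply/val_inj; rewrite /= inordK. Qed.

Lemma osphereP I : osphere I <-> I (inord 0) 0 = 0 /\ imsq I = 1.
Proof.
split.
  move=> h; have {h} H i : (i < 8)%N ->
      omc i (fun j => I (inord j) 0) (fun j => I (inord j) 0) = - (i == 0)%:R.
    by move=> i8; rewrite -omulE // h mxE ooneE.
  have := H 0%N isT; have := H 1%N isT; have := H 2%N isT; have := H 3%N isT.
  have := H 4%N isT; have := H 5%N isT; have := H 6%N isT; have := H 7%N isT.
  rewrite imsq8 /omc /=.
  move: (I (inord 0) 0) (I (inord 1) 0) (I (inord 2) 0) (I (inord 3) 0)
    (I (inord 4) 0) (I (inord 5) 0) (I (inord 6) 0) (I (inord 7) 0).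
  move=> a b c d e f g h h7 h6 h5 h4 h3 h2 h1 h0.
  have [a0|a0] := eqVneq a 0.
    by rewrite a0 in h0 *; split=> //; lra.
  (* The imaginary coordinates of the square are twice the real part [a] times those of [I]. If [a]
     were nonzero they would all vanish, leaving [a ^ 2 = - 1]. *)
  have z t : 2 * (a * t) = 0 -> t = 0.
    by move=> /eqP; rewrite !mulf_eq0 pnatr_eq0 (negbTE a0) => /eqP.
  exfalso; have b0 : b = 0 by apply: z; lra.
  have c0 : c = 0 by apply: z; lra.
  have d0 : d = 0 by apply: z; lra.
  have e0 : e = 0 by apply: z; lra.
  have f0 : f = 0 by apply: z; lra.
  have g0 : g = 0 by apply: z; lra.
  have hh : h = 0 by apply: z; lra.
  move: h0; rewrite b0 c0 d0 e0 f0 g0 hh; have := sqr_ge0 a; lra.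
rewrite imsq8 => -[I0 I1]; apply/matrixP => i j; rewrite (ord1 j).
elim/ord8_ind: i => i i8; rewrite omulE // mxE ooneE //.
move: I1; rewrite /omc /= I0.
by case: i i8 => [|[|[|[|[|[|[|[|]]]]]]]] //= _ h; lra.
Qed.

Definition ovec (X : nat -> R) : oct R := \col_i X i.

Lemma ovecE X i : (i < 8)%N -> ovec X (inord i) 0 = X i.
Proof. by move=> i8; rewrite mxE inordK. Qed.

(** [o3_induces] speaks of orthogonal pairs, so a partner is needed: a quarter turn in the first two
    imaginary coordinates, or the unit [i] itself when both vanish. *)
Lemma osphere_perp I : osphere I -> exists J, oN (I, J).
Proof.
move=> sI; have /osphereP[I0 I1] := sI.
pose s := I (inord 1) 0 ^+ 2 + I (inord 2) 0 ^+ 2.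
have [s0|s0] := eqVneq s 0.
  have [i1 i2] : I (inord 1) 0 = 0 /\ I (inord 2) 0 = 0.
    move/eqP: s0; rewrite paddr_eq0 ?sqr_ge0 // !sqrf_eq0.
    by move=> /andP[/eqP -> /eqP ->].
  exists (ovec (fun i => (i == 1)%:R)); split=> //; split.
    by apply/osphereP; rewrite imsq8 !ovecE //=; split; ring.
  by rewrite /odot sum8 !ovecE //= i1; ring.
have sp : 0 < s by rewrite lt_neqAle eq_sym s0 addr_ge0 ?sqr_ge0.
pose t := (Num.sqrt s)^-1.
have t2 : t ^+ 2 * s = 1 by rewrite /t exprVn sqr_sqrtr ?ltW // mulVf.
exists (ovec (fun i => match i with 1 => - t * I (inord 2) 0 | 2 => t * I (inord 1) 0 | _ => 0 end)).
split=> //; split.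
  apply/osphereP; rewrite imsq8 !ovecE //=; split=> //.
  by move: t2; rewrite /s => t2; rewrite -t2; ring.
by rewrite /odot sum8 !ovecE //=; ring.
Qed.

Lemma omul0 x : omul x 0 = 0.
Proof.
apply/matrixP => i j; rewrite (ord1 j).
elim/ord8_ind: i => i i8; rewrite omulE // mxE /omc /= !mxE.
by case: i i8 => [|[|[|[|[|[|[|[|]]]]]]]] //= _; ring.
Qed.

Section GermQuat.
Variables (n : nat) (p : 'cV[R]_n).
Implicit Types a b : 'cV[R]_n -> quat R.

Definition germ_quat a := [/\ germ_analytic p (fun z => qr (a z)),
  germ_analytic p (fun z => qi (a z)), germ_analytic p (fun z => qj (a z)) &
  germ_analytic p (fun z => qk (a z))].

Lemma germ_qadd a b : germ_quat a -> germ_quat b -> germ_quat (fun z => qadd (a z) (b z)).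
Proof. by move=> [? ? ? ?] [? ? ? ?]; split; apply: germ_analyticD. Qed.

Lemma germ_qsub a b : germ_quat a -> germ_quat b -> germ_quat (fun z => qsub (a z) (b z)).
Proof. by move=> [? ? ? ?] [? ? ? ?]; split; apply: germ_analyticB. Qed.

Lemma germ_qconj a : germ_quat a -> germ_quat (fun z => qconj (a z)).
Proof. by move=> [? ? ? ?]; split=> //; apply: germ_analyticN. Qed.

Lemma germ_qmul a b : germ_quat a -> germ_quat b -> germ_quat (fun z => qmul (a z) (b z)).
Proof.
move=> [r1 i1 j1 k1] [r2 i2 j2 k2]; split.
- exact: germ_analyticB (germ_analyticB (germ_analyticB (germ_analyticM r1 r2)
    (germ_analyticM i1 i2)) (germ_analyticM j1 j2)) (germ_analyticM k1 k2).
- exact: germ_analyticB (germ_analyticD (germ_analyticD (germ_analyticM r1 i2)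
    (germ_analyticM i1 r2)) (germ_analyticM j1 k2)) (germ_analyticM k1 j2).
- exact: germ_analyticD (germ_analyticD (germ_analyticB (germ_analyticM r1 j2)
    (germ_analyticM i1 k2)) (germ_analyticM j1 r2)) (germ_analyticM k1 i2).
- exact: germ_analyticD (germ_analyticB (germ_analyticD (germ_analyticM r1 k2)
    (germ_analyticM i1 j2)) (germ_analyticM j1 i2)) (germ_analyticM k1 r2).
Qed.

Lemma germ_omc (X Y : 'cV[R]_n -> nat -> R) i :
  (forall j, germ_analytic p (X^~ j)) -> (forall j, germ_analytic p (Y^~ j)) ->
  germ_analytic p (fun z => omc i (X z) (Y z)).
Proof.
move=> gX gY.
have g4 (Z : 'cV[R]_n -> nat -> R) i0 i1 i2 i3 : (forall j, germ_analytic p (Z^~ j)) ->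
    germ_quat (fun z => Quat (Z z i0) (Z z i1) (Z z i2) (Z z i3)).
  by move=> gZ; split; exact: gZ.
have ga := g4 X 0%N 1%N 2%N 3%N gX; have gb := g4 X 4%N 5%N 6%N 7%N gX.
have gc := g4 Y 0%N 1%N 2%N 3%N gY; have gd := g4 Y 4%N 5%N 6%N 7%N gY.
have [s0 s1 s2 s3] := germ_qsub (germ_qmul ga gc) (germ_qmul gd (germ_qconj gb)).
have [t0 t1 t2 t3] := germ_qadd (germ_qmul (germ_qconj ga) gd) (germ_qmul gc gb).
by case: i => [|[|[|[|[|[|[|i]]]]]]].
Qed.

End GermQuat.

Lemma slice_pointE (a b : R) I i : (i < 8)%N ->
  (oreal a + b *: I) (inord i) 0 = a * (i == 0)%:R + b * I (inord i) 0.
Proof. by move=> i8; rewrite !mxE -ooneE // mxE. Qed.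

Lemma coord_osphere x a (b : R) I : osphere I -> x = oreal a + b *: I ->
  x (inord 0) 0 = a /\ imsq x = b ^+ 2.
Proof.
move=> /osphereP[I0 I1] ->.
split; first by rewrite slice_pointE //= I0 mulr1 mulr0 addr0.
rewrite imsq8 !slice_pointE //= !mulr0 !add0r; move: I1; rewrite imsq8 => I1.
by rewrite -[RHS]mulr1 -I1; ring.
Qed.

(* For [imsq x = 0] the factor [Y] is irrelevant, so [G1 / 0] may be junk. *)
Lemma slice_value (D : set (R * R)) (F : 'cV[R]_4 -> 'I_4 -> oct R) (f : oct R -> oct R) x
    (Y : nat -> R) :
  (forall a b, D (a, b) -> D (a, - b)) -> o3_stem D F -> o3_induces D F f ->
  D (x (inord 0) 0, Num.sqrt (imsq x)) ->
  (imsq x != 0 -> forall j, (j < 8)%N -> Y j = G1 F (x (inord 0) 0) (Num.sqrt (imsq x))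
     (inord j) 0 / Num.sqrt (imsq x)) ->
  forall i, (i < 8)%N -> f x (inord i) 0 =
    G0 F (x (inord 0) 0) (Num.sqrt (imsq x)) (inord i) 0 +
    omc i (fun j => if j == 0 then 0 else x (inord j) 0) Y.
Proof.
move=> Dsym stem ind; set a := x (inord 0) 0; set b := Num.sqrt (imsq x) => Dab YE i i8.
(* At an axis point the components [F_2] and [F_3] vanish, so the inducing formula becomes the slice
   formula and [J] disappears. *)
have val I : osphere I -> f (oreal a + b *: I) = G0 F a b + omul I (G1 F a b).
  move=> sI; have [J nJ] := osphere_perp sI.
  have E := ED_axis Dsym Dab; have := ind _ E I J nJ.
  rewrite /c4; have [-> -> -> ->] := col4E a b (0 : R) 0.
  by rewrite !scale0r !addr0 (F2_refl stem E) (F3_refl stem E) !omul0 !addr0.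
have [x0|x0] := eqVneq (imsq x) 0.
  have b0 : b = 0 by rewrite /b x0 sqrtr0.
  have xi j : (j < 7)%N -> x (inord j.+1) 0 = 0.
    move=> j7; have -> : inord j.+1 = lift ord0 (inord j) :> 'I_8.
      by apply/val_inj; rewrite /= !inordK.
    exact: imsq0P x0 _.
  pose I : oct R := ovec (fun i => (i == 1)%:R).
  have sI : osphere I by apply/osphereP; rewrite imsq8 !ovecE //=; split; ring.
  have G10 : G1 F a b = 0.
    by apply: eqN0; rewrite -(G1_odd Dsym stem Dab) b0 oppr0.
  have xE : x = oreal a + b *: I.
    apply/matrixP => k j; rewrite (ord1 j); elim/ord8_ind: k => k k8.
    rewrite b0 scale0r addr0 mxE ooneE //.
    by case: k k8 => [|k] k8 /=; [rewrite mulr1|rewrite mulr0 xi].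
  rewrite {1}xE (val _ sI) G10 omul0 addr0 -[LHS]addr0; congr (_ + _).
  rewrite /omc /= !xi //.
  by case: i i8 => [|[|[|[|[|[|[|[|]]]]]]]] //= _; ring.
have ip : 0 < imsq x by rewrite lt_neqAle eq_sym x0 imsq_ge0.
have b0 : 0 < b by rewrite sqrtr_gt0.
have b2 : b ^+ 2 = imsq x by rewrite sqr_sqrtr // ltW.
pose I : oct R := ovec (fun j => (if j == 0%N then 0 else x (inord j) 0) / b).
have bn : b != 0 by rewrite gt_eqF.
have sI : osphere I.
  apply/osphereP; rewrite imsq8 !ovecE //=; split; first by rewrite mul0r.
  rewrite !expr_div_n -!mulrDl -imsq8 b2 divff //.
have xE : x = oreal a + b *: I.
  apply/matrixP => k j; rewrite (ord1 j); elim/ord8_ind: k => k k8.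
  rewrite slice_pointE // ovecE //.
  case: k k8 => [|k] k8 /=; first by rewrite mul0r mulr0 mulr1 addr0.
  by rewrite mulr0 add0r mulrC divfK.
rewrite {1}xE (val _ sI) mxE; congr (_ + _).
rewrite omulE // /omc !ovecE // !(YE x0) // -/a -/b.
by case: i i8 => [|[|[|[|[|[|[|[|]]]]]]]] //= _; field.
Qed.

End OctonionCoordinates.

Theorem theorem2p2 (R : realType) (D : set (R * R)) (f : oct R -> oct R) :
  open D -> D !=set0 -> (forall a b, D (a, b) -> D (a, - b)) ->
  connected (OmegaD D) ->
  slice_fueter_regular D f ->
  real_analytic_on (OmegaD D) f.
Proof.
move=> Dopen _ Dsym _ [F [stem C1 fueter ind]] p [a [b [I [Dab [sI pE]]]]] k.
have [p0 pi2] := coord_osphere sI pE.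
have Dp : D (p ord0 0, Num.sqrt (imsq p)).
  by rewrite -inord0 p0 pi2 sqrtr_sqr; exact: Dabs.
have germs j := axial_germs Dopen Dsym stem C1 fueter j Dp.
have gex j : exists g, germ_analytic p g /\ \forall x \near p, imsq x != 0 ->
    g x = G1 F (x ord0 0) (Num.sqrt (imsq x)) j 0 / Num.sqrt (imsq x).
  by have [_ [g g1 g2]] := germs j; exists g.
have [g Hg] := choice gex.
(* [X] is the imaginary part of [x] and [Y] the analytic germ that extends [v / b]; near [p] the
   function is [u] plus their octonion product. *)
pose Y (x : 'cV[R]_8) (j : nat) := g (inord j) x; pose X (x : 'cV[R]_8) (j : nat) := if j == 0%N then 0 else x (inord j) 0.
have gX j : germ_analytic p (X^~ j).
  by rewrite /X; case: j => [|j]; [exact: germ_analytic_cst|exact: germ_analytic_coord].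
have gY j : germ_analytic p (Y^~ j) by have [] := Hg (inord j).
apply: germ_analyticP.
apply: germ_analytic_near (germ_analyticD (germs k).1 (germ_omc (val k) gX gY)) _.
(* [slice_value] needs the point [(Re x, |Im x|)] in [D]; openness of [D] and continuity of the
   square root give this near [p]. *)
have nD : \forall x \near p, D ((x : 'cV[R]_8) ord0 0, Num.sqrt (imsq x)).
  have c : (fun x : 'cV[R]_8 => Num.sqrt (imsq x)) @ nbhs p --> Num.sqrt (imsq p).
    apply: (@continuous_cvg _ _ _ (nbhs p) (nbhs_filter p) (@imsq R 6)).
      exact: sqrt_continuous.
    exact: imsq_continuous.
  have /nbhs_ballP[e /= e0 H] := open_nbhs_nbhs (conj Dopen Dp).
  have c' := (@cvgrPdist_lt _ _ _ _ (nbhs_filter p) _ _).1 c _ e0.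
  have pb : nbhs p (ball p e) by apply/nbhs_ballP; exists e.
  apply: (@filterS2 _ (nbhs p) (nbhs_filter p) _ _ _ _ pb c') => x [_ px] cx.
  by apply: H; split=> //=; exact: px.
have nY : \forall x \near p, forall j : 'I_8, imsq x != 0 ->
    g j x = G1 F (x ord0 0) (Num.sqrt (imsq x)) j 0 / Num.sqrt (imsq x).
  apply: (@filter_forall _ _ _ (nbhs p) (nbhs_filter p)) => j.
  by have [_] := Hg j.
apply: (@filterS2 _ (nbhs p) (nbhs_filter p) _ _ _ _ nD nY) => x Dx Yx.
have YE : imsq x != 0 -> forall j, (j < 8)%N -> Y x j =
    G1 F (x (inord 0) 0) (Num.sqrt (imsq x)) (inord j) 0 / Num.sqrt (imsq x).
  by move=> x0 j j8; rewrite inord0; exact: Yx.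
rewrite -inord0 in Dx *.
by rewrite -[in RHS](inord_val k) (slice_value Dsym stem ind Dx YE) // inord_val.
Qed.
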